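(* Let $\Phi:\mathbb{R}^2\to\mathbb{R}^2$ be a smooth mapping, let $\Sigma=\{x\in\mathbb{R}^2:\Phi(x)=x\}$, and let $S(x)=\sigma(\Phi(x),x)$, where $\sigma(x,x')=\tfrac12|x-x'|^2$. Assume: ($\Phi$.1) $\Sigma$ is a one-point set, $\Sigma=\{\xi_0\}$. ($\Phi$.2) There exist constants $p>0$, $R>0$, $C>0$ such that for any $x\in\mathbb{R}^2$, if $\sigma(x,0)>\frac{R^2}{2}$, then $S(x)\geqslant C[\sigma(x,0)]^p$. ($\Phi$.3) $\xi_0$ is a non-degenerate critical point of $S$. Then the first coefficients of the asymptotic expansion $\Theta_\Phi(t)\sim\sum_{k=0}^\infty t^kA_k$ as $t\to0^+$ are $$A_0=\sqrt{\det Q},$$ $$A_1=\sqrt{\det Q}\left[-\tfrac14S_{[4]}+\tfrac14S_{[2]\nu_1}S_{[2]\nu_2}Q^{\nu_1\nu_2}+\tfrac16S_{\nu_1\nu_2\nu_3}S_{\nu_4\nu_5\nu_6}Q^{\nu_1\nu_4}Q^{\nu_2\nu_5}Q^{\nu_3\nu_6}\right],$$ $$\begin{aligned} A_2=\sqrt{\det Q}\Big[&-\tfrac1{12}S_{[6]}+\tfrac14S_{[2]\nu_1}S_{[4]\nu_2}Q^{\nu_1\nu_2}+\tfrac13S_{\nu_1\nu_2\nu_3}S_{[2]\nu_4\nu_5\nu_6}Q^{\nu_1\nu_4}Q^{\nu_2\nu_5}Q^{\nu_3\nu_6}\\ &+\tfrac1{32}S_{[4]}S_{[4]}+\tfrac14S_{[2]\nu_1\nu_2}S_{[2]\nu_3\nu_4}Q^{\nu_1\nu_3}Q^{\nu_2\nu_4}\\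 &+\tfrac1{12}S_{\nu_1\nu_2\nu_3\nu_4}S_{\nu_5\nu_6\nu_7\nu_8}Q^{\nu_1\nu_5}Q^{\nu_2\nu_6}Q^{\nu_3\nu_7}Q^{\nu_4\nu_8}-\tfrac1{16}S_{[2]\nu_1}S_{[2]\nu_2}S_{[4]}Q^{\nu_1\nu_2}\\ &-\tfrac12S_{[2]\nu_1}S_{\nu_2\nu_3\nu_4}S_{[2]\nu_5\nu_6}Q^{\nu_1\nu_2}Q^{\nu_3\nu_5}Q^{\nu_4\nu_6}-\tfrac14S_{[2]\nu_1}S_{[2]\nu_2}S_{[2]\nu_3\nu_4}Q^{\nu_1\nu_3}Q^{\nu_2\nu_4}\\ &-\tfrac13S_{[2]\nu_1}S_{\nu_2\nu_3\nu_4}S_{\nu_5\nu_6\nu_7\nu_8}Q^{\nu_1\nu_5}Q^{\nu_2\nu_6}Q^{\nu_3\nu_7}Q^{\nu_4\nu_8}\\ &-\tfrac1{24}S_{\nu_1\nu_2\nu_3}S_{\nu_4\nu_5\nu_6}S_{[4]}Q^{\nu_1\nu_4}Q^{\nu_2\nu_5}Q^{\nu_3\nu_6}\\ &-\tfrac12S_{\nu_1\nu_2\nu_3}S_{\nu_4\nu_5\nu_6}S_{[2]\nu_7\nu_8}Q^{\nu_1\nu_4}Q^{\nu_2\nu_5}Q^{\nu_3\nu_7}Q^{\nu_6\nu_8}\\ &-\tfrac12S_{\nu_1\nu_2\nu_3}S_{\nu_4\nu_5\nu_6}S_{\nu_7\nu_8\nu_9\nu_{10}}Q^{\nu_1\nu_4}Q^{\nu_2\nu_7}Q^{\nu_3\nu_8}Q^{\nu_5\nu_9}Q^{\nu_6\nu_{10}}\\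 &+\tfrac1{32}S_{[2]\nu_1}S_{[2]\nu_2}S_{[2]\nu_3}S_{[2]\nu_4}Q^{\nu_1\nu_2}Q^{\nu_3\nu_4}\\ &+\tfrac1{24}S_{[2]\nu_1}S_{[2]\nu_2}S_{\nu_3\nu_4\nu_5}S_{\nu_6\nu_7\nu_8}Q^{\nu_1\nu_2}Q^{\nu_3\nu_6}Q^{\nu_4\nu_7}Q^{\nu_5\nu_8}\\ &+\tfrac14S_{[2]\nu_1}S_{\nu_2\nu_3\nu_4}S_{\nu_5\nu_6\nu_7}S_{[2]\nu_8}Q^{\nu_1\nu_2}Q^{\nu_3\nu_5}Q^{\nu_4\nu_6}Q^{\nu_7\nu_8}\\ &+\tfrac1{12}S_{[2]\nu_1}S_{\nu_2\nu_3\nu_4}S_{[2]\nu_5}S_{[2]\nu_6}Q^{\nu_1\nu_2}Q^{\nu_3\nu_5}Q^{\nu_4\nu_6}\\ &+\tfrac12S_{[2]\nu_1}S_{\nu_2\nu_3\nu_4}S_{\nu_5\nu_6\nu_7}S_{\nu_8\nu_9\nu_{10}}Q^{\nu_1\nu_2}Q^{\nu_3\nu_5}Q^{\nu_4\nu_8}Q^{\nu_6\nu_9}Q^{\nu_7\nu_{10}}\\ &+\tfrac1{72}S_{\nu_1\nu_2\nu_3}S_{\nu_4\nu_5\nu_6}S_{\nu_7\nu_8\nu_9}S_{\nu_{10}\nu_{11}\nu_{12}}Q^{\nu_1\nu_4}Q^{\nu_2\nu_5}Q^{\nu_3\nu_6}Q^{\nu_7\nu_{10}}Q^{\nu_8\nu_{11}}Q^{\nu_9\nu_{12}}\\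 &+\tfrac14S_{\nu_1\nu_2\nu_3}S_{\nu_4\nu_5\nu_6}S_{\nu_7\nu_8\nu_9}S_{\nu_{10}\nu_{11}\nu_{12}}Q^{\nu_1\nu_4}Q^{\nu_2\nu_5}Q^{\nu_3\nu_7}Q^{\nu_6\nu_{10}}Q^{\nu_8\nu_{11}}Q^{\nu_9\nu_{12}}\\ &+\tfrac16S_{\nu_1\nu_2\nu_3}S_{\nu_4\nu_5\nu_6}S_{\nu_7\nu_8\nu_9}S_{\nu_{10}\nu_{11}\nu_{12}}Q^{\nu_1\nu_4}Q^{\nu_2\nu_7}Q^{\nu_3\nu_{10}}Q^{\nu_5\nu_8}Q^{\nu_6\nu_{11}}Q^{\nu_9\nu_{12}}\Big], \end{aligned}$$ where $Q$ is the inverse of the Hessian matrix $(S_{\alpha\beta})$ and the tensors $S_{\nu_1\ldots\nu_m}$, $S_{[2k]\nu_1\ldots\nu_m}$ are defined in the context.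
   Context: The plane $\mathbb{R}^2$ carries the Euclidean metric $g_{\alpha\beta}=\delta_{\alpha\beta}$ and Cartesian coordinates; repeated indices are summed. The deformed heat trace is $$\Theta_\Phi(t)=\int_{\mathbb{R}^2}dx\,U(t;\Phi(x),x)=(4\pi t)^{-1}\int_{\mathbb{R}^2}dx\,\exp\left(-\frac{1}{2t}S(x)\right),$$ where $U(t;x,x')=(4\pi t)^{-1}\exp\left(-\frac{\sigma(x,x')}{2t}\right)$ is the heat kernel. A critical point is non-degenerate if the Hessian there is strictly positive or strictly negative definite. Write $S_{\nu_1\ldots\nu_k}=\partial_{\nu_1}\cdots\partial_{\nu_k}S(\xi_0)$, let $Q=(Q^{\alpha\beta})$ be the inverse of the Hessian matrix, $Q^{\mu\nu}S_{\nu\alpha}=\delta^\mu_\alpha$, and set $$S_{[2k]\nu_1\ldots\nu_m}=Q^{\mu_1\mu_2}\cdots Q^{\mu_{2k-1}\mu_{2k}}S_{\mu_1\mu_2\ldots\mu_{2k-1}\mu_{2k}\nu_1\ldots\nu_m}.$$ In terms of the derivatives $\Phi^\mu{}_{\nu_1\ldots\nu_k}=\partial_{\nu_1}\cdots\partial_{\nu_k}\Phi^\mu(\xi_0)$ (parentheses denote symmetrization over the enclosed lower indices $\alpha,\beta,\gamma,\ldots$): $$S_{\alpha\beta}=g_{\alpha\beta}-2g_{\mu(\alpha}\Phi^\mu{}_{\beta)}+g_{\mu\nu}\Phi^\mu{}_{(\alpha}\Phi^\nu{}_{\beta)},\qquad S_{\alpha\beta\gamma}=-3g_{\mu(\alpha}\Phi^\mu{}_{\beta\gamma)}+3g_{\mu\nu}\Phi^\mu{}_{(\alpha}\Phi^\nu{}_{\beta\gamma)},$$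 $$S_{\alpha\beta\gamma\delta}=-4g_{\mu(\alpha}\Phi^\mu{}_{\beta\gamma\delta)}+4g_{\mu\nu}\Phi^\mu{}_{(\alpha}\Phi^\nu{}_{\beta\gamma\delta)}+3g_{\mu\nu}\Phi^\mu{}_{(\alpha\beta}\Phi^\nu{}_{\gamma\delta)},$$ $$S_{\alpha\beta\gamma\delta\varepsilon}=-5g_{\mu(\alpha}\Phi^\mu{}_{\beta\gamma\delta\varepsilon)}+5g_{\mu\nu}\Phi^\mu{}_{(\alpha}\Phi^\nu{}_{\beta\gamma\delta\varepsilon)}+10g_{\mu\nu}\Phi^\mu{}_{(\alpha\beta}\Phi^\nu{}_{\gamma\delta\varepsilon)},$$ $$S_{\alpha\beta\gamma\delta\varepsilon\zeta}=-6g_{\mu(\alpha}\Phi^\mu{}_{\beta\gamma\delta\varepsilon\zeta)}+6g_{\mu\nu}\Phi^\mu{}_{(\alpha}\Phi^\nu{}_{\beta\gamma\delta\varepsilon\zeta)}+15g_{\mu\nu}\Phi^\mu{}_{(\alpha\beta}\Phi^\nu{}_{\gamma\delta\varepsilon\zeta)}+10g_{\mu\nu}\Phi^\mu{}_{(\alpha\beta\gamma}\Phi^\nu{}_{\delta\varepsilon\zeta)}.$$ The asymptotic expansion $F(t)\sim\sum_kt^kA_k$ means that for every $K$, $F(t)-\sum_{k=0}^Kt^kA_k=o(t^K)$ as $t\to0^+$. *)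

(* Defs.v *)
From mathcomp Require Import all_boot all_order all_algebra.
From mathcomp Require Import all_classical all_reals all_analysis.
Set Implicit Arguments.
Unset Strict Implicit.
Unset Printing Implicit Defensive.
Import Order.TTheory GRing.Theory Num.Theory.
Import numFieldNormedType.Exports.
Local Open Scope classical_set_scope.
Local Open Scope ring_scope.

(* The plane is R * R, so that it carries the product Lebesgue measure.  The  *)
(* library norm of R * R is the max norm: it is used only for the topology,   *)
(* and the Euclidean metric enters through sigma.                             *)

Definition coord (R : realType) (i : 'I_2) (x : R * R) : R :=
  if i == ord0 then x.1 else x.2.

Definition basis_vec (R : realType) (i : 'I_2) : R * R :=
  if i == ord0 then (1, 0) else (0, 1).

(* partials [:: i1; ..; ik] f = d_i1 (.. (d_ik f)) *)
Definition partials (R : realType) (s : seq 'I_2) (f : R * R -> R) :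
    R * R -> R :=
  foldr (fun i (g : R * R -> R) x => 'D_(basis_vec R i) g x) f s.

(* The operator 'D_v is total, hence the explicit differentiability clause.   *)
Definition smooth (R : realType) (f : R * R -> R) : Prop :=
  forall s : seq 'I_2,
    continuous (partials s f) /\
    forall (i : 'I_2) (x : R * R), derivable (partials s f) x (basis_vec R i).

Definition smooth_map (R : realType) (Phi : R * R -> R * R) : Prop :=
  forall i : 'I_2, smooth (fun x => coord i (Phi x)).

Definition sigma (R : realType) (x x' : R * R) : R :=
  2^-1 * \sum_(i < 2) (coord i x - coord i x') ^+ 2.

Definition S_of (R : realType) (Phi : R * R -> R * R) (x : R * R) : R :=
  sigma (Phi x) x.

Definition heat_kernel (R : realType) (t : R) (x x' : R * R) : R :=
  (4 * pi * t)^-1 * expR (- (sigma x x' / (2 * t))).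

(* The integrand is nonnegative; the real-valued integral is 0 by convention  *)
(* when the integral is infinite.                                             *)
Definition deformed_heat_trace (R : realType) (Phi : R * R -> R * R) (t : R) :
    R :=
  \int[(@lebesgue_measure R \x @lebesgue_measure R)%E]_x
    heat_kernel t (Phi x) x.

Definition hessian (R : realType) (f : R * R -> R) (x : R * R) : 'M[R]_2 :=
  \matrix_(i, j) partials [:: i; j] f x.

Definition posdefmx (R : realType) (n : nat) (M : 'M[R]_n) : Prop :=
  forall v : 'cV[R]_n, v != 0 -> 0 < (v^T *m M *m v) ord0 ord0.

Definition critical_point (R : realType) (f : R * R -> R) (x : R * R) : Prop :=
  forall i : 'I_2, partials [:: i] f x = 0.

Definition nondegenerate_critical_point (R : realType) (f : R * R -> R)
    (x : R * R) : Prop :=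
  critical_point f x /\ (posdefmx (hessian f x) \/ posdefmx (- hessian f x)).

Definition asymptotic_expansion (R : realType) (F : R -> R) (A : nat -> R) :
    Prop :=
  forall K : nat,
    (fun t : R => F t - \sum_(k < K.+1) t ^+ k * A k)
      =o_ ((0 : R)^'+) (fun t : R => t ^+ K).

(* contract Q k S [:: n1; ..; nm] is the tensor written S_[2k] n1 .. nm       *)
Fixpoint contract (R : realType) (Q : 'M[R]_2) (k : nat) (S : seq 'I_2 -> R)
    (s : seq 'I_2) : R :=
  if k is k'.+1 then
    \sum_(i < 2) \sum_(j < 2)
      Q i j * contract Q k' (fun u => S [:: i, j & u]) s
  else S s.

Definition isum (R : realType) (F : 'I_2 -> R) : R := \sum_(i < 2) F i.

Notation "'isum_(' i .. j ')' F" :=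
  (isum (fun i => .. (isum (fun j => F)) ..))
  (at level 36, i binder, j binder, F at level 36,
   format "'isum_(' i  ..  j ')'  F") : ring_scope.

(* In the next three definitions S maps a multi-index to the corresponding    *)
(* partial derivative at the critical point, and Q is the inverse Hessian.    *)

Definition coefA0 (R : realType) (Q : 'M[R]_2) : R := Num.sqrt (\det Q).

Definition coefA1 (R : realType) (S : seq 'I_2 -> R) (Q : 'M[R]_2) : R :=
  let S2 := contract Q 1 S in
  let S4 := contract Q 2 S in
  Num.sqrt (\det Q) *
  (- (1 / 4) * S4 [::]
   + 1 / 4 * isum_(n1 n2) (S2 [:: n1] * S2 [:: n2] * Q n1 n2)
   + 1 / 6 * isum_(n1 n2 n3 n4 n5 n6)
       (S [:: n1; n2; n3] * S [:: n4; n5; n6] * Q n1 n4 * Q n2 n5 * Q n3 n6)).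

Definition coefA2 (R : realType) (S : seq 'I_2 -> R) (Q : 'M[R]_2) : R :=
  let S2 := contract Q 1 S in
  let S4 := contract Q 2 S in
  let S6 := contract Q 3 S in
  Num.sqrt (\det Q) *
  (- (1 / 12) * S6 [::]
   + 1 / 4 * isum_(n1 n2) (S2 [:: n1] * S4 [:: n2] * Q n1 n2)
   + 1 / 3 * isum_(n1 n2 n3 n4 n5 n6)
       (S [:: n1; n2; n3] * S2 [:: n4; n5; n6] * Q n1 n4 * Q n2 n5 * Q n3 n6)
   + 1 / 32 * (S4 [::] * S4 [::])
   + 1 / 4 * isum_(n1 n2 n3 n4)
       (S2 [:: n1; n2] * S2 [:: n3; n4] * Q n1 n3 * Q n2 n4)
   + 1 / 12 * isum_(n1 n2 n3 n4 n5 n6 n7 n8)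
       (S [:: n1; n2; n3; n4] * S [:: n5; n6; n7; n8]
        * Q n1 n5 * Q n2 n6 * Q n3 n7 * Q n4 n8)
   - 1 / 16 * isum_(n1 n2) (S2 [:: n1] * S2 [:: n2] * S4 [::] * Q n1 n2)
   - 1 / 2 * isum_(n1 n2 n3 n4 n5 n6)
       (S2 [:: n1] * S [:: n2; n3; n4] * S2 [:: n5; n6]
        * Q n1 n2 * Q n3 n5 * Q n4 n6)
   - 1 / 4 * isum_(n1 n2 n3 n4)
       (S2 [:: n1] * S2 [:: n2] * S2 [:: n3; n4] * Q n1 n3 * Q n2 n4)
   - 1 / 3 * isum_(n1 n2 n3 n4 n5 n6 n7 n8)
       (S2 [:: n1] * S [:: n2; n3; n4] * S [:: n5; n6; n7; n8]
        * Q n1 n5 * Q n2 n6 * Q n3 n7 * Q n4 n8)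
   - 1 / 24 * isum_(n1 n2 n3 n4 n5 n6)
       (S [:: n1; n2; n3] * S [:: n4; n5; n6] * S4 [::]
        * Q n1 n4 * Q n2 n5 * Q n3 n6)
   - 1 / 2 * isum_(n1 n2 n3 n4 n5 n6 n7 n8)
       (S [:: n1; n2; n3] * S [:: n4; n5; n6] * S2 [:: n7; n8]
        * Q n1 n4 * Q n2 n5 * Q n3 n7 * Q n6 n8)
   - 1 / 2 * isum_(n1 n2 n3 n4 n5 n6 n7 n8 n9 n10)
       (S [:: n1; n2; n3] * S [:: n4; n5; n6] * S [:: n7; n8; n9; n10]
        * Q n1 n4 * Q n2 n7 * Q n3 n8 * Q n5 n9 * Q n6 n10)
   + 1 / 32 * isum_(n1 n2 n3 n4)
       (S2 [:: n1] * S2 [:: n2] * S2 [:: n3] * S2 [:: n4] * Q n1 n2 * Q n3 n4)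
   + 1 / 24 * isum_(n1 n2 n3 n4 n5 n6 n7 n8)
       (S2 [:: n1] * S2 [:: n2] * S [:: n3; n4; n5] * S [:: n6; n7; n8]
        * Q n1 n2 * Q n3 n6 * Q n4 n7 * Q n5 n8)
   + 1 / 4 * isum_(n1 n2 n3 n4 n5 n6 n7 n8)
       (S2 [:: n1] * S [:: n2; n3; n4] * S [:: n5; n6; n7] * S2 [:: n8]
        * Q n1 n2 * Q n3 n5 * Q n4 n6 * Q n7 n8)
   + 1 / 12 * isum_(n1 n2 n3 n4 n5 n6)
       (S2 [:: n1] * S [:: n2; n3; n4] * S2 [:: n5] * S2 [:: n6]
        * Q n1 n2 * Q n3 n5 * Q n4 n6)
   + 1 / 2 * isum_(n1 n2 n3 n4 n5 n6 n7 n8 n9 n10)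
       (S2 [:: n1] * S [:: n2; n3; n4] * S [:: n5; n6; n7] * S [:: n8; n9; n10]
        * Q n1 n2 * Q n3 n5 * Q n4 n8 * Q n6 n9 * Q n7 n10)
   + 1 / 72 * isum_(n1 n2 n3 n4 n5 n6 n7 n8 n9 n10 n11 n12)
       (S [:: n1; n2; n3] * S [:: n4; n5; n6]
        * S [:: n7; n8; n9] * S [:: n10; n11; n12]
        * Q n1 n4 * Q n2 n5 * Q n3 n6 * Q n7 n10 * Q n8 n11 * Q n9 n12)
   + 1 / 4 * isum_(n1 n2 n3 n4 n5 n6 n7 n8 n9 n10 n11 n12)
       (S [:: n1; n2; n3] * S [:: n4; n5; n6]
        * S [:: n7; n8; n9] * S [:: n10; n11; n12]
        * Q n1 n4 * Q n2 n5 * Q n3 n7 * Q n6 n10 * Q n8 n11 * Q n9 n12)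
   + 1 / 6 * isum_(n1 n2 n3 n4 n5 n6 n7 n8 n9 n10 n11 n12)
       (S [:: n1; n2; n3] * S [:: n4; n5; n6]
        * S [:: n7; n8; n9] * S [:: n10; n11; n12]
        * Q n1 n4 * Q n2 n7 * Q n3 n10 * Q n5 n8 * Q n6 n11 * Q n9 n12)).

(* Main.v *)
(* With e ^ 2 = 2 t and L upper triangular such that L L^T = Q, the           *)
(* substitution x = xi0 + e L y turns the heat trace into det L / (2 pi)      *)
(* times the integral over y of exp (- S (xi0 + e L y) / e ^ 2), whose        *)
(* exponent is - |y| ^ 2 / 2 - e w_1(y) - e ^ 2 w_2(y) - .. with w_m(y) the   *)
(* Taylor form of S of degree m + 2 at xi0, evaluated at L y.  Where          *)
(* e ^ 2 |y| ^ 2 is small, exp (- sum_m e ^ m w_m) is expanded in powers of   *)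
(* e, with errors O(e ^ M) up to functions of y growing more slowly than      *)
(* every exp (eta |y| ^ 2); elsewhere coercivity of S makes the integrand     *)
(* O(e ^ M).  Odd powers of e integrate to zero by parity.  A full            *)
(* contraction of tensors along Q equals the contraction along the identity   *)
(* of the tensors pulled back by L, so that A_1 and A_2 become polynomial     *)
(* identities between moments of the standard Gaussian and coefficients of    *)
(* the pulled back binary forms.                                              *)
Require Import Defs.
From mathcomp Require Import all_boot all_order all_algebra.
From mathcomp Require Import all_classical all_reals all_analysis.
From mathcomp Require Import measurable_realfun ring lra.
Import Order.TTheory GRing.Theory Num.Theory.
Import numFieldNormedType.Exports.
Local Open Scope classical_set_scope.
Local Open Scope ring_scope.

(** * Tensors and their contractions *)

(** This is Laplace's method with explicit coefficients. Localisation: the growth condition makes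
    exp(-S/2) integrable ([integrable_growth]) and, as xi0 is the only zero of S, keeps S above a
    positive constant off every disc around xi0 ([away_bound]). Hence only a small disc contributes
    to the trace, up to errors smaller than every power of t. Since S has its minimum 0 at xi0, the
    Hessian H cannot be negative definite ([posdef_hessian]), and [frame_exists] writes its inverse
    as L L^T with L upper triangular and det L equal to the square root of det Q.

    Expansion: after the rescaling x = xi0 + e L y, e^2 = 2t, the exponent is |y|^2/2 plus a series
    in e whose coefficients w_m are the higher Taylor forms. [near_bound] and [far_bound] compare
    exp of it with a Gaussian times the formal series exp(-sum e^m w_m) = sum e^m c_m, on the two
    regions separated by the size of e^2 |y|^2, and [lint_expansion] integrates the comparison. As
    c_m has the parity of m, odd powers of e drop out ([gint_cf_odd]). What is left is A_k = 2^k det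
    L / (2 pi) times the integral of c_2k against exp(-|y|^2/2).

    Identification: c_0 = 1, c_2 = w_1^2/2 - w_2, and c_4 is the corresponding polynomial in w_1,
    .., w_4. By the Isserlis-Wick rule the Gaussian mean of such a polynomial is a sum over complete
    pairings of tensor slots, and grouping the pairings by their pattern gives the contractions of
    the statement. In the code [network_pull] replaces every Q by the identity at the price of
    pulling the tensors back along L. Since derivatives are symmetric ([symmetric_partials],
    [symtensorP]), both sides are then polynomials in the 22 independent derivatives of order three
    to six, and [hmoment_A1], [hmoment_A2] compare them by computation. *)

Section tensors.
Context {R : realType}.
Implicit Types (F G T S : seq 'I_2 -> R) (L Q : 'M[R]_2).

Lemma isumE (F : 'I_2 -> R) : isum F = F ord0 + F ord_max.
Proof.
by rewrite /isum big_ord_recl big_ord1; congr (_ + F _); exact/val_inj.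
Qed.

Lemma mulr_isum (c : R) (F : 'I_2 -> R) : c * isum F = isum (fun i => c * F i).
Proof. by rewrite /isum mulr_sumr. Qed.

Lemma eq_isum (F G : 'I_2 -> R) : F =1 G -> isum F = isum G.
Proof. by move=> FG; apply: eq_bigr => i _. Qed.

Lemma exchange_isum (F : 'I_2 -> 'I_2 -> R) :
  isum (fun i => isum (F i)) = isum (fun j => isum (F ^~ j)).
Proof. exact: exchange_big. Qed.

(** Summation over multi-indices of length k is an iterated [isum], so that for a closed k it
    unfolds to the nested sums written in [coefA1] and [coefA2]. *)
Fixpoint nsum (k : nat) F : R :=
  if k is k'.+1 then isum (fun i => nsum k' (fun s => F (i :: s))) else F [::].

Lemma eq_nsum k F G : (forall s, size s = k -> F s = G s) ->
  nsum k F = nsum k G.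
Proof.
elim: k F G => [|k IH] F G FG /=; first exact: FG.
by apply: eq_isum => i; apply: IH => s sk; apply: FG; rewrite /= sk.
Qed.

Lemma mulr_nsum k (c : R) F : c * nsum k F = nsum k (fun s => c * F s).
Proof.
elim: k F => [//|k IH] F /=; rewrite mulr_isum.
by apply: eq_isum => i; rewrite IH.
Qed.

Lemma nsum_isum k (F : 'I_2 -> seq 'I_2 -> R) :
  nsum k (fun s => isum (F ^~ s)) = isum (fun i => nsum k (F i)).
Proof.
elim: k F => [//|k IH] F /=; rewrite exchange_isum; apply: eq_isum => i.
by rewrite (IH (fun j s => F j (i :: s))).
Qed.

Lemma exchange_nsum k l (F : seq 'I_2 -> seq 'I_2 -> R) :
  nsum k (fun s => nsum l (F s)) = nsum l (fun u => nsum k (F ^~ u)).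
Proof.
elim: k F => [//|k IH] F /=; rewrite nsum_isum; apply: eq_isum => i.
exact: (IH (fun s => F (i :: s))).
Qed.

Lemma nsum_cat k l F :
  nsum (k + l) F = nsum k (fun s => nsum l (fun u => F (s ++ u))).
Proof. by elim: k F => [//|k IH] F /=; apply: eq_isum => i; rewrite IH. Qed.

(** The pullback of the covariant tensor T along L: every lower index is contracted with a column of
    L. *)
Fixpoint pull L T (b : seq 'I_2) : R :=
  if b is a :: b' then isum (fun i => L i a * pull L (fun s => T (i :: s)) b')
  else T [::].

Lemma pullE L T b :
  pull L T b = nsum (size b) (fun s => T s * \prod_(p <- zip s b) L p.1 p.2).
Proof.
elim: b T => [|a b IH] T /=; first by rewrite big_nil mulr1.
apply: eq_isum => i; rewrite IH mulr_nsum; apply: eq_nsum => s _.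
by rewrite big_cons mulrCA.
Qed.

(** The multi-index s is cut into consecutive blocks, one for each tensor. The accumulator c makes
    the product associate to the left. *)
Fixpoint blocks (c : R) (Ts : seq (nat * (seq 'I_2 -> R))) (s : seq 'I_2) : R :=
  if Ts is (k, T) :: Ts' then blocks (c * T (take k s)) Ts' (drop k s) else c.

Lemma blocksM c d Ts s : blocks (c * d) Ts s = c * blocks d Ts s.
Proof.
by elim: Ts d s => [//|[k T] Ts IH] d s /=; rewrite -IH mulrA.
Qed.

(** The factors of L attached to different blocks involve disjoint summation indices, so the sum
    splits into one pullback per tensor. *)
Lemma nsum_blocks L Ts (b : seq 'I_2) : size b = sumn (unzip1 Ts) ->
  nsum (size b) (fun s => blocks 1 Ts s * \prod_(p <- zip s b) L p.1 p.2) =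
  blocks 1 [seq (p.1, pull L p.2) | p <- Ts] b.
Proof.
elim: Ts b => [|[k T] Ts IH] b /=.
  by move/size0nil => -> /=; rewrite big_nil mulr1.
move=> sb; have tk : size (take k b) = k by rewrite size_takel// sb leq_addr.
have dk : size (drop k b) = sumn (unzip1 Ts) by rewrite size_drop sb addKn.
rewrite -[in LHS](cat_take_drop k b) size_cat tk nsum_cat.
rewrite mul1r -[X in blocks X]mulr1 blocksM -IH// pullE tk mulrC mulr_nsum.
apply: eq_nsum => s sk; rewrite mulrC mulr_nsum; apply: eq_nsum => u _.
rewrite take_size_cat// drop_size_cat// zip_cat ?tk// big_cat /=.
by rewrite mul1r -[X in blocks X]mulr1 blocksM; ring.
Qed.

Definition bond Q (s : seq 'I_2) (c : R) (e : nat * nat) : R :=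
  c * Q (nth ord0 s e.1) (nth ord0 s e.2).

Lemma foldl_bond Q s c es : foldl (bond Q s) c es =
  c * \prod_(e <- es) Q (nth ord0 s e.1) (nth ord0 s e.2).
Proof.
elim: es c => [|e es IH] c /=; first by rewrite big_nil mulr1.
by rewrite IH /bond big_cons mulrA.
Qed.

Definition ends (es : seq (nat * nat)) : seq nat :=
  flatten [seq [:: e.1; e.2] | e <- es].

(** An edge occupies two consecutive positions of [ends es], so position i belongs to edge i/2 and
    carries the summation index of that edge. *)
Lemma prod_ends (f : nat -> 'I_2 -> R) es (a : seq 'I_2) : size a = size es ->
  \prod_(p <- zip es a) (f p.1.1 p.2 * f p.1.2 p.2) =
  \prod_(0 <= i < size (ends es)) f (nth 0%N (ends es) i) (nth ord0 a i./2).
Proof.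
elim: es a => [|e es IH] [|x a] //=; first by rewrite !big_nil.
case=> sa; rewrite big_cons IH// big_nat_recl// big_nat_recl//= mulrA.
by [].
Qed.

Lemma prod_nsum es (f : nat * nat -> 'I_2 -> R) :
  \prod_(e <- es) isum (f e) =
  nsum (size es) (fun a => \prod_(p <- zip es a) f p.1 p.2).
Proof.
elim: es => [|e es IH] /=; first by rewrite !big_nil.
rewrite big_cons mulrC mulr_isum; apply: eq_isum => i.
by rewrite mulrC IH mulr_nsum; apply: eq_nsum => s _; rewrite big_cons.
Qed.

(** The product [blocks 1] without its leading unit. Together with the left fold of [bond] it has
    exactly the syntactic shape of the summands of the coefficients, so that [coefA1E] and [coefA2E]
    can end with [reflexivity]. *)
Definition vertices Ts (s : seq 'I_2) : R :=
  if Ts is (k, T) :: Ts' then blocks (T (take k s)) Ts' (drop k s) else 1.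

Lemma verticesE Ts s : vertices Ts s = blocks 1 Ts s.
Proof. by case: Ts => [//|[k T] Ts] /=; rewrite mul1r. Qed.

(* The tensors Ts, whose slots are numbered consecutively, contracted along   *)
(* the edges es, each edge being a pair of slots joined by Q.                 *)
Definition network Q Ts es : R :=
  nsum (sumn (unzip1 Ts)) (fun s => foldl (bond Q s) (vertices Ts s) es).

(** Contraction along the identity: both ends of an edge carry the same index, so one index per edge
    is summed, and slot j receives the index of the edge on which it lies. *)
Definition network1 Ts es : R :=
  nsum (size es) (fun a => vertices Ts
    [seq nth ord0 a (index j (ends es))./2 | j <- iota 0 (sumn (unzip1 Ts))]).

(** Each bond is a sum over an intermediate index, Q i j = sum_a L i a * L j a, which leaves one
    factor of L at either end. As every slot is the end of exactly one edge (the [perm_eq]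
    hypothesis), every slot gets exactly one factor of L, and summing over the original indices
    pulls the tensors back. *)
Lemma network_pull L Q Ts es :
  Q = L *m L^T -> perm_eq (ends es) (iota 0 (sumn (unzip1 Ts))) ->
  network Q Ts es = network1 [seq (p.1, pull L p.2) | p <- Ts] es.
Proof.
move=> QE; rewrite /network /network1.
have -> : unzip1 [seq (p.1, pull L p.2) | p <- Ts] = unzip1 Ts.
  by rewrite /unzip1 -map_comp.
set n := sumn _ => pes; set ks := ends es in pes *.
have uks : uniq ks by rewrite (perm_uniq pes) iota_uniq.
have sks : size ks = n by rewrite (perm_size pes) size_iota.
have QLE i j : Q i j = isum (fun a => L i a * L j a).
  by rewrite QE !mxE; apply: eq_bigr => a _; rewrite mxE.
transitivity (nsum n (fun s => nsum (size es) (fun a => blocks 1 Ts s *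
    \prod_(p <- zip es a)
      (L (nth ord0 s p.1.1) p.2 * L (nth ord0 s p.1.2) p.2)))).
  apply: eq_nsum => s _; rewrite foldl_bond verticesE -mulr_nsum; congr (_ * _).
  rewrite -(prod_nsum es (fun e x => L (nth ord0 s e.1) x * L (nth ord0 s e.2) x)).
  by apply: eq_bigr => e _; rewrite QLE.
rewrite exchange_nsum; apply: eq_nsum => a sa; rewrite verticesE.
set b := map _ (iota _ _).
have sb : size b = n by rewrite size_map size_iota.
rewrite -nsum_blocks// sb; apply: eq_nsum => s sn; congr (_ * _).
rewrite (prod_ends (fun j x => L (nth ord0 s j) x))//.
rewrite -/ks (big_nth (ord0, ord0)) size_zip sn sb minnn.
transitivity (\prod_(j <- ks) L (nth ord0 s j) (nth ord0 a (index j ks)./2)).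
  rewrite [RHS](big_nth 0%N) [LHS]big_nat_cond [RHS]big_nat_cond.
  by apply: eq_bigr => i; rewrite andbT => /andP[_ ik]; rewrite index_uniq.
rewrite (perm_big _ pes)/= -[n in iota 0 n]subn0 -/(index_iota 0 n).
rewrite [LHS]big_nat_cond [RHS]big_nat_cond.
apply: eq_bigr => j; rewrite andbT => /andP[_ jn].
by rewrite nth_zip ?sn ?sb//= (nth_map 0%N) ?size_iota// nth_iota.
Qed.

End tensors.

(** * Pullback of the inner contractions S_[2k] *)

Section tensors.
Context {R : realType}.
Implicit Types (F G T S : seq 'I_2 -> R) (L Q : 'M[R]_2).

(** The counterpart of [contract] when Q is the identity. *)
Fixpoint loops (k : nat) T (s : seq 'I_2) : R :=
  if k is k'.+1 then isum (fun a => loops k' (fun u => T [:: a, a & u]) s)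
  else T s.

Lemma loops_sum (I : Type) (r : seq I) k (c : I -> R) (T : I -> seq 'I_2 -> R) s :
  loops k (fun u => \sum_(i <- r) c i * T i u) s =
  \sum_(i <- r) c i * loops k (T i) s.
Proof.
elim: k T s => [//|k IH] T s /=.
under eq_isum do rewrite (IH (fun i u => T i [:: _, _ & u])).
by rewrite /isum exchange_big; apply: eq_bigr => i _; rewrite mulr_sumr.
Qed.

Lemma eq_loops k T T' s : T =1 T' -> loops k T s = loops k T' s.
Proof. by move=> /funext ->. Qed.

Lemma pull_sum (I : Type) (r : seq I) L (c : I -> R) (T : I -> seq 'I_2 -> R) b :
  pull L (fun u => \sum_(i <- r) c i * T i u) b =
  \sum_(i <- r) c i * pull L (T i) b.
Proof.
elim: b T => [//|a b IH] T /=.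
under eq_isum do rewrite (IH (fun i u => T i (_ :: u))) mulr_sumr.
rewrite /isum exchange_big; apply: eq_bigr => i _; rewrite mulr_sumr.
by apply: eq_bigr => j _; rewrite mulrCA.
Qed.

Lemma pull_contract L Q k T b : Q = L *m L^T ->
  pull L (Defs.contract Q k T) b = loops k (pull L T) b.
Proof.
move=> QE; elim: k T => [//|k IH] T.
transitivity (pull L (fun s => \sum_(i < 2) 1 * \sum_(j < 2)
    Q i j * Defs.contract Q k (fun u => T [:: i, j & u]) s) b).
  by congr (pull L _ b); apply/funext => s; apply: eq_bigr => i _; rewrite mul1r.
rewrite (pull_sum _ _ _ (fun=> 1)).
under eq_bigr do rewrite pull_sum mul1r.
transitivity (isum (fun a => \sum_(i < 2) L i a * \sum_(j < 2) L j a *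
    loops k (pull L (fun u => T [:: i, j & u])) b)); last first.
  apply: eq_isum => a /=.
  transitivity (loops k (fun u => \sum_(i < 2) L i a * \sum_(j < 2) L j a *
      pull L (fun v => T [:: i, j & v]) u) b); last exact: eq_loops.
  by rewrite loops_sum; apply: eq_bigr => i _; rewrite loops_sum.
rewrite /isum [RHS]exchange_big /=; apply: eq_bigr => i _.
under [RHS]eq_bigr do rewrite mulr_sumr.
rewrite [RHS]exchange_big /=; apply: eq_bigr => j _.
rewrite IH QE !mxE mulr_suml; apply: eq_bigr => a _.
by rewrite mxE mulrA.
Qed.

End tensors.

(** * The coefficients as lists of Wick contractions *)

Section tensors.
Context {R : realType}.
Implicit Types (F G T S : seq 'I_2 -> R) (L Q : 'M[R]_2).


(* A term (c, vs, es) stands for c times the contraction along es of the      *)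
(* tensors S_[2k] with m free slots, for (k, m) in vs.                        *)
Definition term : Type := R * seq (nat * nat) * seq (nat * nat).

(** The slots count from 0 over the tensors in the order written, so the index n_i of the
    coefficient is slot i - 1. Scalars such as S_[4] have no slot. *)
Definition termsA1 : seq term := [::
   (- (1 / 4), [:: (2, 0)]%N, [::]);
   (1 / 4, [:: (1, 1); (1, 1)]%N, [:: (0, 1)]%N);
   (1 / 6, [:: (0, 3); (0, 3)]%N, [:: (0, 3); (1, 4); (2, 5)]%N)].

Definition termsA2 : seq term := [::
   (- (1 / 12), [:: (3, 0)]%N, [::]);
   (1 / 4, [:: (1, 1); (2, 1)]%N, [:: (0, 1)]%N);
   (1 / 3, [:: (0, 3); (1, 3)]%N, [:: (0, 3); (1, 4); (2, 5)]%N);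
   (1 / 32, [:: (2, 0); (2, 0)]%N, [::]);
   (1 / 4, [:: (1, 2); (1, 2)]%N, [:: (0, 2); (1, 3)]%N);
   (1 / 12, [:: (0, 4); (0, 4)]%N, [:: (0, 4); (1, 5); (2, 6); (3, 7)]%N);
   (- (1 / 16), [:: (1, 1); (1, 1); (2, 0)]%N, [:: (0, 1)]%N);
   (- (1 / 2), [:: (1, 1); (0, 3); (1, 2)]%N, [:: (0, 1); (2, 4); (3, 5)]%N);
   (- (1 / 4), [:: (1, 1); (1, 1); (1, 2)]%N, [:: (0, 2); (1, 3)]%N);
   (- (1 / 3), [:: (1, 1); (0, 3); (0, 4)]%N, [:: (0, 4); (1, 5); (2, 6); (3, 7)]%N);
   (- (1 / 24), [:: (0, 3); (0, 3); (2, 0)]%N, [:: (0, 3); (1, 4); (2, 5)]%N);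
   (- (1 / 2), [:: (0, 3); (0, 3); (1, 2)]%N, [:: (0, 3); (1, 4); (2, 6); (5, 7)]%N);
   (- (1 / 2), [:: (0, 3); (0, 3); (0, 4)]%N, [:: (0, 3); (1, 6); (2, 7); (4, 8); (5, 9)]%N);
   (1 / 32, [:: (1, 1); (1, 1); (1, 1); (1, 1)]%N, [:: (0, 1); (2, 3)]%N);
   (1 / 24, [:: (1, 1); (1, 1); (0, 3); (0, 3)]%N, [:: (0, 1); (2, 5); (3, 6); (4, 7)]%N);
   (1 / 4, [:: (1, 1); (0, 3); (0, 3); (1, 1)]%N, [:: (0, 1); (2, 4); (3, 5); (6, 7)]%N);
   (1 / 12, [:: (1, 1); (0, 3); (1, 1); (1, 1)]%N, [:: (0, 1); (2, 4); (3, 5)]%N);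
   (1 / 2, [:: (1, 1); (0, 3); (0, 3); (0, 3)]%N, [:: (0, 1); (2, 4); (3, 7); (5, 8); (6, 9)]%N);
   (1 / 72, [:: (0, 3); (0, 3); (0, 3); (0, 3)]%N, [:: (0, 3); (1, 4); (2, 5); (6, 9); (7, 10); (8, 11)]%N);
   (1 / 4, [:: (0, 3); (0, 3); (0, 3); (0, 3)]%N, [:: (0, 3); (1, 4); (2, 6); (5, 9); (7, 10); (8, 11)]%N);
   (1 / 6, [:: (0, 3); (0, 3); (0, 3); (0, 3)]%N, [:: (0, 3); (1, 6); (2, 9); (4, 7); (5, 10); (8, 11)]%N)].

Definition wick Q S (ts : seq term) : R :=
  \sum_(t <- ts) t.1.1 *
    network Q [seq (v.2, Defs.contract Q v.1 S) | v <- t.1.2] t.2.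

Definition wick1 S (ts : seq term) : R :=
  \sum_(t <- ts) t.1.1 * network1 [seq (v.2, loops v.1 S) | v <- t.1.2] t.2.

Lemma coefA1E Q S : coefA1 S Q = Num.sqrt (\det Q) * wick Q S termsA1.
Proof.
congr (_ * _); rewrite /wick !big_cons big_nil addr0 !addrA !mulNr.
reflexivity.
Qed.

Lemma coefA2E Q S : coefA2 S Q = Num.sqrt (\det Q) * wick Q S termsA2.
Proof.
congr (_ * _); rewrite /wick !big_cons big_nil addr0 !addrA !mulNr.
reflexivity.
Qed.

(** The side condition, that the edges of every term use each slot once, is decidable and is settled
    by computation for the two concrete lists. *)
Lemma wick_pull L Q S (ts : seq term) : Q = L *m L^T ->
  all (fun t : term => perm_eq (ends t.2) (iota 0 (sumn (unzip2 t.1.2)))) ts ->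
  wick Q S ts = wick1 (pull L S) ts.
Proof.
move=> QE /allP tsP; apply: eq_big_seq => t /tsP pt; congr (_ * _).
rewrite (network_pull L)//; last by rewrite /unzip1 -map_comp.
rewrite -map_comp; congr network1; apply: eq_map => v; congr (_, _).
by apply/funext => b; rewrite /= (pull_contract L Q).
Qed.

Lemma coefA1_pull L Q S : Q = L *m L^T ->
  coefA1 S Q = Num.sqrt (\det Q) * wick1 (pull L S) termsA1.
Proof. by move=> QE; rewrite coefA1E (wick_pull L). Qed.

Lemma coefA2_pull L Q S : Q = L *m L^T ->
  coefA2 S Q = Num.sqrt (\det Q) * wick1 (pull L S) termsA2.
Proof. by move=> QE; rewrite coefA2E (wick_pull L). Qed.

End tensors.

(** * Binary forms and their Gaussian moments *)

Section forms.
Context {R : realType}.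
Implicit Types p q : seq R.

(** A list of n + 1 coefficients stands for a form of degree n, the j-th entry multiplying u^(n-j)
    v^j. Lists rather than polynomials let products and moments be evaluated by computation. *)
Fixpoint hform p (u v : R) : R :=
  if p is a :: p' then a * u ^+ size p' + v * hform p' u v else 0.

Fixpoint hadd p q : seq R :=
  match p, q with a :: p', b :: q' => a + b :: hadd p' q' | _, _ => [::] end.

(** Since [hadd] truncates to the shorter list, all summands are padded to the length of the
    product, including the zero list returned for an empty p. *)
Fixpoint hmul p q : seq R :=
  if p is a :: p' then
    hadd (map ( *%R a) q ++ nseq (size p') 0) (0 :: hmul p' q)
  else nseq (size q).-1 0.

Lemma size_hadd p q : size p = size q -> size (hadd p q) = size p.
Proof. by elim: p q => [|a p IH] [|b q] //= [pq]; rewrite IH. Qed.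

Lemma size_hmul p q : (0 < size q)%N -> size (hmul p q) = (size p + size q).-1.
Proof.
move=> q0; elim: p => [|a p IH]; first by rewrite /= size_nseq.
have spq : size (map ( *%R a) q ++ nseq (size p) 0) = (size p + size q)%N.
  by rewrite size_cat size_map size_nseq addnC.
by rewrite [LHS]size_hadd spq//= IH prednK// addn_gt0 q0 orbT.
Qed.

Lemma hform_add p q u v : size p = size q ->
  hform (hadd p q) u v = hform p u v + hform q u v.
Proof.
elim: p q => [|a p IH] [|b q] //= => [_|[pq]]; first by rewrite addr0.
by rewrite IH// size_hadd// -pq; ring.
Qed.

Lemma hform_nseq n u v : hform (nseq n 0) u v = 0.
Proof. by elim: n => [//|n IH] /=; rewrite IH mul0r mulr0 addr0. Qed.

Lemma hform_pad p n u v : hform (p ++ nseq n 0) u v = u ^+ n * hform p u v.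
Proof.
elim: p => [|a p IH] /=; first by rewrite hform_nseq mulr0.
by rewrite IH size_cat size_nseq exprD; ring.
Qed.

Lemma hform_scale a p u v : hform (map ( *%R a) p) u v = a * hform p u v.
Proof. by elim: p => [|b p IH] /=; rewrite ?mulr0// IH size_map; ring. Qed.

Lemma hform_mul p q u v : (0 < size q)%N ->
  hform (hmul p q) u v = hform p u v * hform q u v.
Proof.
move=> q0; elim: p => [|a p IH]; first by rewrite /= hform_nseq mul0r.
rewrite [hmul _ _]/= hform_add; last first.
  rewrite size_cat size_map size_nseq /= size_hmul// prednK ?addn_gt0 ?q0 ?orbT//.
  by rewrite addnC.
by rewrite hform_pad hform_scale /= IH; ring.
Qed.

(* The n-th moment of the standard normal distribution.                       *)
Fixpoint moment (n : nat) : R :=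
  match n with 0%N => 1 | 1%N => 0 | n'.+2 => n'.+1%:R * moment n' end.

(** The standard Gaussian mean of v^k times the form p, monomial by monomial; k counts the
    coefficients already passed. *)
Fixpoint hmoment_rec k p : R :=
  if p is a :: p' then a * (moment (size p') * moment k) + hmoment_rec k.+1 p'
  else 0.

Definition hmoment p : R := hmoment_rec 0 p.

(* Coefficients of sum_(a1..an) T a1..an y_a1 .. y_an / n! for a symmetric T  *)
(* whose value on a multi-index with j entries 1 is c n j.                    *)
Definition taylor_form (c : nat -> nat -> R) (n : nat) : seq R :=
  [seq c n j / (j`! * (n - j)`!)%:R | j <- iota 0 n.+1].

Definition symtensor (c : nat -> nat -> R) (s : seq 'I_2) : R :=
  c (size s) (count (pred1 ord_max) s).


Lemma isum_fun : @isum R = fun F => F ord0 + F ord_max.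
Proof. exact/funext/isumE. Qed.

(** The Wick rule for the mean of w_1^2/2 - w_2, verified by expanding both sides into polynomials
    in the components of the tensor. The factor 2 comes from e^2 = 2t. *)
Lemma hmoment_A1 c :
  2 * (hmoment (hmul (taylor_form c 3) (taylor_form c 3)) / 2
       - hmoment (taylor_form c 4)) = wick1 (symtensor c) termsA1.
Proof.
rewrite /wick1 !big_cons big_nil /network1 /= isum_fun /symtensor.
by rewrite /hmoment /taylor_form /= !factS fact0; field.
Qed.

(** The same comparison one order higher: the left side is e^4/t^2 = 4 times the mean of the
    coefficient of e^4 in exp(-sum e^m w_m). *)
Lemma hmoment_A2 c :
  let w n := taylor_form c n.+2 in
  let w11 := hmul (w 1%N) (w 1%N) in
  4 * (hmoment (hmul w11 w11) / 24 - hmoment (hmul w11 (w 2%N)) / 2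
       + hmoment (hmul (w 2%N) (w 2%N)) / 2 + hmoment (hmul (w 1%N) (w 3%N))
       - hmoment (w 4%N)) = wick1 (symtensor c) termsA2.
Proof.
rewrite /wick1 !big_cons big_nil /network1 /= isum_fun /symtensor.
rewrite /hmoment /taylor_form /= !factS fact0.
by field.
Qed.
End forms.

(** * Smooth functions of two variables *)

Section smooth_functions.
Context {R : realType}.
Implicit Types (f g : R * R -> R) (x v : R * R).

(** Both derivatives are limits of the same difference quotient. This carries directional
    derivatives to the calculus of one real variable. *)
Lemma is_derive_line f x v (d : R) :
  is_derive x v f d <-> is_derive (0 : R) 1 (fun h : R => f (h *: v + x)) d.
Proof.
pose g (h : R) := f (h *: v + x).
have E1 : derivable f x v = derivable g 0 1.
  apply: (congr1 (fun q : R -> R => cvg (q @ 0^'))); apply/funext => h /=.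
  by rewrite /g scale0r add0r addr0 [h *: 1]mulr1.
have E2 : 'D_v f x = 'D_1 g 0.
  apply: (congr1 (fun q : R -> R => lim (q @ 0^'))); apply/funext => h /=.
  by rewrite /g scale0r add0r addr0 [h *: 1]mulr1.
by split=> -[df dfE]; split; rewrite -/g; [rewrite -E1|rewrite -E2|rewrite E1|rewrite E2].
Qed.

Lemma is_derive_shift1 (f : R -> R) (x d : R) :
  is_derive x 1 f d <-> is_derive (0 : R) 1 (fun h : R => f (h + x)) d.
Proof.
pose g (h : R) := f (h + x).
have E1 : derivable f x 1 = derivable g 0 1.
  apply: (congr1 (fun q : R -> R => cvg (q @ 0^'))); apply/funext => h /=.
  by rewrite /g add0r addr0.
have E2 : 'D_1 f x = 'D_1 g 0.
  apply: (congr1 (fun q : R -> R => lim (q @ 0^'))); apply/funext => h /=.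
  by rewrite /g add0r addr0.
by split=> -[df dfE]; split; rewrite -/g; [rewrite -E1|rewrite -E2|rewrite E1|rewrite E2].
Qed.

Definition pd (i : 'I_2) f : R * R -> R := fun x => 'D_(basis_vec R i) f x.

(** Smoothness is the largest class of continuous functions with partial derivatives that is stable
    under taking them, so it suffices to exhibit one such class containing f. *)
Lemma smooth_coind (P : (R * R -> R) -> Prop) :
  (forall f, P f -> [/\ continuous f,
     forall i x, derivable f x (basis_vec R i) & forall i, P (pd i f)]) ->
  forall f, P f -> smooth f.
Proof.
move=> HP f Pf s; have : P (partials s f).
  by elim: s => [//|i s IH] /=; have [_ _] := HP _ IH; exact.
by case/HP.
Qed.

Lemma smooth_pd i f : smooth f -> smooth (pd i f).
Proof.
by move=> sf s; have := sf (rcons s i); rewrite /partials foldr_rcons.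
Qed.

Lemma pdE i f x : pd i f x = 'D_(basis_vec R i) f x. Proof. by []. Qed.

Lemma partials_cons i s f : partials (i :: s) f = pd i (partials s f).
Proof. by []. Qed.

Lemma partials_cat s u f : partials (s ++ u) f = partials s (partials u f).
Proof. exact: foldr_cat. Qed.

Lemma partials_rcons s i f : partials (rcons s i) f = partials s (pd i f).
Proof. exact: foldr_rcons. Qed.

Lemma smooth_partials s f : smooth f -> smooth (partials s f).
Proof. by move=> sf; elim: s => [//|i s IH]; exact: smooth_pd. Qed.

Lemma smoothP f : smooth f ->
  continuous f /\ forall i x, derivable f x (basis_vec R i).
Proof. exact: (fun sf => sf [::]). Qed.

(** An algebra closed under partial derivatives by the Leibniz rule. It serves as the invariant for
    [smooth_coind], so that no formula for iterated derivatives of a product is needed. *)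
Inductive smooth_algebra : (R * R -> R) -> Prop :=
| SmoothGen f of smooth f : smooth_algebra f
| SmoothCst c : smooth_algebra (cst c)
| SmoothFst : smooth_algebra fst
| SmoothSnd : smooth_algebra snd
| SmoothAdd f g of smooth_algebra f & smooth_algebra g :
    smooth_algebra (f + g)
| SmoothMul f g of smooth_algebra f & smooth_algebra g :
    smooth_algebra (f * g).

Lemma is_derive_fst x v : is_derive x v (@fst R R) v.1.
Proof.
apply/is_derive_line => /=.
have -> : (fun h : R => h * v.1 + x.1) = (fun h => v.1 *: h) + cst x.1.
  by apply/funext => h /=; rewrite mulrC.
by apply: is_derive_eq; rewrite addr0 [_ *: _]mulr1.
Qed.

Lemma is_derive_snd x v : is_derive x v (@snd R R) v.2.
Proof.
apply/is_derive_line => /=.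
have -> : (fun h : R => h * v.2 + x.2) = (fun h => v.2 *: h) + cst x.2.
  by apply/funext => h /=; rewrite mulrC.
by apply: is_derive_eq; rewrite addr0 [_ *: _]mulr1.
Qed.

Lemma smooth_algebraP f : smooth_algebra f -> smooth f.
Proof.
move: f; apply: smooth_coind => f; elim => {f}.
- move=> f /[dup] sf /smoothP[cf df]; split => // i.
  by constructor; exact: smooth_pd.
- move=> c; split=> [|i x|i]; [exact: cst_continuous|exact: derivable_cst|].
  have -> : pd i (cst c) = cst 0 by apply/funext => x; rewrite /pd derive_cst.
  by constructor.
- split=> [x|i x|i]; first exact: cvg_fst.
    by have [] := is_derive_fst x (basis_vec R i).
  have -> : pd i fst = cst (basis_vec R i).1.
    by apply/funext => x; have [] := is_derive_fst x (basis_vec R i).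
  by constructor.
- split=> [x|i x|i]; first exact: cvg_snd.
    by have [] := is_derive_snd x (basis_vec R i).
  have -> : pd i snd = cst (basis_vec R i).2.
    by apply/funext => x; have [] := is_derive_snd x (basis_vec R i).
  by constructor.
- move=> f g _ [cf df af] _ [cg dg ag]; split => [x|i x|i].
  + by apply: cvgD; [exact: cf|exact: cg].
  + exact: derivableD.
  + have -> : pd i (f + g) = pd i f + pd i g.
      by apply/funext => x; rewrite /pd deriveD.
    exact: (SmoothAdd _ _ (af i) (ag i)).
- move=> f g sf [cf df af] sg [cg dg ag]; split => [x|i x|i].
  + by apply: cvgM; [exact: cf|exact: cg].
  + exact: derivableM.
  + have -> : pd i (f * g) = f * pd i g + g * pd i f.
      by apply/funext => x; rewrite /pd deriveM.
    exact: (SmoothAdd _ _ (SmoothMul _ _ sf (ag i)) (SmoothMul _ _ sg (af i))).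
Qed.

Lemma smooth_cst (c : R) : smooth (fun _ : R * R => c).
Proof. by apply: smooth_algebraP; exact: SmoothCst. Qed.

Lemma smoothD f g : smooth f -> smooth g -> smooth (fun x => f x + g x).
Proof.
by move=> sf sg; apply: smooth_algebraP; apply: SmoothAdd; exact: SmoothGen.
Qed.

Lemma smoothM f g : smooth f -> smooth g -> smooth (fun x => f x * g x).
Proof.
by move=> sf sg; apply: smooth_algebraP; apply: SmoothMul; exact: SmoothGen.
Qed.

Lemma smooth_coord i : smooth (@Defs.coord R i).
Proof.
by rewrite /Defs.coord; case: (i == ord0); apply: smooth_algebraP;
  [exact: SmoothFst|exact: SmoothSnd].
Qed.

Lemma smooth_S_of Phi : smooth_map Phi -> smooth (S_of (R := R) Phi).
Proof.
move=> sP; pose d i := fun x => Defs.coord i (Phi x) + (-1) * Defs.coord i x.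
have sd i : smooth (d i).
  apply: (smoothD _ _ (sP i)); apply: smoothM; [exact: smooth_cst|].
  exact: smooth_coord.
have -> : S_of Phi =
    fun x => 2^-1 * (d ord0 x * d ord0 x + d ord_max x * d ord_max x).
  apply/funext => x; rewrite /S_of /sigma big_ord_recl big_ord1 /d !mulN1r.
  by rewrite !expr2; congr (_ * (_ + (Defs.coord _ _ - Defs.coord _ _) * (Defs.coord _ _ - Defs.coord _ _))); exact/val_inj.
apply: smoothM; first exact: smooth_cst.
by apply: smoothD; apply: smoothM.
Qed.

(* Unfolding iterated directional derivatives into limits makes unification   *)
(* diverge.                                                                   *)
Opaque pd partials.

(** The mean value theorem without an order on the endpoints, as increments of either sign occur. *)
Lemma MVT_abs (f df : R -> R) (a b : R) :
  (forall x : R, is_derive x 1 f (df x)) ->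
  exists2 c, `|c - a| <= `|b - a| & f b - f a = df c * (b - a).
Proof.
move=> fdf; have cf : continuous f.
  by move=> x; apply/differentiable_continuous/derivable1_diffP/ex_derive.
have [ab|ba] := leP a b.
  have [c + E] := MVT_segment ab (fun z _ => fdf z) (continuous_subspaceT cf).
  by rewrite in_itv/= => /andP[ac cb]; exists c => //; rewrite !ger0_norm; lra.
have [c + E] := MVT_segment (ltW ba) (fun z _ => fdf z) (continuous_subspaceT cf).
rewrite in_itv/= => /andP[ac cb]; exists c; first by rewrite !ler0_norm; lra.
by rewrite -[LHS]opprB E; ring.
Qed.

Lemma is_derive_horizontal f (y a : R) : smooth f ->
  is_derive a 1 (fun a => f (a, y)) (pd ord0 f (a, y)).
Proof.
move=> /smoothP[_ df]; apply/is_derive_shift1.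
have : is_derive (a, y) (basis_vec R ord0) f (pd ord0 f (a, y)) by exact: DeriveDef.
move/is_derive_line.
rewrite /basis_vec /=; congr is_derive; apply/funext => h.
have -> : h *: ((1, 0) : R * R) + (a, y) = (h * 1 + a, h * 0 + y) by [].
by rewrite mulr1 mulr0 add0r.
Qed.

Lemma is_derive_vertical f (y a : R) : smooth f ->
  is_derive y 1 (fun y => f (a, y)) (pd ord_max f (a, y)).
Proof.
move=> /smoothP[_ df]; apply/is_derive_shift1.
have : is_derive (a, y) (basis_vec R ord_max) f (pd ord_max f (a, y)) by exact: DeriveDef.
move/is_derive_line.
rewrite /basis_vec /=; congr is_derive; apply/funext => h.
have -> : h *: ((0, 1) : R * R) + (a, y) = (h * 0 + a, h * 1 + y) by [].
by rewrite mulr1 mulr0 add0r.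
Qed.

Definition dird (v : R * R) f : R * R -> R :=
  fun x => v.1 * pd ord0 f x + v.2 * pd ord_max f x.

Lemma near_continuous f x (e : R) : continuous f -> 0 < e ->
  exists2 d, 0 < d & forall y, `|y.1 - x.1| < d -> `|y.2 - x.2| < d ->
    `|f y - f x| < e.
Proof.
move=> cf e0; have /cvgrPdist_lt/(_ e e0) := cf x.
rewrite -nbhs_nearE => /nbhs_ballP[d /= d0 H]; exists d => // y y1 y2.
by rewrite distrC; apply: H; split; rewrite /ball /= distrC.
Qed.

Lemma weighted_dist (A B A' B' u v k : R) :
  0 <= k -> `|A' - A| <= k -> `|B' - B| <= k ->
  `|u * A + v * B - (A' * u + B' * v)| <= k * (1 + `|u| + `|v|).
Proof.
move=> k0 hA hB.
have -> : u * A + v * B - (A' * u + B' * v) = - ((A' - A) * u + (B' - B) * v).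
  by ring.
rewrite normrN (le_trans (ler_normD _ _))// !normrM !mulrDr mulr1 -addrA.
by apply: ler_wpDl => //; apply: lerD; exact: ler_wpM2r.
Qed.

(* Two applications of the mean value theorem, along horizontal and vertical  *)
(* segments.                                                                  *)
Lemma is_derive_dird f x v : smooth f -> is_derive x v f (dird v f x).
Proof.
move=> sf; have [c0 _] := smoothP _ (smooth_pd ord0 _ sf).
have [c1 _] := smoothP _ (smooth_pd ord_max _ sf).
suff H : (fun h : R => h^-1 *: ((f \o shift x) (h *: v) - f x)) @ 0^' --> dird v f x.
  by split; [apply/cvg_ex; exists (dird v f x)|exact: cvg_lim].
apply/cvgrPdist_le => /= e e0.
(* Once both partial derivatives at the intermediate points are within [k] of their values at x,
   [weighted_dist] bounds the total error by k * w = e. *)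
pose k := e / (1 + `|v.1| + `|v.2|).
have k0 : 0 < k by rewrite divr_gt0// -addrA ltr_pwDl// addr_ge0.
have [d0 d00 H0] := near_continuous _ x _ c0 k0.
have [d1 d10 H1] := near_continuous _ x _ c1 k0.
pose w := 1 + `|v.1| + `|v.2|.
have w0 : 0 < w by rewrite /w -addrA ltr_pwDl// addr_ge0.
pose d := Num.min d0 d1 / w.
have dd0 : 0 < d by rewrite divr_gt0// lt_min d00.
exists d => // h /=; rewrite sub0r normrN => hd h0.
have hw : `|h| * w < Num.min d0 d1 by rewrite -ltr_pdivlMr.
have small (u : R) : `|u| <= `|v.1| \/ `|u| <= `|v.2| -> `|h * u| < Num.min d0 d1.
  move=> uv; apply: le_lt_trans hw; rewrite normrM ler_wpM2l// /w.
  by have := normr_ge0 v.1; have := normr_ge0 v.2; case: uv; lra.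
have [c hc Ec] := MVT_abs (fun a => f (a, h * v.2 + x.2)) _ x.1 (h * v.1 + x.1)
  (fun a => is_derive_horizontal f _ a sf).
have [c' hc' Ec'] := MVT_abs (fun y => f (x.1, y)) _ x.2 (h * v.2 + x.2)
  (fun y => is_derive_vertical f y _ sf).
rewrite addrK in hc Ec; rewrite addrK in hc' Ec'.
have -> : (f \o shift x) (h *: v) - f x =
    pd ord0 f (c, h * v.2 + x.2) * (h * v.1) + pd ord_max f (x.1, c') * (h * v.2).
  by rewrite -Ec -Ec' /=; case: (x) => x1 x2 /=; rewrite addrA subrK.
have -> : h^-1 *: (pd ord0 f (c, h * v.2 + x.2) * (h * v.1) +
    pd ord_max f (x.1, c') * (h * v.2)) =
    pd ord0 f (c, h * v.2 + x.2) * v.1 + pd ord_max f (x.1, c') * v.2.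
  by rewrite /GRing.scale /=; field.
have B0 : `|pd ord0 f (c, h * v.2 + x.2) - pd ord0 f x| < k.
  apply: H0 => /=.
    by apply: (le_lt_trans hc); have := small v.1 (or_introl (lexx _)); rewrite lt_min => /andP[].
  by rewrite addrK; have := small v.2 (or_intror (lexx _)); rewrite lt_min => /andP[].
have B1 : `|pd ord_max f (x.1, c') - pd ord_max f x| < k.
  apply: H1 => /=; first by rewrite subrr normr0.
  by apply: (le_lt_trans hc'); have := small v.2 (or_intror (lexx _)); rewrite lt_min => /andP[].
rewrite (_ : e = k * w); last by rewrite /k /w divfK// gt_eqF.
exact: (weighted_dist _ _ _ _ _ _ _ (ltW k0) (ltW B0) (ltW B1)).
Qed.

End smooth_functions.

(** * Symmetry of derivatives and Taylor's formula in the plane *)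

Section taylor.
Context {R : realType}.
Implicit Types (f g : R * R -> R) (x v : R * R).

(** Two uses of the mean value theorem turn the mixed second difference over a square into h^2 times
    a mixed derivative. [second_difference'] does so in the other order, and letting h tend to 0
    gives the symmetry of second derivatives ([pd_comm01]). *)
Lemma second_difference f (x1 x2 h : R) : smooth f -> 0 <= h ->
  exists p : R * R, [/\ `|p.1 - x1| <= h, `|p.2 - x2| <= h &
  f (x1 + h, x2 + h) - f (x1, x2 + h) - (f (x1 + h, x2) - f (x1, x2)) =
  h * h * pd ord_max (pd ord0 f) p].
Proof.
move=> sf h0.
have dphi (a : R) : is_derive a 1 (fun a => f (a, x2 + h) - f (a, x2))
    (pd ord0 f (a, x2 + h) - pd ord0 f (a, x2)).
  by apply: is_deriveB; exact: is_derive_horizontal.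
have [c hc Ec] := MVT_abs _ _ x1 (x1 + h) dphi.
have [d hd Ed] := MVT_abs (fun y => pd ord0 f (c, y)) _ x2 (x2 + h)
  (fun y => is_derive_vertical _ y c (smooth_pd _ _ sf)).
rewrite addrAC subrr add0r (ger0_norm h0) in hc Ec.
rewrite addrAC subrr add0r (ger0_norm h0) in hd Ed.
exists (c, d); split => //.
transitivity (f (x1 + h, x2 + h) - f (x1 + h, x2) - (f (x1, x2 + h) - f (x1, x2))).
  by ring.
by rewrite Ec Ed; ring.
Qed.

Lemma second_difference' f (x1 x2 h : R) : smooth f -> 0 <= h ->
  exists p : R * R, [/\ `|p.1 - x1| <= h, `|p.2 - x2| <= h &
  f (x1 + h, x2 + h) - f (x1, x2 + h) - (f (x1 + h, x2) - f (x1, x2)) =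
  h * h * pd ord0 (pd ord_max f) p].
Proof.
move=> sf h0.
have dphi (y : R) : is_derive y 1 (fun y => f (x1 + h, y) - f (x1, y))
    (pd ord_max f (x1 + h, y) - pd ord_max f (x1, y)).
  by apply: is_deriveB; exact: is_derive_vertical.
have [c hc Ec] := MVT_abs _ _ x2 (x2 + h) dphi.
have [d hd Ed] := MVT_abs (fun a => pd ord_max f (a, c)) _ x1 (x1 + h)
  (fun a => is_derive_horizontal _ c a (smooth_pd _ _ sf)).
rewrite addrAC subrr add0r (ger0_norm h0) in hc Ec.
rewrite addrAC subrr add0r (ger0_norm h0) in hd Ed.
exists (d, c); split => //.
transitivity (f (x1 + h, x2 + h) - f (x1, x2 + h) - (f (x1 + h, x2) - f (x1, x2))).
  by ring.
by rewrite Ec Ed; ring.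
Qed.

Lemma continuous_eq_near f g x : continuous f -> continuous g ->
  (forall h : R, 0 < h -> exists p q : R * R,
    [/\ `|p.1 - x.1| <= h, `|p.2 - x.2| <= h, `|q.1 - x.1| <= h,
        `|q.2 - x.2| <= h & f p = g q]) ->
  f x = g x.
Proof.
move=> cf cg H; apply/eqP; rewrite -subr_eq0 -normr_le0 leNgt; apply/negP => e0.
have e2 : 0 < `|f x - g x| / 2 by rewrite divr_gt0.
have [d d0 Hd] := near_continuous _ x _ cf e2.
have [d' d'0 Hd'] := near_continuous _ x _ cg e2.
have m0 : 0 < Num.min d d' / 2 by rewrite divr_gt0// lt_min d0.
have hm : Num.min d d' / 2 < Num.min d d' by lra.
have [p [q [p1 p2 q1 q2 E]]] := H _ m0.
move: hm; rewrite lt_min => /andP[hd hd'].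
have B := Hd p (le_lt_trans p1 hd) (le_lt_trans p2 hd).
have B' := Hd' q (le_lt_trans q1 hd') (le_lt_trans q2 hd').
rewrite E in B; have tri (u b c k : R) :
    `|c - u| < k / 2 -> `|c - b| < k / 2 -> `|u - b| < k.
  by rewrite !ltr_norml; lra.
by have := tri _ _ _ _ B B'; rewrite ltxx.
Qed.

Lemma pd_comm01 f : smooth f -> pd ord0 (pd ord_max f) = pd ord_max (pd ord0 f).
Proof.
move=> sf; apply/funext => x.
have [c01 _] := smoothP _ (smooth_pd ord0 _ (smooth_pd ord_max _ sf)).
have [c10 _] := smoothP _ (smooth_pd ord_max _ (smooth_pd ord0 _ sf)).
apply: continuous_eq_near => // h h0.
have [p [p1 p2 Ep]] := second_difference f x.1 x.2 h sf (ltW h0).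
have [q [q1 q2 Eq]] := second_difference' f x.1 x.2 h sf (ltW h0).
exists q, p; split; [exact: q1|exact: q2|exact: p1|exact: p2|].
have hh : h * h != 0 by rewrite mulf_neq0// gt_eqF.
apply: (mulfI hh).
exact: (etrans (esym Eq) Ep).
Qed.

Lemma pd_comm i j f : smooth f -> pd i (pd j f) = pd j (pd i f).
Proof.
move=> sf; have ordE (k : 'I_2) : k = ord0 \/ k = ord_max.
  by case: k => [[|[|//]] k2]; [left|right]; exact/val_inj.
by case: (ordE i) (ordE j) => -> [] ->; rewrite ?(pd_comm01 f sf).
Qed.

Definition symmetric (T : seq 'I_2 -> R) : Prop :=
  forall s i j u, T (s ++ [:: i, j & u]) = T (s ++ [:: j, i & u]).

Lemma symmetric_partials f x : smooth f ->
  symmetric (fun s => partials s f x).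
Proof.
move=> sf s i j u; apply: (congr1 (fun g : R * R -> R => g x)).
rewrite (partials_cat s [:: i, j & u]) (partials_cat s [:: j, i & u]).
apply: (congr1 (partials s)).
rewrite (partials_cons i (j :: u)) (partials_cons j u).
rewrite (partials_cons j (i :: u)) (partials_cons i u).
exact: (pd_comm i j _ (smooth_partials u _ sf)).
Qed.

Lemma symmetric_pull L T : symmetric T -> symmetric (pull L T).
Proof.
move=> symT s; elim: s T symT => [|a s IH] T symT i j u /=.
  under eq_isum do rewrite mulr_isum.
  rewrite exchange_isum; apply: eq_isum => b; rewrite mulr_isum.
  apply: eq_isum => c; rewrite mulrCA; congr (_ * (_ * pull _ _ _)).
  by apply/funext => w; have := symT [::] c b w.
by apply: eq_isum => b; congr (_ * _); apply: IH => s' i' j' u'; exact: (symT (b :: s')).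
Qed.

(** Adjacent transpositions sort a multi-index, so the value depends only on its length and on the
    number of entries [ord_max]. The proof sorts behind an arbitrary prefix [t]. *)
Lemma symtensorP T : symmetric T ->
  T = symtensor (fun n j => T (nseq (n - j) ord0 ++ nseq j ord_max)).
Proof.
move=> symT; apply/funext => s; rewrite /symtensor.
suff H t : T (t ++ s) = T (t ++ nseq (size s - count (pred1 ord_max) s) ord0 ++
    nseq (count (pred1 ord_max) s) ord_max) by have := H [::].
elim: s t => [//|i s IH] t /=.
case: (eqVneq i ord_max) => [->|i0] /=; last first.
  have -> : i = ord0 by case: i i0 => [[|[|//]] ?] ?; exact/val_inj.
  rewrite add0n subSn ?count_size//= -cat_rcons IH -cat_rcons.
  by rewrite cat_rcons.
rewrite add1n subSS -cat_rcons IH cat_rcons add0n.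
set b := count_mem _ _; set a := (size s - b)%N; clearbody a b.
(* The leading [ord_max] moves past the zeros one transposition at a time. *)
elim: a t => [//|a IHa] t /=.
by rewrite symT -cat_rcons IHa cat_rcons.
Qed.

(** Here [g k] is the k-th derivative. The remainder vanishes at 0 and its derivative is the
    remainder of order n - 1 for g', so induction and the mean value theorem on [0, h] give the
    bound. The factor 1/n! is given up, since only the order matters. *)
Lemma taylor_bound (g : nat -> R -> R) n (M : R) :
  (forall k (s : R), is_derive s 1 (g k) (g k.+1 s)) ->
  (forall s : R, 0 <= s <= 1 -> `|g n s| <= M) ->
  forall h : R, 0 <= h <= 1 ->
  `|g 0%N h - \sum_(k < n) g k 0 * h ^+ k / k`!%:R| <= M.
Proof.
elim: n g => [|n IH] g dg gM h h01.
  by rewrite big_ord0 subr0; exact: gM.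
pose r (h : R) := g 0%N h - \sum_(k < n.+1) g k 0 * h ^+ k / k`!%:R.
pose r' (h : R) := g 1%N h - \sum_(k < n) g k.+1 0 * h ^+ k / k`!%:R.
have dr (s : R) : is_derive s 1 r (r' s).
  have -> : r = fun h => g 0%N h - (g 0%N 0 +
      \sum_(k < n) g k.+1 0 * h ^+ k.+1 / k.+1`!%:R).
    by apply/funext => u; rewrite /r big_ord_recl expr0 mulr1 divr1.
  apply: is_deriveB; rewrite -[X in is_derive _ _ _ X]add0r.
  apply: is_deriveD.
  have -> : (fun h : R => \sum_(k < n) g k.+1 0 * h ^+ k.+1 / k.+1`!%:R) =
    \sum_(k < n) (fun h : R => g k.+1 0 * h ^+ k.+1 / k.+1`!%:R).
    by apply/funext => u; rewrite fct_sumE.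
  apply: is_derive_sum => k.
  have -> : (fun h : R => g k.+1 0 * h ^+ k.+1 / k.+1`!%:R) =
      (g k.+1 0 / k.+1`!%:R) \*: (@GRing.exp R ^~ k.+1).
    by apply/funext => u; rewrite /= mulrAC.
  have H : is_derive s 1 (@GRing.exp R ^~ k.+1) (k.+1%:R * s ^+ k).
    by split; [exact: exprn_derivable|rewrite exp_derive [LHS]mulr1].
  have -> : g k.+1 0 * s ^+ k / k`!%:R =
      (g k.+1 0 / k.+1`!%:R) *: (k.+1%:R * s ^+ k).
    have K0 : k.+1%:R != 0 :> R by rewrite pnatr_eq0.
    have F0 : k`!%:R != 0 :> R by rewrite pnatr_eq0 -lt0n fact_gt0.
    rewrite factS natrM; move: (k.+1%:R : R) (k`!%:R : R) K0 F0 => K F K0 F0.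
    by rewrite /GRing.scale /=; field; rewrite F0.
  exact: is_deriveZ.
have B (s : R) : 0 <= s <= 1 -> `|r' s| <= M by exact: (IH (fun k => g k.+1)).
case/andP: h01 => h0 h1.
have r0 : r 0 = 0.
  rewrite /r big_ord_recl expr0 mulr1 divr1 big1 ?addr0 ?subrr// => k _.
  by rewrite expr0n /= mulr0 mul0r.
have cr : continuous r.
  by move=> u; apply/differentiable_continuous/derivable1_diffP/ex_derive.
have [c] := MVT_segment h0 (fun z _ => dr z) (continuous_subspaceT cr).
rewrite in_itv/= r0 !subr0 => /andP[c0 ch] E.
rewrite -/(r h) E normrM (ger0_norm h0).
have rM : `|r' c| <= M by apply: B; rewrite c0 (le_trans ch).
by rewrite (le_trans _ rM)// ler_piMr.
Qed.

(** The homogeneous form T(v, .., v) of degree n. *)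
Definition polar n (T : seq 'I_2 -> R) v : R :=
  nsum n (fun s => T s * \prod_(i <- s) Defs.coord i v).

Lemma is_derive_nsum n (F : seq 'I_2 -> R * R -> R) dF x v :
  (forall s, is_derive x v (F s) (dF s)) ->
  is_derive x v (fun x => nsum n (F ^~ x)) (nsum n dF).
Proof.
elim: n F dF => [|n IH] F dF FdF /=; first exact: FdF.
rewrite !isum_fun.
by apply: is_deriveD; apply: (IH (fun s => F (_ :: s)) (fun s => dF (_ :: s))).
Qed.

Lemma iter_dird n v f : smooth f ->
  iter n (dird v) f = fun x => polar n (fun s => partials s f x) v.
Proof.
move=> sf; elim: n => [|n IH]; apply/funext => x.
  by rewrite /polar /= big_nil mulr1.
have pd_polar i : pd i (fun x => polar n (fun s => partials s f x) v) x =
    polar n (fun s => partials (i :: s) f x) v.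
  rewrite pdE /polar; apply: derive_val; apply: is_derive_nsum => s.
  set c := \prod_(_ <- _) _.
  have -> : (fun x => partials s f x * c) = c \*: partials s f.
    by apply/funext => z /=; rewrite mulrC.
  have [_ /(_ i x)/derivableP H] := smoothP _ (smooth_partials s _ sf).
  by apply: is_derive_eq; rewrite /= mulrC.
rewrite iterS IH /dird !pd_polar /polar /= isumE !mulr_nsum.
by congr (_ + _); apply: eq_nsum => s _; rewrite big_cons mulrCA.
Qed.

Lemma smooth_dird v f : smooth f -> smooth (dird v f).
Proof.
move=> sf; apply: smoothD; apply: smoothM; try exact: smooth_cst.
- exact: smooth_pd.
- exact: smooth_pd.
Qed.

Lemma ler_norm_nsum n F G :
  (forall s, size s = n -> `|F s| <= G s) -> `|nsum n F : R| <= nsum n G.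
Proof.
elim: n F G => [|n IH] F G FG /=; first exact: FG.
rewrite !isumE (le_trans (ler_normD _ _))// lerD// IH// => s sn; apply: FG;
  by rewrite /= sn.
Qed.

Lemma nsum_prod n (c : 'I_2 -> R) : nsum n (fun s => \prod_(i <- s) c i) = isum c ^+ n.
Proof.
elim: n => [|n IH] /=; first by rewrite big_nil.
rewrite exprSr mulr_isum; apply: eq_isum => i; rewrite -IH mulrC mulr_nsum.
by apply: eq_nsum => s _; rewrite big_cons.
Qed.

Definition norm1 v : R := `|v.1| + `|v.2|.

Lemma norm1_ge0 v : 0 <= norm1 v. Proof. exact: addr_ge0. Qed.

Lemma polar_le n T (C : R) v : (forall s, size s = n -> `|T s| <= C) ->
  `|polar n T v| <= C * norm1 v ^+ n.
Proof.
move=> TC; rewrite /norm1 -[X in _ * X ^+ _](isumE (fun i => `|Defs.coord i v|)).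
rewrite -nsum_prod mulr_nsum; apply: ler_norm_nsum => s sn.
by rewrite normrM normr_prod ler_wpM2r ?TC// prodr_ge0.
Qed.

Lemma bounded_box f x (r : R) : 0 <= r -> continuous f ->
  exists2 C : R, 0 <= C & forall p : R * R, `|p.1 - x.1| <= r -> `|p.2 - x.2| <= r ->
    `|f p| <= C.
Proof.
move=> r0 cf; pose A : set (R * R) :=
  (`[x.1 - r, x.1 + r]%classic `*` `[x.2 - r, x.2 + r]%classic).
have cA : compact A by apply: compact_setX; exact: segment_compact.
have A0 : A !=set0.
  by exists x; split => /=; rewrite in_itv/= lerBlDr lerDl r0.
have cnf : {within A, continuous (fun p => `|f p|)}.
  apply: continuous_subspaceT => p.
  exact: (cvg_norm (cf p)).
have [c _ H] := compact_EVT_max A0 cA cnf.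
exists `|f c| => // p p1 p2; apply: H; rewrite inE; split => /=;
  by rewrite in_itv/= -ler_distlC distrC.
Qed.

Lemma bounded_partials f x n : smooth f ->
  exists2 C : R, 0 <= C & forall s, size s = n -> forall p : R * R,
    `|p.1 - x.1| <= 1 -> `|p.2 - x.2| <= 1 -> `|partials s f p| <= C.
Proof.
elim: n f => [|n IH] f sf.
  have [cf _] := smoothP _ sf.
  have [C C0 H] := bounded_box f x 1 ler01 cf.
  by exists C => // s /size0nil -> p; exact: H.
have [C C0 HC] := IH _ (smooth_pd ord0 _ sf).
have [D D0 HD] := IH _ (smooth_pd ord_max _ sf).
exists (C + D) => [|s]; first exact: addr_ge0.
elim/last_ind: s => [//|s i _]; rewrite size_rcons => -[sn] p p1 p2.
rewrite partials_rcons.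
case: i => [[|[|//]] i2].
- rewrite (_ : Ordinal i2 = ord0); last exact/val_inj.
  by rewrite (le_trans (HC s sn p p1 p2))// lerDl.
- rewrite (_ : Ordinal i2 = ord_max); last exact/val_inj.
  by rewrite (le_trans (HD s sn p p1 p2))// lerDr.
Qed.

(** [taylor_bound] on the segment s -> x + s v, whose derivatives are polar forms of the partial
    derivatives ([iter_dird]). The constant bounds the partial derivatives of order n on the unit
    box around x. *)
Lemma taylor2 f x n : smooth f ->
  exists2 C : R, 0 <= C & forall v : R * R, norm1 v <= 1 ->
    `|f (x + v) - \sum_(k < n) polar k (fun s => partials s f x) v / k`!%:R|
      <= C * norm1 v ^+ n.
Proof.
move=> sf; have [C C0 HC] := bounded_partials f x n sf.
exists C => // v v1.
pose g k (s : R) := iter k (dird v) f (s *: v + x).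
have dg k (s : R) : is_derive s 1 (g k) (g k.+1 s).
  have sk : smooth (iter k (dird v) f).
    by elim: k => [//|k IH] /=; exact: smooth_dird.
  have /is_derive_line := is_derive_dird _ (s *: v + x) v sk.
  move=> H; apply/is_derive_shift1; move: H; congr is_derive.
  by apply/funext => h; rewrite /g scalerDl addrA.
have gn (s : R) : 0 <= s <= 1 -> `|g n s| <= C * norm1 v ^+ n.
  move=> /andP[s0 s1]; rewrite /g iter_dird//; apply: polar_le => u un.
  have b (a : R) : `|a| <= 1 -> `|s * a| <= 1.
    by move=> a1; rewrite normrM (ger0_norm s0) mulr_ile1.
  apply: HC => //=; rewrite addrK; apply: b; apply: le_trans v1; rewrite /norm1.
  - by rewrite lerDl.
  - by rewrite lerDr.
have := taylor_bound g n _ dg gn 1; rewrite ler01 lexx => /(_ isT).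
rewrite {1}/g /= scale1r (addrC v) => H; apply: le_trans H; rewrite le_eqVlt; apply/orP; left; apply/eqP; congr (`|_ - _|).
by apply: eq_bigr => k _; rewrite /g iter_dird// scale0r add0r expr1n mulr1.
Qed.

End taylor.

(** * Integration on the plane *)

Section plane_integral.
Context {R : realType}.
Notation mu := (@lebesgue_measure R).
Notation mu2 := (mu \x mu)%E.
Implicit Types (f g : R * R -> R).

(** An open set is the union of the rational boxes that it contains. The union runs over all
    rational boxes, those not contained in U being emptied, so that the index set is visibly
    countable; this makes continuous functions measurable for the product sigma-algebra. *)
Lemma open_bigcup_box (U : set (R * R)) : open U ->
  U = \bigcup_(q : (rat * rat) * (rat * rat))
    ((if `[< `]ratr q.1.1, ratr q.1.2[%classic `*`
             `]ratr q.2.1, ratr q.2.2[%classic `<=` U >] then setT else set0) `&`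
      (`]ratr q.1.1, ratr q.1.2[%classic `*` `]ratr q.2.1, ratr q.2.2[%classic)).
Proof.
move=> oU; apply/seteqP; split => [x Ux|x [q _ []]]; last first.
  by case: asboolP => // qU _; exact: qU.
have /nbhs_ballP[e /= e0 eU] : nbhs x U by apply: open_nbhs_nbhs.
have rat_near (a : R) : exists q : rat * rat,
    `]ratr q.1, ratr q.2[%classic a /\
    `]ratr q.1, ratr q.2[ `<=` (ball a e : set R).
  have [p] := @rat_in_itvoo _ (a - e) a ltac:(by rewrite ltrBlDr ltrDl).
  have [q] := @rat_in_itvoo _ a (a + e) ltac:(by rewrite ltrDl).
  rewrite !in_itv/= => /andP[aq qe] /andP[ep pa]; exists (p, q); split => /=.
    by rewrite in_itv/= pa aq.
  move=> z /=; rewrite in_itv/= /ball/= ltr_distlC => /andP[pz zq].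
  by rewrite (lt_trans ep pz) (lt_trans zq qe).
have [q1 [x1 B1]] := rat_near x.1; have [q2 [x2 B2]] := rat_near x.2.
exists (q1, q2) => //=; split; last by split.
case: asboolP => // -[] z [z1 z2]; apply: eU.
by split; [exact: B1|exact: B2].
Qed.

Lemma continuous_measurable_fun2 f : continuous f ->
  measurable_fun [set: measurableTypeR R * measurableTypeR R] f.
Proof.
move=> /continuousP cf; apply: (measurability _ (RGenOpens.measurableE R)).
move=> _ [_ [a [b ->] <-]]; rewrite setTI.
rewrite (open_bigcup_box _ (cf _ (interval_open _ _)))//.
apply: countable_bigcupT_measurable => // q; apply: measurableI.
  by case: ifP => _; [exact: measurableT|exact: measurable0].
by apply: measurableX; exact: measurable_itv.
Qed.

Lemma ge0_integral_reflect (G : R -> R) : continuous G -> (forall x, 0 <= G x) ->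
  (\int[mu]_x (G x)%:E = \int[mu]_x (G (- x))%:E)%E.
Proof.
move=> cG G0; have mG := continuous_measurable_fun cG.
transitivity (\int[pushforward mu (-%R : _ -> measurableTypeR R)]_x (G x)%:E)%E.
  by apply: eq_measure_integral => /= A mA _; exact/esym/lebesgue_measureN.
rewrite ge0_integral_pushforward//=.
- exact/measurable_EFinP.
- by move=> x _; rewrite lee_fin.
Qed.

Lemma ge0_integral_affine_gt0 (G : R -> R) (a b : R) :
  continuous G -> (forall x, 0 <= G x) -> 0 < a ->
  (\int[mu]_x (G x)%:E = \int[mu]_x (a * G (a * x + b))%:E)%E.
Proof.
move=> cG G0 a0; pose F (x : R) := a * x + b.
have dF (x : R) : is_derive x 1 F a.
  have -> : F = a \*: id + cst b by [].
  by apply: is_derive_eq; rewrite addr0 [_ *: _]mulr1.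
have F'E : derive1 F = cst a.
  by apply/funext => x; rewrite derive1E; have [] := dF x.
rewrite (@increasing_ge0_integration_by_substitutionT _ F)//.
- by apply: eq_integral => x _; rewrite F'E /= mulrC.
- by move=> x y xy; rewrite /F ltrD2r ltr_pM2l.
- by rewrite F'E; exact: cst_continuous.
- by rewrite F'E; exact: is_cvg_cst.
- by rewrite F'E; exact: is_cvg_cst.
- apply/cvgrNyPle => A; exists ((A - b) / a); split; first exact: num_real.
  by move=> x /ltW; rewrite ler_pdivlMr// lerBrDr mulrC.
- apply/cvgryPge => A; exists ((A - b) / a); split; first exact: num_real.
  by move=> x /ltW; rewrite ler_pdivrMr// lerBlDr mulrC.
Qed.

Lemma ge0_integral_affine (G : R -> R) (a b : R) :
  continuous G -> (forall x, 0 <= G x) -> a != 0 ->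
  (\int[mu]_x (G x)%:E = \int[mu]_x (`|a| * G (a * x + b))%:E)%E.
Proof.
move=> cG G0 aN0; have [a0|a0] := ltP 0 a.
  by rewrite gtr0_norm//; exact: ge0_integral_affine_gt0.
have {}a0 : a < 0 by rewrite lt_neqAle aN0.
rewrite ltr0_norm// (ge0_integral_affine_gt0 _ (- a) b)//; last by rewrite oppr_gt0.
rewrite ge0_integral_reflect.
- by under eq_integral do rewrite mulrNN.
- move=> x; apply: cvgM; first exact: cvg_cst.
  apply: (@cvg_comp _ _ _ (fun x => - a * x + b) G); last exact: cG.
  apply: cvgD; last exact: cvg_cst.
  by apply: cvgM; [exact: cvg_cst|exact: cvg_id].
- by move=> x; rewrite mulr_ge0// oppr_ge0 ltW.
Qed.

(** The linear map of the upper triangular matrix with rows (a, b) and (0, c), of determinant a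
    c. *)
Definition tri (a b c : R) (y : R * R) : R * R := (a * y.1 + b * y.2, c * y.2).

Lemma continuous_plane_comp f (g h : R * R -> R) : continuous f ->
  continuous g -> continuous h -> continuous (fun y => f (g y, h y)).
Proof.
move=> cf cg ch y; apply: (@cvg_comp _ _ _ (fun y => (g y, h y)) f); last exact: cf.
exact: (cvg_pair (cg y) (ch y)).
Qed.

Lemma continuous_slice1 f (y : R) : continuous f -> continuous (fun x => f (x, y)).
Proof.
move=> cf x; apply: (@cvg_comp _ _ _ (fun x => (x, y)) f); last exact: cf.
by apply: (@cvg_pair _ _ _ _ (nbhs x) (nbhs y)); [exact: cvg_id|exact: cvg_cst].
Qed.

Lemma continuous_slice2 f (x : R) : continuous f -> continuous (fun y => f (x, y)).
Proof.
move=> cf y; apply: (@cvg_comp _ _ _ (fun y => (x, y)) f); last exact: cf.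
by apply: (@cvg_pair _ _ _ _ (nbhs x) (nbhs y)); [exact: cvg_cst|exact: cvg_id].
Qed.

Lemma continuous_affine1 (a b c : R) : continuous (fun y : R * R => a * y.1 + b * y.2 + c).
Proof.
move=> y; apply: cvgD; last exact: cvg_cst.
apply: cvgD; apply: cvgM; try exact: cvg_cst; [exact: cvg_fst|exact: cvg_snd].
Qed.

(* The shear comes first, with the second variable fixed, so that only        *)
(* continuous functions of one variable are substituted into.                 *)
Lemma ge0_integral_tri f (x : R * R) (a b c : R) :
  continuous f -> (forall x, 0 <= f x) -> a != 0 -> c != 0 ->
  (\int[mu2]_z (f z)%:E =
   \int[mu2]_y (`|a * c| * f (x + tri a b c y))%:E)%E.
Proof.
move=> cf f0 a0 c0.
have mf g : continuous g -> measurable_fun setT (EFin \o g : measurableTypeR R * measurableTypeR R -> \bar R).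
  by move=> cg; apply/measurable_EFinP; exact: continuous_measurable_fun2.
pose k := b / c.
pose g (y : R * R) := `|a| * f (a * y.1 + k * y.2 + (x.1 - k * x.2), y.2).
have cg : continuous g.
  move=> y; apply: cvgM; first exact: cvg_cst.
  apply: (continuous_plane_comp _ (fun y : R * R => a * y.1 + k * y.2 + (x.1 - k * x.2)) snd cf); last by move=> z; exact: cvg_snd.
  exact: continuous_affine1.
pose h (y : R * R) := `|a * c| * f (x + tri a b c y).
have hE y : h y = `|c| * g (y.1, c * y.2 + x.2).
  rewrite /h /g; have -> : x + tri a b c y =
      (a * y.1 + k * (c * y.2 + x.2) + (x.1 - k * x.2), c * y.2 + x.2).
    rewrite /tri /k; case: (x) => x1 x2 /=.
    transitivity (x1 + (a * y.1 + b * y.2), x2 + c * y.2); first by [].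
    by congr (_, _); [field|rewrite addrC].
  by rewrite normrM /=; ring.
have ch : continuous h.
  have -> : h = fun y => `|c| * g (1 * y.1 + 0 * y.2 + 0, 0 * y.1 + c * y.2 + x.2).
    by apply/funext => y; rewrite hE mul1r !mul0r !addr0 add0r.
  move=> y; apply: cvgM; first exact: cvg_cst.
  exact: (continuous_plane_comp _ (fun y : R * R => 1 * y.1 + 0 * y.2 + 0)
    (fun y : R * R => 0 * y.1 + c * y.2 + x.2) cg (continuous_affine1 _ _ _)
    (continuous_affine1 _ _ _)).
rewrite fubini_tonelli2//; last exact: mf.
transitivity (\int[mu]_v \int[mu]_u (g (u, v))%:E)%E.
  apply: eq_integral => v _ /=.
  rewrite [LHS](ge0_integral_affine (fun u => f (u, v)) a (k * v + (x.1 - k * x.2)))//.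
    by apply: eq_integral => u _; rewrite /g /= addrA.
  exact: continuous_slice1.
have g0 z : 0 <= g z by rewrite mulr_ge0.
have mg : measurable_fun setT
    (EFin \o g : measurableTypeR R * measurableTypeR R -> \bar R) by exact: mf.
transitivity (\int[mu]_u \int[mu]_v (g (u, v))%:E)%E.
  have FT := @fubini_tonelli _ _ _ _ R mu mu _ mg.
  by rewrite [RHS]FT// => z; rewrite lee_fin.
transitivity (\int[mu]_u \int[mu]_v (h (u, v))%:E)%E.
  apply: eq_integral => u _ /=.
  rewrite [LHS](ge0_integral_affine (fun v => g (u, v)) c x.2)//.
    by apply: eq_integral => v _; rewrite hE.
  exact: continuous_slice2.
have mh : measurable_fun setT
    (EFin \o h : measurableTypeR R * measurableTypeR R -> \bar R) by exact: mf.
have FT := @fubini_tonelli1 _ _ _ _ R mu mu _ mh.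
by rewrite [RHS]FT// => z; rewrite lee_fin mulr_ge0.
Qed.

End plane_integral.

(** * Gaussian moments on the line *)

Section gaussian_line.
Context {R : realType}.
Notation mu := (@lebesgue_measure R).

Lemma expr_le_expR (n : nat) (z : R) : 0 <= z -> z ^+ n <= n`!%:R * expR z.
Proof.
move=> z0; case: n => [|n].
  by rewrite expr0 fact0 mul1r -expR0 ler_expR.
have F0 : 0 < n.+1`!%:R :> R by rewrite ltr0n fact_gt0.
rewrite -ler_pdivrMl// mulrC (le_trans _ (expR_ge1Dxn n z0))//.
by rewrite lerDr.
Qed.

(** The exponential series bounds x^(2n) by n!/e^n times exp(e x^2). This dominates |x|^n when |x| >
    1; otherwise |x|^n is at most 1. *)
Lemma expr_norm_le_expR (n : nat) (e : R) : 0 < e ->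
  exists2 K : R, 0 <= K & forall x : R, `|x| ^+ n <= K * expR (e * x ^+ 2).
Proof.
move=> e0; exists (1 + n`!%:R / e ^+ n).
  by rewrite addr_ge0// divr_ge0// exprn_ge0// ltW.
move=> x; have x20 : 0 <= e * x ^+ 2 by rewrite mulr_ge0 ?sqr_ge0// ltW.
have H := expr_le_expR n _ x20.
have E1 : 1 <= expR (e * x ^+ 2) by rewrite -expR0 ler_expR.
have en0 : 0 < e ^+ n by rewrite exprn_gt0.
have {}H : `|x| ^+ n * `|x| ^+ n <= n`!%:R / e ^+ n * expR (e * x ^+ 2).
  rewrite mulrAC ler_pdivlMr// (le_trans _ H)// exprMn -real_normK ?num_real//.
  by rewrite mulrC -expr2 exprAC.
rewrite mulrDl mul1r; have [x1|x1] := leP `|x| 1.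
  apply: ler_wpDr; first by rewrite mulr_ge0 ?expR_ge0// divr_ge0// ltW.
  by apply: le_trans E1; exact: exprn_ile1.
apply: ler_wpDl; first exact: expR_ge0.
apply: le_trans H; rewrite ler_peMl ?exprn_ge0//.
by rewrite exprn_ege1// ltW.
Qed.

Definition gexp (k x : R) : R := expR (- (k * x ^+ 2)).

Lemma gexp_ge0 k x : 0 <= gexp k x. Proof. exact: expR_ge0. Qed.

Lemma gexpD k l x : gexp (k + l) x = gexp k x * gexp l x.
Proof. by rewrite /gexp -expRD mulrDl opprD. Qed.

Lemma is_derive_pow (n : nat) (x : R) :
  is_derive x 1 (@GRing.exp R ^~ n) (n%:R * x ^+ n.-1).
Proof.
by split; [exact: exprn_derivable|rewrite exp_derive [LHS]mulr1].
Qed.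

Lemma is_derive_gexp (k x : R) :
  is_derive x 1 (gexp k) (- (2 * k * x) * gexp k x).
Proof.
have H : is_derive x 1 (fun x : R => - (k * x ^+ 2)) (- (2 * k * x)).
  have -> : (fun x : R => - (k * x ^+ 2)) = (- k) \*: (@GRing.exp R ^~ 2%N).
    by apply/funext => z; rewrite /= scaleNr.
  apply: (is_derive_eq (@is_deriveZ _ _ _ _ (- k) x 1 _ (is_derive_pow 2 x))).
  by rewrite /GRing.scale /=; ring.
apply: (is_derive_eq (@is_derive1_comp R expR (fun x : R => - (k * x ^+ 2)) x _ _ _ H)).
by rewrite mulrC.
Qed.

Lemma is_derive_pow_gexp (n : nat) (k x : R) :
  is_derive x 1 (fun x => x ^+ n.+1 * gexp k x)
    (n.+1%:R * (x ^+ n * gexp k x) - 2 * k * (x ^+ n.+2 * gexp k x)).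
Proof.
have H := @is_deriveM _ _ _ _ _ _ _ _ (is_derive_pow n.+1 x) (is_derive_gexp k x).
have -> : (fun x => x ^+ n.+1 * gexp k x) = (@GRing.exp R ^~ n.+1) * gexp k by [].
apply: (is_derive_eq H).
by rewrite /GRing.scale /= !exprS; ring.
Qed.

Lemma is_derive_continuous (f df : R -> R) :
  (forall x : R, is_derive x 1 f (df x)) -> continuous f.
Proof.
by move=> fdf x; apply/differentiable_continuous/derivable1_diffP/ex_derive.
Qed.

Lemma continuous_pow_gexp n k : continuous (fun x : R => x ^+ n * gexp k x).
Proof.
move=> x; apply: cvgM; first exact: exprn_continuous.
exact: (is_derive_continuous _ _ (is_derive_gexp k)).
Qed.

Lemma integrable_oneDsqrV : mu.-integrable setT (EFin \o (fun x : R => (oneDsqr x)^-1)).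
Proof.
have c : continuous (fun x : R => (oneDsqr x)^-1) by exact: continuous_oneDsqrV.
apply/integrableP; split.
  by apply/measurable_EFinP; exact: continuous_measurable_fun.
rewrite (_ : (\int[mu]_x _)%E = (\int[mu]_x (oneDsqr x)^-1%:E)%E); last first.
  by apply: eq_integral => x _ /=; rewrite ger0_norm// invr_ge0.
rewrite ge0_symfun_integralT//.
- rewrite (_ : [set x | _] = `[0, +oo[%classic); last first.
    by apply/seteqP; split => x /=; rewrite in_itv/= andbT.
  by rewrite integral0y_oneDsqr -EFinM ltry.
- by move=> x; rewrite /oneDsqr /= sqrrN.
Qed.

Lemma gexp_le_oneDsqrV (k : R) : 0 < k ->
  exists2 K : R, 0 <= K & forall x, gexp k x <= K * (oneDsqr x)^-1.
Proof.
move=> k0; exists (1 + k^-1); first by rewrite addr_ge0// invr_ge0 ltW.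
move=> x; have d0 : 0 < oneDsqr x by [].
rewrite ler_pdivlMr// /gexp expRN mulrC ler_pdivrMr ?expR_gt0//.
have H := expR_ge1Dx (k * x ^+ 2); apply: (@le_trans _ _ ((1 + k^-1) * (1 + k * x ^+ 2))).
  have -> : (1 + k^-1) * (1 + k * x ^+ 2) = oneDsqr x + k * x ^+ 2 + k^-1.
    by rewrite /oneDsqr; field; rewrite gt_eqF.
  rewrite -addrA lerDl addr_ge0 ?invr_ge0 ?(ltW k0)//.
  by rewrite mulr_ge0 ?sqr_ge0 ?(ltW k0).
apply: ler_wpM2l; last exact: H.
by rewrite addr_ge0// invr_ge0 ltW.
Qed.

(** Half of the exponent absorbs the power, and the other half is dominated by a multiple of 1/(1 +
    x^2). *)
Lemma integrable_pow_gexp n (k : R) : 0 < k ->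
  mu.-integrable setT (EFin \o (fun x : R => x ^+ n * gexp k x)).
Proof.
move=> k0; have k2 : 0 < k / 2 by rewrite divr_gt0.
have [K K0 HK] := expr_norm_le_expR n _ k2.
have [M M0 HM] := gexp_le_oneDsqrV _ k2.
apply: (@le_integrable _ _ _ mu setT measurableT _ (fun x => (K * M)%:E * (oneDsqr x)^-1%:E)%E).
- apply/measurable_EFinP; apply: continuous_measurable_fun.
  exact: continuous_pow_gexp.
- move=> x _ /=; rewrite lee_fin [leRHS]ger0_norm; last first.
    by rewrite !mulr_ge0.
  rewrite normrM normrX (ger0_norm (gexp_ge0 _ _)) -mulrA.
  have -> : gexp k x = gexp (k / 2) x * gexp (k / 2) x.
    by rewrite -gexpD -splitr.
  apply: le_trans (ler_wpM2l K0 (HM x)); rewrite mulrA ler_wpM2r ?gexp_ge0//.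
  by rewrite /gexp expRN ler_pdivrMr ?expR_gt0.
- exact/integrableZl/integrable_oneDsqrV.
Qed.

Definition gmom (n : nat) : R := \int[mu]_x (x ^+ n * gexp 2^-1 x).

Lemma ge0_integrable_EFin (d : measure_display) (T : measurableType d)
  (m : {measure set T -> \bar R}) (f : T -> R) :
  m.-integrable setT (EFin \o f) -> (\int[m]_x (f x)%:E = (\int[m]_x f x)%:E)%E.
Proof. by move=> H; rewrite /Rintegral fineK// integrable_fin_num. Qed.

Lemma gmom0 : gmom 0 = Num.sqrt (2 * pi).
Proof.
(* Dilation by 1/sqrt 2 turns the known integral of exp(-x^2) into that of exp(-x^2/2). *)
rewrite /gmom; pose a : R := (Num.sqrt 2)^-1.
have s2 : 0 < Num.sqrt 2 :> R by rewrite sqrtr_gt0.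
have a0 : 0 < a by rewrite invr_gt0.
have E := @ge0_integral_affine_gt0 R gauss_fun a 0
  (@continuous_gauss_fun R) (@gauss_fun_ge0 R) a0.
rewrite integralT_gauss in E.
have H x : (a * gauss_fun (a * x + 0))%:E = (a%:E * (x ^+ 0 * gexp 2^-1 x)%:E)%E.
  rewrite -EFinM expr0 mul1r /gauss_fun /gexp addr0 exprMn /a exprVn.
  by rewrite sqr_sqrtr.
have ig : mu.-integrable setT (EFin \o (fun x : R => x ^+ 0 * gexp 2^-1 x)).
  by apply: integrable_pow_gexp; rewrite invr_gt0.
have {}E : (Num.sqrt pi)%:E = (a%:E * \int[mu]_x (x ^+ 0 * gexp 2^-1 x)%:E)%E.
  by rewrite E -integralZl//; apply: eq_integral => x _; exact: H.
rewrite (ge0_integrable_EFin _ _ _ _ ig) in E; case: E; rewrite -/(gmom 0) => E.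
have : Num.sqrt 2 * Num.sqrt pi = gmom 0.
  by rewrite E /a mulVKf// gt_eqF.
by rewrite -sqrtrM.
Qed.

(** The reflection formula is for non-negative functions, so it is applied to f + |f|, which
    reflection sends to |f| - f. *)
Lemma gmom_odd n : odd n -> gmom n = 0.
Proof.
move=> on; pose f (x : R) := x ^+ n * gexp 2^-1 x.
have cf : continuous f by exact: continuous_pow_gexp.
have fi : mu.-integrable setT (EFin \o f) by apply: integrable_pow_gexp; rewrite invr_gt0.
have fN x : f (- x) = - f x.
  by rewrite /f exprNn -signr_odd on expr1 mulN1r mulNr /gexp sqrrN.
pose g x := f x + `|f x|.
have ni : mu.-integrable setT (EFin \o (fun x => `|f x|)) by exact: integrable_norm.
have cg : continuous g.
  by move=> x; apply: cvgD; [exact: cf|apply: cvg_norm; exact: cf].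
have g0 x : 0 <= g x by rewrite /g -lerBlDl sub0r -normrN ler_norm.
have E : \int[mu]_x (f x + `|f x|) = \int[mu]_x (`|f x| - f x).
  rewrite /Rintegral; congr fine; rewrite [LHS](ge0_integral_reflect g cg g0).
  by apply: eq_integral => x _; rewrite /g fN normrN addrC.
rewrite (RintegralD measurableT fi ni) (RintegralB measurableT ni fi) in E.
by move: E; rewrite -/(gmom n); lra.
Qed.

(** Integration by parts on the half line: x^(n+1) exp(-x^2/2) vanishes at both ends and has
    derivative (n+1) f_n - f_(n+2). The fundamental theorem is used for non-negative integrands, so
    h(x) = K x exp(-x^2/4), which dominates f_(n+2) and has an explicit primitive, is added; q and h
    then have the same integral 2K. Evenness of n carries the result to the whole line. *)
Lemma gmomSS n : ~~ odd n -> gmom n.+2 = n.+1%:R * gmom n.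
Proof.
move=> en; pose f (m : nat) (x : R) := x ^+ m * gexp 2^-1 x.
have i2 : 0 < 2^-1 :> R by rewrite invr_gt0.
have i4 : 0 < 4^-1 :> R by rewrite invr_gt0.
have [K K0 HK] := expr_norm_le_expR n.+1 _ i4.
have g24 x : gexp 2^-1 x = gexp 4^-1 x * gexp 4^-1 x.
  rewrite -gexpD; suff -> : 2^-1 = 4^-1 + 4^-1 :> R by [].
  by field.
pose h (x : R) := K * (x * gexp 4^-1 x).
have fh x : 0 <= x -> f n.+2 x <= h x.
  move=> x0; rewrite /f /h exprS -mulrA (mulrCA K) ler_wpM2l//.
  have := HK x; rewrite ger0_norm// => {}HK.
  rewrite g24 mulrA ler_wpM2r ?gexp_ge0//.
  by rewrite /gexp expRN ler_pdivrMr ?expR_gt0.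
have dh (x : R) : is_derive x 1 (fun x => - (2 * K) * gexp 4^-1 x) (h x).
  apply: (is_derive_eq (@is_deriveZ _ _ _ _ (- (2 * K)) x 1 _ (is_derive_gexp 4^-1 x))).
  by rewrite /h /GRing.scale /=; field.
have cgexp k : 0 < k -> gexp k x @[x --> +oo] --> (0 : R).
  move=> k0; apply: (@cvg_comp _ _ _ (fun x => k * x ^+ 2) (fun x : R => expR (- x)));
    last exact: cvgr_expR.
  apply/cvgryPge => A; exists (Num.max 1 (A / k)); split; first exact: num_real.
  move=> x; rewrite gt_max => /andP[x1]; rewrite ltr_pdivrMr// mulrC => /ltW kA.
  by rewrite (le_trans kA)// ler_wpM2l ?(ltW k0)// expr2 ler_peMl ?ltW// (lt_trans _ x1).
have cf m : continuous (f m) by exact: continuous_pow_gexp.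
have ch : continuous h.
  move=> x; apply: cvgM; first exact: cvg_cst.
  by have := continuous_pow_gexp 1 4^-1 x; under eq_fun do rewrite expr1.
pose q x := n.+1%:R * f n x - f n.+2 x + h x.
have cq : continuous q.
  move=> x; apply: cvgD; last exact: ch.
  by apply: cvgB; [apply: cvgM; [exact: cvg_cst|exact: cf]|exact: cf].
have ftc_h : (\int[mu]_(x in `[0%R, +oo[) (h x)%:E = (2 * K)%:E)%E.
  rewrite (@ge0_continuous_FTC2y _ _ (fun x => - (2 * K) * gexp 4^-1 x) 0 0).
  - by rewrite /gexp expr0n mulr0 oppr0 expR0 sub0e mulr1 EFinN oppeK.
  - by move=> x x0; rewrite /h !mulr_ge0 ?gexp_ge0.
  - exact: continuous_subspaceT.
  - rewrite -[X in _ --> X](mulr0 (- (2 * K))).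
    by apply: cvgM; [exact: cvg_cst|exact: cgexp].
  - by move=> x _; have [] := dh x.
  - by apply: cvg_at_right_filter; exact: (is_derive_continuous _ _ dh).
  - by move=> x _; rewrite derive1E; have [] := dh x.
pose F (x : R) := x ^+ n.+1 * gexp 2^-1 x + - (2 * K) * gexp 4^-1 x.
have dF (x : R) : is_derive x 1 F (q x).
  apply: (is_derive_eq (is_deriveD (is_derive_pow_gexp n 2^-1 x) (dh x))).
  by rewrite /q /f divff ?mul1r// pnatr_eq0.
have ftc_q : (\int[mu]_(x in `[0%R, +oo[) (q x)%:E = (2 * K)%:E)%E.
  rewrite (@ge0_continuous_FTC2y _ _ F 0 0).
  - rewrite -EFinB /F /gexp !expr0n /= !mulr0 oppr0 expR0; congr EFin; ring.
  - move=> x x0; rewrite /q -addrA addr_ge0// ?mulr_ge0 ?exprn_ge0 ?gexp_ge0//.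
    by rewrite addrC subr_ge0 fh.
  - exact: continuous_subspaceT.
  - rewrite -[X in _ --> X]addr0 -[X in _ --> _ + X](mulr0 (- (2 * K))).
    apply: cvgD; last by apply: cvgM; [exact: cvg_cst|exact: cgexp].
    apply: (@squeeze_cvgr _ _ _ _ (fun=> 0) (fun x => K * gexp 4^-1 x)).
    + exists 0; split; first exact: num_real.
      move=> x x0; rewrite !mulr_ge0 ?exprn_ge0 ?gexp_ge0 ?(ltW x0)//= g24 mulrA.
      rewrite ler_wpM2r ?gexp_ge0// /gexp expRN ler_pdivrMr ?expR_gt0//.
      by have := HK x; rewrite gtr0_norm.
    + exact: cvg_cst.
    + rewrite -[X in _ --> X](mulr0 K).
      by apply: cvgM; [exact: cvg_cst|exact: cgexp].
  - by move=> x _; have [] := dF x.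
  - by apply: cvg_at_right_filter; exact: (is_derive_continuous _ _ dF).
  - by move=> x _; rewrite derive1E; have [] := dF x.
pose r m : R := \int[mu]_(x in `[0%R, +oo[) f m x.
have rE m : (\int[mu]_(x in `[0%R, +oo[) (f m x)%:E = (r m)%:E)%E.
  rewrite /r /Rintegral fineK// integrable_fin_num//.
  by apply: (integrableS _ _ _ (integrable_pow_gexp m _ i2)).
have mf (p : R -> R) : continuous p -> measurable_fun (`[0%R, +oo[%classic : set R) (EFin \o p).
  by move=> cp; apply/measurable_EFinP/measurable_funTS; exact: continuous_measurable_fun.
have f0 m x : 0 <= x -> 0 <= f m x.
  by move=> x0; rewrite mulr_ge0 ?exprn_ge0 ?gexp_ge0.
have q0 x : 0 <= x -> 0 <= q x.
  move=> x0; rewrite /q -addrA; apply: addr_ge0.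
    by apply: mulr_ge0; [exact: ler0n|exact: f0].
  by rewrite addrC subr_ge0 fh.
have h0 x : 0 <= x -> 0 <= h x by move=> x0; rewrite !mulr_ge0 ?gexp_ge0.
have rS : r n.+2 = n.+1%:R * r n.
  have E : (\int[mu]_(x in `[0%R, +oo[) ((q x)%:E + (f n.+2 x)%:E) =
            \int[mu]_(x in `[0%R, +oo[) (n.+1%:R%:E * (f n x)%:E + (h x)%:E))%E.
    by apply: eq_integral => x _; rewrite -EFinM -!EFinD /q; congr EFin; ring.
  rewrite ge0_integralD// in E; last 4 first.
  - by move=> x /=; rewrite in_itv/= andbT lee_fin => /q0.
  - exact: mf.
  - by move=> x /=; rewrite in_itv/= andbT lee_fin => /f0.
  - exact: mf.
  rewrite ge0_integralD// in E; last 4 first.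
  - by move=> x /=; rewrite in_itv/= andbT -EFinM lee_fin => /f0 ?; rewrite mulr_ge0.
  - apply: (mf (fun x => n.+1%:R * f n x)) => x.
    by apply: cvgM; [exact: cvg_cst|exact: cf].
  - by move=> x /=; rewrite in_itv/= andbT lee_fin => /h0.
  - exact: mf.
  rewrite ge0_integralZl// in E; last 2 first.
  - exact: mf.
  - by move=> x /=; rewrite in_itv/= andbT lee_fin => /f0.
  rewrite ftc_q ftc_h !rE -EFinM -!EFinD in E.
  by case: E => E; lra.
have gmomE m : ~~ odd m -> gmom m = 2 * r m.
  move=> em; rewrite /gmom /Rintegral ge0_symfun_integralT.
  - rewrite (_ : [set x | _] = `[0%R, +oo[%classic); last first.
      by apply/seteqP; split => x /=; rewrite in_itv/= andbT.
    by rewrite -/(f m) rE.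
  - by move=> x; rewrite mulr_ge0 ?gexp_ge0// exprn_even_ge0.
  - exact: cf.
  - by move=> x; rewrite /= exprNn -signr_odd (negbTE em) expr0 mul1r /gexp sqrrN.
by rewrite !gmomE/= ?negbK// rS mulrCA.
Qed.

Lemma gmomE n : gmom n = Num.sqrt (2 * pi) * moment n.
Proof.
suff [//] : gmom n = Num.sqrt (2 * pi) * moment n /\
    gmom n.+1 = Num.sqrt (2 * pi) * moment n.+1.
elim: n => [|n [IH IHS]].
  by split; [rewrite gmom0 mulr1|rewrite gmom_odd ?mulr0].
split; first exact: IHS.
have momentSS : moment n.+2 = n.+1%:R * moment n :> R by [].
rewrite momentSS mulrCA -IH; have [on|en] := boolP (odd n).
  rewrite (gmom_odd _ on) mulr0; apply: gmom_odd.
  by rewrite /= negbK.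
exact: gmomSS.
Qed.

End gaussian_line.

(** * Gaussian integrals on the plane *)

Section gaussian_plane.
Context {R : realType}.
Notation mu := (@lebesgue_measure R).
Notation mu2 := (mu \x mu)%E.
Notation plane := (measurableTypeR R * measurableTypeR R)%type.
Implicit Types (f g s : R * R -> R) (y : R * R).

Definition sq y : R := y.1 ^+ 2 + y.2 ^+ 2.

Definition gauss (k : R) y : R := expR (- (k * sq y)).

Lemma gaussE k y : gauss k y = gexp k y.1 * gexp k y.2.
Proof. by rewrite /gauss /gexp /sq -expRD mulrDr opprD. Qed.

Lemma gauss_ge0 k y : 0 <= gauss k y. Proof. exact: expR_ge0. Qed.

Lemma gaussD k l y : gauss (k + l) y = gauss k y * gauss l y.
Proof. by rewrite /gauss -expRD mulrDl opprD. Qed.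

Lemma sq_ge0 y : 0 <= sq y. Proof. by rewrite addr_ge0 ?sqr_ge0. Qed.

(** The class of admissible error weights: it contains the polynomials, is closed under sums and
    products, and is integrable against every Gaussian when continuous. *)
Definition slow s := forall e : R, 0 < e ->
  exists2 K : R, 0 <= K & forall y, `|s y| <= K * expR (e * sq y).

Lemma slow_cst (c : R) : slow (fun=> c).
Proof.
move=> e e0; exists `|c| => // y; rewrite ler_peMr// -expR0 ler_expR.
by rewrite mulr_ge0 ?sq_ge0// ltW.
Qed.

Lemma slowD s s' : slow s -> slow s' -> slow (fun y => s y + s' y).
Proof.
move=> sl sl' e e0; have [K K0 HK] := sl e e0; have [K' K'0 HK'] := sl' e e0.
exists (K + K') => [|y]; first exact: addr_ge0.
by rewrite (le_trans (ler_normD _ _))// mulrDl lerD.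
Qed.

Lemma slowM s s' : slow s -> slow s' -> slow (fun y => s y * s' y).
Proof.
move=> sl sl' e e0; have e2 : 0 < e / 2 by rewrite divr_gt0.
have [K K0 HK] := sl _ e2; have [K' K'0 HK'] := sl' _ e2.
exists (K * K') => [|y]; first exact: mulr_ge0.
rewrite normrM [in leRHS](splitr e) mulrDl expRD mulrACA.
by apply: ler_pM.
Qed.

Lemma slowX s n : slow s -> slow (fun y => s y ^+ n).
Proof.
move=> sl; elim: n => [|n IH]; first by under eq_fun do rewrite expr0; exact: slow_cst.
by under eq_fun do rewrite exprS; exact: slowM.
Qed.

Lemma slow_norm s : slow s -> slow (fun y => `|s y|).
Proof.
by move=> sl e /sl[K K0 HK]; exists K => // y; rewrite normr_id.
Qed.

Lemma slow_fst : slow fst.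
Proof.
move=> e e0; have [K K0 HK] := expr_norm_le_expR 1 _ e0; exists K => // y.
rewrite -[leLHS]expr1 (le_trans (HK _))// ler_wpM2l// ler_expR ler_wpM2l// ?(ltW e0)//.
by rewrite lerDl sqr_ge0.
Qed.

Lemma slow_snd : slow snd.
Proof.
move=> e e0; have [K K0 HK] := expr_norm_le_expR 1 _ e0; exists K => // y.
rewrite -[leLHS]expr1 (le_trans (HK _))// ler_wpM2l// ler_expR ler_wpM2l// ?(ltW e0)//.
by rewrite lerDr sqr_ge0.
Qed.

Lemma integrable_prod (p q : R -> R) : continuous p -> continuous q ->
  mu.-integrable setT (EFin \o p) -> mu.-integrable setT (EFin \o q) ->
  mu2.-integrable setT (EFin \o (fun y : plane => p y.1 * q y.2)) /\
  \int[mu2]_y (p y.1 * q y.2) = (\int[mu]_x p x) * (\int[mu]_x q x).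
Proof.
move=> cp cq ip iq; pose f (y : plane) : R := p y.1 * q y.2.
have mf : measurable_fun setT (EFin \o f).
  apply/measurable_EFinP; apply: continuous_measurable_fun2 => y.
  apply: cvgM; first by apply: (@cvg_comp _ _ _ fst p); [exact: cvg_fst|exact: cp].
  by apply: (@cvg_comp _ _ _ snd q); [exact: cvg_snd|exact: cq].
have npi : mu.-integrable setT (EFin \o (fun x => `|p x|)) by exact: integrable_norm.
have nqi : mu.-integrable setT (EFin \o (fun x => `|q x|)) by exact: integrable_norm.
have if_ : mu2.-integrable setT (EFin \o f).
  apply/(integrable12ltyP mu mu mf).
  rewrite (_ : (\int[mu]_x _)%E = (\int[mu]_x ((\int[mu]_z `|q z|)%:E * `|p x|%:E))%E).
    rewrite integralZl// ge0_integrable_EFin//; exact: ltry.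
  apply: eq_integral => x _.
  rewrite -(ge0_integrable_EFin _ _ _ _ nqi) muleC -integralZl//.
  by apply: eq_integral => z _; rewrite /= normrM EFinM.
split => //; rewrite /Rintegral -(integral12_prod_meas1 if_).
rewrite (_ : (\int[mu]_x _)%E = (\int[mu]_x ((\int[mu]_z q z)%:E * (p x)%:E))%E).
  by rewrite integralZl// ge0_integrable_EFin// mulrC.
apply: eq_integral => x _.
rewrite -(ge0_integrable_EFin _ _ _ _ iq) muleC -integralZl//.
Qed.

Definition cauchy2 y : R := (oneDsqr y.1)^-1 * (oneDsqr y.2)^-1.

Lemma integrable_cauchy2 : mu2.-integrable setT (EFin \o (cauchy2 : plane -> R)).
Proof.
have c : continuous (fun x : R => (oneDsqr x)^-1) by exact: continuous_oneDsqrV.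
exact: (integrable_prod _ _ c c integrable_oneDsqrV integrable_oneDsqrV).1.
Qed.

Lemma integrable_dominated f (g : plane -> R) : continuous f ->
  mu2.-integrable setT (EFin \o g) -> (forall y, `|f y| <= g y) ->
  mu2.-integrable setT (EFin \o (f : plane -> R)).
Proof.
move=> cf ig fg; apply: (@le_integrable _ _ _ mu2 setT measurableT _ (EFin \o g)) => //.
  by apply/measurable_EFinP; exact: continuous_measurable_fun2.
by move=> y _ /=; rewrite lee_fin (le_trans (fg y))// ler_norm.
Qed.

Lemma gauss_le_cauchy2 (k : R) : 0 < k ->
  exists2 K : R, 0 <= K & forall y, gauss k y <= K * cauchy2 y.
Proof.
move=> k0; have [K K0 HK] := gexp_le_oneDsqrV _ k0.
exists (K * K) => [|y]; first exact: mulr_ge0.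
rewrite gaussE mulrACA; apply: ler_pM; rewrite ?gexp_ge0//.
Qed.

Lemma continuous_gauss k : continuous (gauss k).
Proof.
move=> y; apply: (@cvg_comp _ _ _ (fun y => - (k * sq y)) expR); last exact: continuous_expR.
apply: cvgN; apply: cvgM; first exact: cvg_cst.
apply: cvgD; apply: (@cvg_comp _ _ _ _ (fun x : R => x ^+ 2));
  [exact: cvg_fst|exact: exprn_continuous|exact: cvg_snd|exact: exprn_continuous].
Qed.

(** Half of the Gaussian exponent is spent on absorbing the slow factor. *)
Lemma slow_gauss_le s (k : R) : slow s -> 0 < k ->
  exists2 K : R, 0 <= K & forall y, `|s y| * gauss k y <= K * gauss (k / 2) y.
Proof.
move=> sl k0; have k2 : 0 < k / 2 by rewrite divr_gt0.
have [K K0 HK] := sl _ k2; exists K => // y.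
rewrite {1}(splitr k) gaussD mulrA ler_wpM2r ?gauss_ge0//.
by rewrite /gauss expRN ler_pdivrMr ?expR_gt0.
Qed.

Lemma integrable_gauss (k : R) : 0 < k ->
  mu2.-integrable setT (EFin \o (gauss k : plane -> R)).
Proof.
move=> k0; have [K K0 HK] := gauss_le_cauchy2 k k0.
apply: (integrable_dominated _ (fun y => K * cauchy2 y)) => [||y].
- exact: continuous_gauss.
- exact: (integrableZl measurableT K integrable_cauchy2).
- by rewrite ger0_norm ?gauss_ge0.
Qed.

Lemma integrable_slow_gauss s (k : R) : continuous s -> slow s -> 0 < k ->
  mu2.-integrable setT (EFin \o ((fun y => s y * gauss k y) : plane -> R)).
Proof.
move=> cs sl k0; have [K K0 HK] := slow_gauss_le s k sl k0.
apply: (integrable_dominated _ (fun y => K * gauss (k / 2) y)) => [y||y].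
- by apply: cvgM; [exact: cs|exact: continuous_gauss].
- apply: (integrableZl measurableT K (integrable_gauss _ _)).
  by rewrite divr_gt0.
- by rewrite normrM (ger0_norm (gauss_ge0 _ _)).
Qed.

(** As on the line, f + |f| is compared with its reflection, here the triangular substitution y ->
    -y. *)
Lemma Rintegral_odd f : continuous f ->
  mu2.-integrable setT (EFin \o (f : plane -> R)) ->
  (forall y, f (- y) = - f y) -> \int[mu2]_y f y = 0.
Proof.
move=> cf fi fN.
have ni : mu2.-integrable setT (EFin \o (fun y : plane => `|f y|)) by exact: integrable_norm.
pose g y := f y + `|f y|.
have cg : continuous g.
  by move=> y; apply: cvgD; [exact: cf|apply: cvg_norm; exact: cf].
have g0 y : 0 <= g y by rewrite /g -lerBlDl sub0r -normrN ler_norm.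
have N1 : -1 != 0 :> R by rewrite oppr_eq0 oner_eq0.
have E : \int[mu2]_y (f y + `|f y|) = \int[mu2]_y (`|f y| - f y).
  rewrite /Rintegral; congr fine; rewrite [LHS](ge0_integral_tri g 0 (-1) 0 (-1))//.
  apply: eq_integral => y _; rewrite mulrNN mulr1 normr1 mul1r add0r.
  have -> : tri (-1) 0 (-1) y = - y.
    by rewrite /tri; case: (y) => u v /=; rewrite !mulN1r mul0r addr0.
  by rewrite /g fN normrN addrC.
rewrite (RintegralD measurableT fi ni) (RintegralB measurableT ni fi) in E.
by move: E; lra.
Qed.

(** Not normalised: the total mass is 2 pi. *)
Definition gint f : R := \int[mu2]_y (f y * gauss 2^-1 y).

Lemma gint_monomial (a b : nat) :
  gint (fun y => y.1 ^+ a * y.2 ^+ b) = 2 * pi * (moment a * moment b).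
Proof.
have i2 : 0 < 2^-1 :> R by rewrite invr_gt0.
have [_ E] := integrable_prod _ _ (continuous_pow_gexp a 2^-1)
  (continuous_pow_gexp b 2^-1) (integrable_pow_gexp a _ i2) (integrable_pow_gexp b _ i2).
rewrite /gint.
under eq_Rintegral do rewrite gaussE mulrACA.
by rewrite E -!/(gmom _) !gmomE mulrACA -expr2 sqr_sqrtr// mulr_ge0// ltW// pi_gt0.
Qed.

Lemma continuous_monomial (a b : nat) : continuous (fun y : R * R => y.1 ^+ a * y.2 ^+ b).
Proof.
move=> y; apply: cvgM; apply: (@cvg_comp _ _ _ _ (fun x : R => x ^+ _));
  [exact: cvg_fst|exact: exprn_continuous|exact: cvg_snd|exact: exprn_continuous].
Qed.

Lemma slow_monomial (a b : nat) : slow (fun y : R * R => y.1 ^+ a * y.2 ^+ b).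
Proof. by apply: slowM; apply: slowX; [exact: slow_fst|exact: slow_snd]. Qed.

Lemma gintD f g : continuous f -> slow f -> continuous g -> slow g ->
  gint (fun y => f y + g y) = gint f + gint g.
Proof.
move=> cf sf cg sg; have i2 : 0 < 2^-1 :> R by rewrite invr_gt0.
rewrite /gint; under eq_Rintegral do rewrite mulrDl.
by rewrite RintegralD//; exact: integrable_slow_gauss.
Qed.

Lemma gintZ (c : R) f : continuous f -> slow f ->
  gint (fun y => c * f y) = c * gint f.
Proof.
move=> cf sf; have i2 : 0 < 2^-1 :> R by rewrite invr_gt0.
rewrite /gint; under eq_Rintegral do rewrite -mulrA.
by rewrite RintegralZl//; exact: integrable_slow_gauss.
Qed.

Lemma gint_hform (p : seq R) : gint (fun y => hform p y.1 y.2) = 2 * pi * hmoment p.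
Proof.
suff H k : [/\ continuous (fun y : R * R => y.2 ^+ k * hform p y.1 y.2),
    slow (fun y : R * R => y.2 ^+ k * hform p y.1 y.2) &
    gint (fun y => y.2 ^+ k * hform p y.1 y.2) = 2 * pi * hmoment_rec k p].
  have [_ _ <-] := H 0%N; congr gint; apply/funext => y.
  by rewrite expr0 mul1r.
elim: p k => [|a p IH] k /=.
  have -> : (fun y : R * R => y.2 ^+ k * (0 : R)) = fun=> 0.
    by apply/funext => y; rewrite mulr0.
  split; [by move=> y; exact: cvg_cst|exact: slow_cst|].
  rewrite mulr0 /gint; under eq_Rintegral do rewrite mul0r.
  by rewrite Rintegral_cst// mul0r.
have [c s E] := IH k.+1.
have fE : (fun y : R * R => y.2 ^+ k * (a * y.1 ^+ size p + y.2 * hform p y.1 y.2)) =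
   fun y => a * (y.1 ^+ size p * y.2 ^+ k) + y.2 ^+ k.+1 * hform p y.1 y.2.
  by apply/funext => y; rewrite exprS; ring.
have cm := continuous_monomial (size p) k.
have sm := slow_monomial (size p) k.
have cam : continuous (fun y : R * R => a * (y.1 ^+ size p * y.2 ^+ k)).
  by move=> y; apply: cvgM; [exact: cvg_cst|exact: cm].
have sam : slow (fun y : R * R => a * (y.1 ^+ size p * y.2 ^+ k)).
  exact: (slowM _ _ (slow_cst a) sm).
rewrite fE; split.
- by move=> y; apply: cvgD; [exact: cam|exact: c].
- exact: slowD.
- by rewrite gintD// gintZ// E gint_monomial; ring.
Qed.

End gaussian_plane.

(** * Asymptotic expansions *)

Section formal_series.
Context {R : realType}.
Notation plane := (R * R)%type.
Implicit Types (a b : nat -> plane -> R) (f g : R -> plane -> R).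

(** The Cauchy product, by recursion on dropping the leading coefficient of the first series;
    [expands_conv] follows the same recursion. *)
Fixpoint conv a b (m : nat) (y : plane) : R :=
  a 0%N y * b m y + (if m is m'.+1 then conv (fun k => a k.+1) b m' y else 0).

Fixpoint pows a (j : nat) : nat -> plane -> R :=
  if j is j'.+1 then conv a (pows a j') else fun m y => (m == 0%N)%:R.

(* The coefficients of exp (- sum_m a_m e^m), for a series without constant   *)
(* term.                                                                      *)
Definition expseries a (m : nat) (y : plane) : R :=
  \sum_(j < m.+1) (-1) ^+ j / j`!%:R * pows a j m y.

Lemma conv_eq0 a b m y : (forall i, (i <= m)%N -> b i y = 0) -> conv a b m y = 0.
Proof.
elim: m a => [|m IH] a b0 /=; first by rewrite b0// mulr0 addr0.
by rewrite b0// mulr0 add0r IH// => i im; rewrite b0// ltnW.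
Qed.

Lemma pows_eq0 a j m y : a 0%N y = 0 -> (m < j)%N -> pows a j m y = 0.
Proof.
move=> a0; elim: j m => [//|j IH] [|m] /= mj; rewrite a0 mul0r add0r//.
by apply: conv_eq0 => i im; rewrite IH// (leq_ltn_trans im).
Qed.

Lemma expseriesE a M m y : a 0%N y = 0 -> (m < M)%N ->
  \sum_(j < M) (-1) ^+ j / j`!%:R * pows a j m y = expseries a m y.
Proof.
move=> a0 mM; rewrite /expseries [RHS](big_ord_widen M (fun j => (-1) ^+ j / j`!%:R * pows a j m y))//.
rewrite [RHS]big_mkcond; apply: eq_bigr => j _; case: ifPn => // /negbTE jm.
by rewrite pows_eq0 ?mulr0// ltnNge -ltnS jm.
Qed.

Lemma conv_slow a b m : (forall k, slow (a k)) -> (forall k, slow (b k)) ->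
  slow (conv a b m).
Proof.
move=> sa sb; elim: m a sa => [|m IH] a sa /=.
  by apply: slowD; [exact: slowM|exact: slow_cst].
by apply: slowD; [exact: slowM|exact: IH].
Qed.

Lemma pows_slow a j m : (forall k, slow (a k)) -> slow (pows a j m).
Proof.
move=> sa; elim: j m => [|j IH] m /=; first exact: slow_cst.
exact: conv_slow.
Qed.

Lemma slow_sum n (F : 'I_n -> plane -> R) : (forall i, slow (F i)) ->
  slow (fun y => \sum_(i < n) F i y).
Proof.
elim: n F => [|n IH] F sF.
  by under eq_fun do rewrite big_ord0; exact: slow_cst.
by under eq_fun do rewrite big_ord_recl; apply: slowD => //; exact: IH.
Qed.

Lemma expseries_slow a m : (forall k, slow (a k)) -> slow (expseries a m).
Proof.
move=> sa; apply: slow_sum => j; apply: slowM; first exact: slow_cst.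
exact: pows_slow.
Qed.

Lemma conv_continuous a b m : (forall k, continuous (a k)) ->
  (forall k, continuous (b k)) -> continuous (conv a b m).
Proof.
move=> ca cb; elim: m a ca => [|m IH] a ca y /=.
  by apply: cvgD; [apply: cvgM; [exact: ca|exact: cb]|exact: cvg_cst].
by apply: cvgD; [apply: cvgM; [exact: ca|exact: cb]|exact: IH].
Qed.

Lemma expseries_continuous a m : (forall k, continuous (a k)) ->
  continuous (expseries a m).
Proof.
move=> ca; have cp j k : continuous (pows a j k).
  elim: j k => [|j IH] k /=; first by move=> y; exact: cvg_cst.
  exact: conv_continuous.
rewrite /expseries; elim: m.+1 => [|n IH] y.
  by under eq_fun do rewrite big_ord0; exact: cvg_cst.
under eq_fun do rewrite big_ord_recr; apply: cvgD; first exact: IH.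
by apply: cvgM; [exact: cvg_cst|exact: cp].
Qed.

Lemma conv_parity a b m y : (forall k, a k (- y) = (-1) ^+ k * a k y) ->
  (forall k, b k (- y) = (-1) ^+ k * b k y) ->
  conv a b m (- y) = (-1) ^+ m * conv a b m y.
Proof.
move=> pa pb; suff H l a' : (forall k, a' k (- y) = (-1) ^+ (k + l) * a' k y) ->
    conv a' b m (- y) = (-1) ^+ (m + l) * conv a' b m y.
  by rewrite (H 0%N) ?addn0// => k; rewrite addn0.
elim: m l a' => [|m IH] l a' pa' /=.
  by rewrite pa' pb !add0n expr0 !addr0; ring.
rewrite pa' pb (IH l.+1) => [|k]; last by rewrite pa' addSnnS.
by rewrite add0n !addnS !addSn !exprS exprD; ring.
Qed.

Lemma expseries_parity a m y : (forall k, a k (- y) = (-1) ^+ k * a k y) ->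
  expseries a m (- y) = (-1) ^+ m * expseries a m y.
Proof.
move=> pa; have pp j k : pows a j k (- y) = (-1) ^+ k * pows a j k y.
  elim: j k => [|j IH] k /=; last exact: conv_parity.
  by case: k => [|k]; rewrite ?mulr1// mulr0.
by rewrite /expseries mulr_sumr; apply: eq_bigr => j _; rewrite pp mulrCA.
Qed.

End formal_series.

(** * Calculus of expansions in e with slowly growing remainders *)

Section expansions.
Context {R : realType}.
Notation plane := (R * R)%type.
Implicit Types (a b : nat -> plane -> R) (f g : R -> plane -> R).
Variable D : R -> plane -> Prop.
Hypothesis D01 : forall e y, D e y -> 0 < e <= 1.

(** Uniform in e, and in y up to a slow weight, on the region [D] of admissible pairs; later [D] is
    the region where e^2 |y|^2 is small. *)
Definition bigO (M : nat) f := exists2 s, slow s &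
  forall e y, D e y -> `|f e y| <= e ^+ M * s y.

Definition expands (M : nat) f a :=
  bigO M (fun e y => f e y - \sum_(m < M) e ^+ m * a m y).

Lemma eq_bigO M f g : (forall e y, D e y -> f e y = g e y) -> bigO M f -> bigO M g.
Proof.
by move=> fg [s sl H]; exists s => // e y Dey; rewrite -fg//; exact: H.
Qed.

Lemma bigOD M f g : bigO M f -> bigO M g -> bigO M (fun e y => f e y + g e y).
Proof.
move=> [s sl H] [s' sl' H']; exists (fun y => s y + s' y); first exact: slowD.
move=> e y Dey; rewrite (le_trans (ler_normD _ _))// mulrDr lerD//; [exact: H|exact: H'].
Qed.

Lemma bigOM M N f g : bigO M f -> bigO N g -> bigO (M + N) (fun e y => f e y * g e y).
Proof.
move=> [s sl H] [s' sl' H']; exists (fun y => s y * s' y); first exact: slowM.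
move=> e y Dey; rewrite normrM exprD mulrACA ler_pM//; [exact: H|exact: H'].
Qed.

Lemma bigO_slow s : slow s -> bigO 0 (fun _ y => s y).
Proof.
move=> sl; exists (fun y => `|s y|); first exact: slow_norm.
by move=> e y _; rewrite expr0 mul1r.
Qed.

Lemma bigO_leq M N f : (N <= M)%N -> bigO M f -> bigO N f.
Proof.
move=> NM [s sl H]; exists (fun y => `|s y|); first exact: slow_norm.
move=> e y /[dup] /D01/andP[e0 e1] /H; move/le_trans; apply.
rewrite (le_trans (ler_norm _))// normrM normrX (gtr0_norm e0).
by rewrite ler_wpM2r// ler_wiXn2l// ltW.
Qed.

Lemma bigO_pow M : bigO M (fun e _ => e ^+ M).
Proof.
exists (fun=> 1); first exact: slow_cst.
by move=> e y /D01/andP[e0 e1]; rewrite mulr1 ger0_norm// exprn_ge0// ltW.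
Qed.

Lemma expands_weak M f a : slow (a M) -> expands M.+1 f a -> expands M f a.
Proof.
move=> sa H; have {}H := bigO_leq _ _ _ (leqnSn M) H.
have T : bigO M (fun e y => e ^+ M * a M y).
  rewrite -[X in bigO X](addn0 M).
  exact: (bigOM M 0 _ _ (bigO_pow M) (bigO_slow _ sa)).
apply: eq_bigO (bigOD _ _ _ H T) => e y _.
by rewrite big_ord_recr /=; ring.
Qed.

Lemma expands_head M f a : expands M.+1 f a ->
  expands M (fun e y => e^-1 * (f e y - a 0%N y)) (fun k => a k.+1).
Proof.
move=> [s sl H]; exists s => // e y Dey; have /andP[e0 e1] := D01 _ _ Dey.
have := H e y Dey; rewrite big_ord_recl expr0 mul1r /=.
under eq_bigr do rewrite /bump /= add1n exprS -mulrA.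
rewrite -mulr_sumr; set t := \sum_(_ < _) _.
have -> : f e y - (a 0%N y + e * t) = e * (e^-1 * (f e y - a 0%N y) - t).
  by field; rewrite gt_eqF.
by rewrite normrM (gtr0_norm e0) exprS -mulrA ler_pM2l.
Qed.

Lemma expands_tail M f (c : plane -> R) a : expands M f a ->
  expands M.+1 (fun e y => c y + e * f e y) (fun k => if k is k'.+1 then a k' else c).
Proof.
move=> [s sl H]; exists s => // e y Dey; have /andP[e0 e1] := D01 _ _ Dey.
rewrite big_ord_recl expr0 mul1r /=.
under eq_bigr do rewrite /bump /= add1n exprS -mulrA.
rewrite -mulr_sumr opprD addrACA subrr add0r -mulrBr normrM (gtr0_norm e0).
by rewrite exprS -mulrA ler_pM2l// H.
Qed.

Lemma expandsD M f g a b : expands M f a -> expands M g b ->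
  expands M (fun e y => f e y + g e y) (fun k y => a k y + b k y).
Proof.
move=> Hf Hg; apply: eq_bigO (bigOD _ _ _ Hf Hg) => e y _.
under [in RHS]eq_bigr do rewrite mulrDr.
by rewrite big_split /=; ring.
Qed.

Lemma expandsZ M (s : plane -> R) f a : slow s -> expands M f a ->
  expands M (fun e y => s y * f e y) (fun k y => s y * a k y).
Proof.
move=> sl Hf; apply: eq_bigO (bigOM _ _ _ _ (bigO_slow _ sl) Hf) => e y _.
rewrite mulrBr mulr_sumr; congr (_ - _); apply: eq_bigr => i _; ring.
Qed.

(** Write f g = a_0 g + e ((f - a_0)/e) g. The quotient expands to one order less with shifted
    coefficients, so induction treats the second summand. *)
Lemma expands_conv M f g a b : (forall k, slow (a k)) -> (forall k, slow (b k)) ->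
  expands M f a -> expands M g b ->
  expands M (fun e y => f e y * g e y) (conv a b).
Proof.
move=> sa sb; elim: M f a sa => [|M IH] f a sa Hf Hg.
  have E h c : expands 0 h c <-> bigO 0 h.
    by split; apply: eq_bigO => e y _; rewrite big_ord0 subr0.
  move/E : Hf => Hf; move/E : Hg => Hg; apply/E.
  exact: (bigOM _ _ _ _ Hf Hg).
have H1 := IH _ _ (fun k => sa k.+1) (expands_head _ _ _ Hf) (expands_weak _ _ _ (sb M) Hg).
have H2 := expandsZ _ _ _ _ (sa 0%N) Hg.
have H3 := expandsD _ _ _ _ _ H2 (expands_tail _ _ (fun=> 0) _ H1).
have -> : conv a b = fun k y => a 0%N y * b k y +
    (if k is k'.+1 then conv (fun k => a k.+1) b k' else fun=> 0) y.
  by apply/funext => -[|k]; apply/funext => y.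
apply: eq_bigO H3 => e y Dey; have /andP[e0 e1] := D01 _ _ Dey.
by congr (_ - _); field; rewrite gt_eqF.
Qed.

Lemma expands_pows M f a j : (forall k, slow (a k)) ->
  expands M f a -> expands M (fun e y => f e y ^+ j) (pows a j).
Proof.
move=> sa Hf; elim: j => [|j IH] /=.
  exists (fun=> 1); first exact: slow_cst.
  move=> e y /D01/andP[e0 e1]; rewrite expr0 mulr1; case: M Hf => [|M] _.
    by rewrite big_ord0 subr0 normr1 expr0.
  rewrite big_ord_recl /= expr0 mulr1 big1 ?addr0 ?subrr ?normr0 ?exprn_ge0 ?(ltW e0)//.
  by move=> i _; rewrite mulr0.
have := expands_conv _ _ _ _ _ sa (fun k => pows_slow a j k sa) Hf IH.
by apply: eq_bigO => e y _; rewrite exprS.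
Qed.

Lemma expands_sum M n (F : 'I_n -> R -> plane -> R) (A : 'I_n -> nat -> plane -> R) :
  (forall i, expands M (F i) (A i)) ->
  expands M (fun e y => \sum_(i < n) F i e y) (fun k y => \sum_(i < n) A i k y).
Proof.
elim: n F A => [|n IH] F A H.
  exists (fun=> 0); first exact: slow_cst.
  move=> e y _; rewrite big_ord0 mulr0 big1 ?subr0 ?normr0// => i _.
  by rewrite big_ord0 mulr0.
have := expandsD _ _ _ _ _ (H ord0) (IH _ _ (fun i => H (lift ord0 i))).
apply: eq_bigO => e y _; rewrite big_ord_recl; congr (_ - _).
by apply: eq_bigr => i _; rewrite big_ord_recl.
Qed.

Lemma expands_expsum M f a : (forall k, slow (a k)) -> (forall y, a 0%N y = 0) ->
  expands M f a ->
  expands M (fun e y => \sum_(j < M) (- f e y) ^+ j / j`!%:R) (expseries a).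
Proof.
move=> sa a0 Hf.
have H := expands_sum M M _ _ (fun j : 'I_M => expandsZ M _ _ _
  (slow_cst ((-1) ^+ j / j`!%:R)) (expands_pows M f a j sa Hf)).
apply: eq_bigO H => e y _; congr (_ - _).
  by apply: eq_bigr => j _; rewrite [in RHS]exprNn; ring.
by apply: eq_bigr => m _; rewrite expseriesE.
Qed.

End expansions.

(** * Remainder of the exponential series *)

Section exp_remainder.
Context {R : realType}.

(** [taylor_bound] for s -> exp(s z), whose M-th derivative on [0, 1] is at most |z|^M max(1, exp z)
    in absolute value. *)
Lemma expR_remainder (z : R) (M : nat) :
  `|expR z - \sum_(j < M) z ^+ j / j`!%:R| <= `|z| ^+ M * Num.max 1 (expR z).
Proof.
pose g (k : nat) (s : R) := z ^+ k * expR (s * z).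
have dg k (s : R) : is_derive s 1 (g k) (g k.+1 s).
  have d1 : is_derive s 1 (fun s : R => s * z) z.
    have -> : (fun s : R => s * z) = z \*: id by apply/funext => u; rewrite /= mulrC.
    by apply: is_derive_eq; rewrite [LHS]mulr1.
  apply: (is_derive_eq (@is_deriveZ _ _ _ _ (z ^+ k) s 1 _
    (@is_derive1_comp R expR (fun s : R => s * z) s _ _ _ d1))).
  by rewrite /g exprS /GRing.scale /=; ring.
have := taylor_bound g M (`|z| ^+ M * Num.max 1 (expR z)) dg _ 1.
rewrite ler01 lexx /g => H; have {H} := H _ isT.
rewrite expr0 !mul1r mul0r expR0 => H.
have {}H : (forall s : R, 0 <= s <= 1 ->
    `|z ^+ M * expR (s * z)| <= `|z| ^+ M * Num.max 1 (expR z)) ->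
    `|expR z - \sum_(j < M) z ^+ j / j`!%:R| <= `|z| ^+ M * Num.max 1 (expR z).
  move=> /H; congr (`|_ - _| <= _); apply: eq_bigr => j _.
  by rewrite expr1n !mulr1.
apply: H => s /andP[s0 s1]; rewrite normrM normrX ler_wpM2l ?exprn_ge0//.
rewrite ger0_norm ?expR_ge0// le_max -[X in _ <= X]expR0 !ler_expR.
have [z0|z0] := leP 0 z; last by rewrite mulr_ge0_le0// ltW.
by rewrite orbC ler_piMl.
Qed.

End exp_remainder.

(** * Homogeneous forms in the coordinates given by a triangular frame *)

Section polar_forms.
Context {R : realType}.
Implicit Types (T : seq 'I_2 -> R) (v y : R * R).

Lemma polarZ n T (e : R) v : polar n T (e *: v) = e ^+ n * polar n T v.
Proof.
rewrite /polar mulr_nsum; apply: eq_nsum => s <-; rewrite mulrCA; congr (_ * _).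
elim: s => [|i s IH]; first by rewrite !big_nil mulr1.
rewrite !big_cons IH exprS.
have -> : Defs.coord i (e *: v) = e * Defs.coord i v.
  by rewrite /Defs.coord; case: (i == ord0).
by ring.
Qed.

Lemma norm1Z (e : R) v : 0 <= e -> norm1 (e *: v) = e * norm1 v.
Proof. by move=> e0; rewrite /norm1 /= !normrM ger0_norm// mulrDr. Qed.

Section frame.
Variables (a b c : R).

Lemma triZ (e : R) y : tri (e * a) (e * b) (e * c) y = e *: tri a b c y.
Proof.
rewrite /tri; transitivity (e * (a * y.1 + b * y.2), e * (c * y.2)); last by [].
by congr (_, _); ring.
Qed.

Lemma continuous_coord_tri i : continuous (fun y => Defs.coord i (tri a b c y)).
Proof.
rewrite /Defs.coord; case: (i == ord0) => y /=.
  apply: cvgD; apply: cvgM; try exact: cvg_cst; [exact: cvg_fst|exact: cvg_snd].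
by apply: cvgM; [exact: cvg_cst|exact: cvg_snd].
Qed.

Lemma slow_coord_tri i : slow (fun y => Defs.coord i (tri a b c y)).
Proof.
rewrite /Defs.coord; case: (i == ord0) => /=.
  by apply: slowD; apply: slowM; (exact: slow_cst || exact: slow_fst || exact: slow_snd).
by apply: slowM; [exact: slow_cst|exact: slow_snd].
Qed.

Lemma continuous_nsum n (F : seq 'I_2 -> R * R -> R) :
  (forall s, continuous (F s)) -> continuous (fun y => nsum n (F ^~ y)).
Proof.
elim: n F => [|n IH] F cF /=; first exact: cF.
rewrite isum_fun => y.
by apply: cvgD; apply: (IH (fun s => F (_ :: s))) => s; exact: cF.
Qed.

Lemma slow_nsum n (F : seq 'I_2 -> R * R -> R) :
  (forall s, slow (F s)) -> slow (fun y => nsum n (F ^~ y)).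
Proof.
elim: n F => [|n IH] F sF /=; first exact: sF.
by rewrite isum_fun; apply: slowD; apply: (IH (fun s => F (_ :: s))).
Qed.

Lemma continuous_polar_tri n T : continuous (fun y => polar n T (tri a b c y)).
Proof.
apply: (continuous_nsum n (fun s y => T s * \prod_(i <- s) Defs.coord i (tri a b c y))).
move=> s; have cp : continuous (fun y => \prod_(i <- s) Defs.coord i (tri a b c y)).
    elim: s => [|i s IH].
      by under eq_fun do rewrite big_nil; move=> y; exact: cvg_cst.
    under eq_fun do rewrite big_cons.
    by move=> y; apply: cvgM; [exact: continuous_coord_tri|exact: IH].
by move=> y; apply: cvgM; [exact: cvg_cst|exact: cp].
Qed.

Lemma slow_polar_tri n T : slow (fun y => polar n T (tri a b c y)).
Proof.
apply: (slow_nsum n (fun s y => T s * \prod_(i <- s) Defs.coord i (tri a b c y))).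
move=> s; apply: slowM; first exact: slow_cst.
  elim: s => [|i s IH]; first by under eq_fun do rewrite big_nil; exact: slow_cst.
  under eq_fun do rewrite big_cons.
  by apply: slowM; [exact: slow_coord_tri|exact: IH].
Qed.

Lemma slow_norm1_tri : slow (fun y => norm1 (tri a b c y)).
Proof.
apply: slowD; apply: slow_norm.
- exact: (slow_coord_tri ord0).
- exact: (slow_coord_tri ord_max).
Qed.

Lemma norm1_tri_le : exists2 l : R, 0 < l &
  forall y, norm1 (tri a b c y) ^+ 2 <= l * sq y.
Proof.
exists (2 * (a ^+ 2 + b ^+ 2 + c ^+ 2) + 1).
  by rewrite ltr_wpDl// mulr_ge0// !addr_ge0// sqr_ge0.
move=> y; rewrite /norm1 /tri /sq /=.
set p := a * _ + _; set q := c * _.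
have H : (`|p| + `|q|) ^+ 2 <= 2 * (p ^+ 2 + q ^+ 2).
  have := sqr_ge0 (`|p| - `|q|).
  by rewrite sqrrB sqrrD !real_normK ?num_real//; lra.
apply: (le_trans H); rewrite /p /q.
move: (y.1) (y.2) => u v.
have := sqr_ge0 (a * v - b * u); have := sqr_ge0 (c * u).
have := sqr_ge0 u; have := sqr_ge0 v.
nra.
Qed.

Lemma sq_tri_ge : a != 0 -> c != 0 -> exists2 l : R, 0 < l &
  forall y, sq y <= l * sq (tri a b c y).
Proof.
move=> a0 c0; exists (2 / a ^+ 2 + 2 * b ^+ 2 / (a * c) ^+ 2 + 1 / c ^+ 2).
  rewrite ltr_wpDl//; last by rewrite divr_gt0// exprn_even_gt0.
  by apply: addr_ge0; apply: divr_ge0; rewrite ?sqr_ge0//; apply: mulr_ge0;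
    rewrite ?sqr_ge0.
move=> y; rewrite /sq /tri /=; set v2 := c * y.2; set v1 := a * y.1 + b * y.2.
have E2 : y.2 = v2 / c by rewrite /v2; field.
have E1 : y.1 = v1 / a - b * v2 / (a * c) by rewrite /v1 /v2; field; rewrite a0 c0.
have H : y.1 ^+ 2 <= 2 / a ^+ 2 * v1 ^+ 2 + 2 * b ^+ 2 / (a * c) ^+ 2 * v2 ^+ 2.
  have := sqr_ge0 (v1 / a + b * v2 / (a * c)); rewrite E1 => H.
  have -> : 2 / a ^+ 2 * v1 ^+ 2 + 2 * b ^+ 2 / (a * c) ^+ 2 * v2 ^+ 2 =
     (v1 / a - b * v2 / (a * c)) ^+ 2 + (v1 / a + b * v2 / (a * c)) ^+ 2.
    by field; rewrite a0 c0.
  by rewrite lerDl.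
have -> : y.2 ^+ 2 = 1 / c ^+ 2 * v2 ^+ 2 by rewrite E2; field.
have nn (p q r : R) : 0 <= p -> 0 <= p / q ^+ 2 * r ^+ 2.
  by move=> p0; rewrite mulr_ge0 ?sqr_ge0// divr_ge0 ?sqr_ge0.
have h1 : 0 <= 2 / a ^+ 2 * v2 ^+ 2 by exact: nn.
have h2 : 0 <= 2 * b ^+ 2 / (a * c) ^+ 2 * v1 ^+ 2.
  by apply: nn; rewrite mulr_ge0 ?sqr_ge0.
have h3 : 0 <= 1 / c ^+ 2 * v1 ^+ 2 by exact: nn.
by move: H h1 h2 h3; move: (2 / _) (2 * _ / _) (1 / _) => A B C; lra.
Qed.

End frame.
End polar_forms.

(** * Laplace's method *)

Section laplace.
Context {R : realType}.
Notation mu := (@lebesgue_measure R).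
Notation mu2 := (mu \x mu)%E.
Notation plane := (measurableTypeR R * measurableTypeR R)%type.
Variables (S : R * R -> R) (xi : R * R) (a b c : R).
Hypothesis S_smooth : smooth S.
Hypothesis a_gt0 : 0 < a.
Hypothesis c_gt0 : 0 < c.
Hypothesis S_ge0 : forall x, 0 <= S x.
Hypothesis S_xi : S xi = 0.
Let jet (s : seq 'I_2) : R := partials s S xi.
Hypothesis S_crit : forall v, polar 1 jet v = 0.
Hypothesis S_hess : forall y, polar 2 jet (tri a b c y) = sq y.
Hypothesis S_away : forall r : R, 0 < r ->
  exists2 m : R, 0 < m & forall v, r <= sq v -> m <= S (xi + v).
Hypothesis S_int : mu2.-integrable setT (EFin \o ((fun x => expR (- (S x / 2))) : plane -> R)).

Let V (y : R * R) : R * R := tri a b c y.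

Definition phase (e : R) (y : R * R) : R := S (xi + e *: V y) / e ^+ 2.

(** The coefficient of e^m in phase - |y|^2/2. Division by e^2 shifts the Taylor degree by two, and
    the value 0 at m = 0 makes this a series without constant term. *)
Definition wser (m : nat) (y : R * R) : R :=
  if m is 0%N then 0 else polar m.+2 jet (V y) / m.+2`!%:R.

(** Taylor's formula for S with terms of degree up to M + 2, divided by e^2: the terms of degree 0
    and 1 vanish and that of degree 2 is |y|^2/2 by the choice of the frame. *)
Lemma phase_taylor M : exists2 C : R, 0 <= C & forall e y, 0 < e ->
  norm1 (e *: V y) <= 1 ->
  `|phase e y - sq y / 2 - \sum_(m < M.+1) e ^+ m * wser m y| <=
    C * (e ^+ M.+1 * norm1 (V y) ^+ M.+3).
Proof.
have [C C0 HC] := taylor2 S xi M.+3 S_smooth; exists C => // e y e0 v1.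
have E : \sum_(k < M.+3) polar k jet (e *: V y) / k`!%:R =
    e ^+ 2 * (sq y / 2 + \sum_(m < M.+1) e ^+ m * wser m y).
  rewrite !big_ord_recl /= !polarZ.
  have -> : polar 0 jet (V y) = 0 by rewrite /polar /= big_nil mulr1 /jet.
  rewrite S_crit S_hess !mulr0 !mul0r !add0r [RHS]mulrDr /bump /= !add1n mulrA; congr (_ + _).
  by rewrite mulr_sumr; apply: eq_bigr => i _; rewrite polarZ !exprS; ring.
have H := HC _ v1; rewrite E norm1Z ?(ltW e0)// in H.
have e2 : 0 < e ^+ 2 by rewrite exprn_gt0.
rewrite -(ler_pM2l e2) -{1}(gtr0_norm e2) -normrM.
have -> : e ^+ 2 * (phase e y - sq y / 2 - \sum_(m < M.+1) e ^+ m * wser m y) =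
    S (xi + e *: V y) - e ^+ 2 * (sq y / 2 + \sum_(m < M.+1) e ^+ m * wser m y).
  rewrite /phase -addrA -opprD mulrBr; congr (_ - _); rewrite mulrCA divff ?mulr1//.
  by rewrite gt_eqF.
by apply: (le_trans H); rewrite exprMn !exprS le_eqVlt; apply/orP; left; apply/eqP; ring.
Qed.


Lemma wser_slow m : slow (wser m).
Proof.
case: m => [|m]; first exact: slow_cst.
by apply: slowM; [exact: slow_polar_tri|exact: slow_cst].
Qed.

Lemma wser_continuous m : continuous (wser m).
Proof.
case: m => [|m] y; first exact: cvg_cst.
by apply: cvgM; [exact: continuous_polar_tri|exact: cvg_cst].
Qed.

Lemma wser_parity m y : wser m (- y) = (-1) ^+ m * wser m y.
Proof.
case: m => [|m]; first by rewrite mulr0.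
have VN : V (- y) = -1 *: V y.
  rewrite /V /tri; case: (y) => u v /=.
  transitivity (-1 * (a * u + b * v), -1 * (c * v)); last by [].
  by congr (_, _); ring.
by rewrite /wser VN polarZ !exprS; ring.
Qed.

Let cf m := expseries wser m.

Lemma near_region : exists2 d : R, 0 < d & forall e y, 0 < e <= 1 ->
  e ^+ 2 * sq y <= d ->
  norm1 (e *: V y) <= 1 /\ `|phase e y - sq y / 2| <= sq y / 4.
Proof.
have [C C0 HC] := phase_taylor 0; have [l l0 Hl] := norm1_tri_le a b c.
(* With |e V y| at most k, the cubic remainder is at most C k l |y|^2, and this choice makes C k l
   at most 1/4. *)
pose k : R := Num.min 1 (4 * (C * l + 1))^-1.
have Cl : 0 <= C * l by rewrite mulr_ge0// ltW.
have k0 : 0 < k by rewrite /k lt_min ltr01 invr_gt0 mulr_gt0// ltr_wpDl.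
exists (k ^+ 2 / l); first by rewrite divr_gt0// exprn_gt0.
move=> e y /andP[e0 e1]; rewrite ler_pdivlMr// => H.
have nk : norm1 (e *: V y) <= k.
  rewrite -(@ler_pXn2r _ 2)// ?nnegrE ?norm1_ge0 ?(ltW k0)//.
  rewrite norm1Z ?(ltW e0)// exprMn; apply: (le_trans _ H).
  rewrite -[leRHS]mulrA; apply: ler_wpM2l; first exact: sqr_ge0.
  by rewrite mulrC; exact: Hl.
have n1 : norm1 (e *: V y) <= 1 by rewrite (le_trans nk)// /k ge_min lexx.
split => //; have := HC e y e0 n1.
rewrite big_ord1 /= mulr0 subr0 => /le_trans; apply.
have -> : C * (e ^+ 1 * norm1 (V y) ^+ 3) = C * (norm1 (e *: V y) * norm1 (V y) ^+ 2).
  by rewrite norm1Z ?(ltW e0)//; ring.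
have kC : C * k * l <= 4^-1.
  apply: (@le_trans _ _ (C * l * (4 * (C * l + 1))^-1)).
    by rewrite mulrAC ler_wpM2l// /k ge_min lexx orbT.
  rewrite ler_pdivrMr ?mulr_gt0// ?ltr_wpDl//.
  by rewrite mulrA mulVf// mul1r lerDl.
apply: (@le_trans _ _ (C * k * l * sq y)); last first.
  by rewrite mulrC ler_wpM2l// sq_ge0.
rewrite -!mulrA ler_wpM2l//; apply: ler_pM => //; rewrite ?norm1_ge0 ?sqr_ge0//.
Qed.

Definition near_dom (d e : R) (y : R * R) : Prop := 0 < e <= 1 /\ e ^+ 2 * sq y <= d.

Lemma near_dom01 d e y : near_dom d e y -> 0 < e <= 1. Proof. by case. Qed.

(** With W = phase - |y|^2/2, exp(-W) is compared with its exponential sum cut at M, and this sum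
    with the formal series. Since |W| is at most |y|^2/4, the factor exp(-W) costs only half of the
    Gaussian exponent; half of what remains absorbs the slow weights, which leaves exp(-|y|^2/8). *)
Lemma near_bound d M : 0 < d -> (forall e y, near_dom d e y ->
    norm1 (e *: V y) <= 1 /\ `|phase e y - sq y / 2| <= sq y / 4) ->
  exists2 K : R, 0 <= K & forall e y, near_dom d e y ->
  `|expR (- phase e y) - (\sum_(m < M) e ^+ m * cf m y) * gauss 2^-1 y| <=
    K * e ^+ M * gauss (4^-1 / 2) y.
Proof.
move=> d0 near; pose W (e : R) y := phase e y - sq y / 2.
have HS n : expands (near_dom d) n.+1 W wser.
  have [C C0 HC] := phase_taylor n.
  exists (fun y => C * norm1 (V y) ^+ n.+3).
    by apply: slowM; [exact: slow_cst|apply: slowX; exact: slow_norm1_tri].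
  move=> e y Dey; have [n1 _] := near _ _ Dey.
  have /andP[e0 _] := near_dom01 _ _ _ Dey.
  by rewrite mulrCA; exact: HC.
(* [HS] provides only positive orders; weakening from M + 1 covers M = 0. *)
have HM : expands (near_dom d) M W wser.
  by apply: (expands_weak _ (near_dom01 d)); [exact: wser_slow|exact: HS].
have [s ss Hs] := expands_expsum _ (near_dom01 d) _ _ _ wser_slow (fun y => erefl) HM.
(* At order one the sum is the zero term [wser 0], so this says that |W| is at most e [s1], which
   turns |W|^M into O(e^M). *)
have [s1 ss1 Hs1] := HS 0%N.
have i4 : 0 < 4^-1 :> R by rewrite invr_gt0.
have [K K0 HK] := slow_gauss_le _ _ (slowD _ _ (slowX _ M (slow_norm _ ss1)) (slow_norm _ ss)) i4.
exists K => // e y Dey; have /andP[e0 e1] := near_dom01 _ _ _ Dey.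
have [_ W4] := near _ _ Dey.
have eM : 0 <= e ^+ M by rewrite exprn_ge0// ltW.
have {}Hs1 : `|W e y| ^+ M <= e ^+ M * `|s1 y| ^+ M.
  have := Hs1 e y Dey; rewrite big_ord1 /= mulr0 subr0 expr1 => H.
  rewrite -exprMn lerXn2r ?nnegrE ?mulr_ge0 ?(ltW e0)//.
  by rewrite (le_trans H)// ler_wpM2l ?(ltW e0)// ler_norm.
set A := \sum_(m < M) _ * _.
have {}Hs : `|\sum_(j < M) (- W e y) ^+ j / j`!%:R - A| <= e ^+ M * `|s y|.
  by rewrite (le_trans (Hs e y Dey))// ler_wpM2l// ler_norm.
have HR := expR_remainder (- W e y) M; rewrite normrN in HR.
have HX : Num.max 1 (expR (- W e y)) <= expR (sq y / 4).
  rewrite ge_max -[X in X <= _]expR0 !ler_expR divr_ge0 ?sq_ge0//=.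
  by rewrite (le_trans _ W4)// -normrN ler_norm.
have gE : expR (- phase e y) = expR (- W e y) * gauss 2^-1 y.
  by rewrite /gauss -expRD /W; congr expR; rewrite [2^-1 * _]mulrC; ring.
have g4 : expR (sq y / 4) * gauss 2^-1 y = gauss 4^-1 y.
  by rewrite /gauss -expRD; congr expR; field.
have g24 : gauss 2^-1 y <= gauss 4^-1 y.
  by rewrite -g4 ler_peMl ?gauss_ge0// -expR0 ler_expR divr_ge0 ?sq_ge0.
rewrite gE -mulrBl normrM (ger0_norm (gauss_ge0 _ _)).
have T : `|expR (- W e y) - A| <=
    e ^+ M * `|s1 y| ^+ M * expR (sq y / 4) + e ^+ M * `|s y|.
  rewrite -(subrKA (\sum_(j < M) (- W e y) ^+ j / j`!%:R)) (le_trans (ler_normD _ _))// lerD//.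
  by rewrite (le_trans HR)//; apply: ler_pM => //; rewrite ?exprn_ge0// le_max ler01.
apply: le_trans (ler_wpM2r (gauss_ge0 _ _) T) _; rewrite mulrDl.
apply: (@le_trans _ _ (e ^+ M * (`|s1 y| ^+ M + `|s y|) * gauss 4^-1 y)).
  rewrite -[X in X + _]mulrA g4 mulrDr mulrDl lerD2l.
  by apply: ler_wpM2l => //; rewrite mulr_ge0.
rewrite -mulrA (mulrC K) -mulrA ler_wpM2l// (le_trans _ (HK y))//.
by rewrite ler_wpM2r ?gauss_ge0// ler_norm.
Qed.

(** Both terms are small separately. In the formal series, 1 is at most (e^2 |y|^2/d)^M, hence at
    most e^M times a polynomial in y. In the true exponential, S is at least m0 and e is at most 1,
    so S/e^2 is at least m0/(2 e^2) + S/2: the first part decays in e and the second keeps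
    integrability. *)
Lemma far_bound d M : 0 < d -> exists2 K : R, 0 <= K & exists2 m0 : R, 0 < m0 &
  forall e y, 0 < e <= 1 -> d < e ^+ 2 * sq y ->
  `|expR (- phase e y) - (\sum_(m < M) e ^+ m * cf m y) * gauss 2^-1 y| <=
    K * e ^+ M * gauss (4^-1 / 2) y +
    expR (- (m0 / (2 * e ^+ 2))) * expR (- (S (xi + e *: V y) / 2)).
Proof.
move=> d0; have [l l0 Hl] := sq_tri_ge a b c (lt0r_neq0 a_gt0) (lt0r_neq0 c_gt0).
have [m0 m00 Hm] := S_away (d / l) (divr_gt0 d0 l0).
have i4 : 0 < 4^-1 :> R by rewrite invr_gt0.
have sq_slow : slow (@sq R).
  by apply: slowD; apply: slowX; [exact: slow_fst|exact: slow_snd].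
pose s y := (\sum_(m < M) `|cf m y|) * (sq y * d^-1) ^+ M.
have ss : slow s.
  apply: slowM; last by apply: slowX; apply: slowM; [exact: sq_slow|exact: slow_cst].
  by apply: slow_sum => m; apply: slow_norm; apply: expseries_slow; exact: wser_slow.
have [K K0 HK] := slow_gauss_le _ _ ss i4.
exists K => //; exists m0 => // e y /andP[e0 e1] dy.
rewrite (le_trans (ler_normB _ _))// addrC lerD//.
  rewrite normrM (ger0_norm (gauss_ge0 _ _)).
  have g24 : gauss 2^-1 y <= gauss 4^-1 y.
    rewrite /gauss ler_expR lerN2 ler_wpM2r ?sq_ge0//.
    by rewrite lef_pV2 ?posrE// ler_nat.
  have A1 : `|\sum_(m < M) e ^+ m * cf m y| <= \sum_(m < M) `|cf m y|.
    rewrite (le_trans (ler_norm_sum _ _ _))// ler_sum// => m _.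
    rewrite normrM normrX (gtr0_norm e0) ler_piMl// exprn_ile1// ltW//.
  have A2 : 1 <= e ^+ M * (sq y * d^-1) ^+ M.
    rewrite -exprMn exprn_ege1// mulrA ler_pdivlMr// mul1r (le_trans (ltW dy))//.
    by rewrite ler_wpM2r ?sq_ge0// expr2 ler_piMl// ltW.
  have A3 : `|\sum_(m < M) e ^+ m * cf m y| <= e ^+ M * `|s y|.
    apply: (le_trans A1); rewrite ger0_norm; last first.
      rewrite mulr_ge0 ?sumr_ge0// exprn_ge0// mulr_ge0 ?sq_ge0// invr_ge0 ltW//.
    by rewrite /s mulrCA ler_peMr// sumr_ge0.
  apply: (@le_trans _ _ (e ^+ M * `|s y| * gauss 4^-1 y)).
    by apply: ler_pM => //; rewrite gauss_ge0.
  by rewrite (mulrC K) -!mulrA ler_wpM2l ?exprn_ge0 ?(ltW e0)//; exact: HK.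
rewrite ger0_norm ?expR_ge0// -expRD ler_expR -opprD lerN2 /phase.
have mS : m0 <= S (xi + e *: V y).
  apply: Hm; rewrite ler_pdivrMr// mulrC.
  have -> : e *: V y = tri a b c (e *: y).
    rewrite /V /tri; case: (y) => u v /=.
    transitivity (e * (a * u + b * v), e * (c * v)); first by [].
    by congr (_, _); rewrite /GRing.scale /=; ring.
  apply: le_trans (Hl _); rewrite (le_trans (ltW dy))// /sq /=.
  by rewrite !exprMn -mulrDr.
have e2 : 0 < e ^+ 2 by rewrite exprn_gt0.
rewrite ler_pdivlMr// mulrDl.
have -> : m0 / (2 * e ^+ 2) * e ^+ 2 = m0 / 2 by field; rewrite gt_eqF.
have : S (xi + e *: V y) / 2 * e ^+ 2 <= S (xi + e *: V y) / 2.
  by rewrite ler_piMr ?divr_ge0// exprn_ile1// ltW.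
by move: mS; move: (S _) (_ * e ^+ 2) => p q; lra.
Qed.

Lemma continuous_dilation (f : R * R -> R) (e : R) : continuous f ->
  continuous (fun y => f (xi + e *: V y)).
Proof.
move=> cf0; have -> : (fun y => f (xi + e *: V y)) = fun y =>
    f ((e * a) * y.1 + (e * b) * y.2 + xi.1, 0 * y.1 + (e * c) * y.2 + xi.2).
  apply/funext => y; congr f; rewrite /V -triZ /tri; case: (xi) => x1 x2.
  transitivity (x1 + (e * a * y.1 + e * b * y.2), x2 + e * c * y.2); first by [].
  by congr (_, _); rewrite /=; ring.
exact: (continuous_plane_comp _ (fun y : R * R => (e * a) * y.1 + (e * b) * y.2 + xi.1)
  (fun y : R * R => 0 * y.1 + (e * c) * y.2 + xi.2) cf0 (continuous_affine1 _ _ _)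
  (continuous_affine1 _ _ _)).
Qed.

(** Used for exp(-S/e^2), which rescales the trace, and for exp(-S/2), which bounds the far region.
    Integrability of the dilated function follows from the change of variables, whose Jacobian is
    positive. *)
Lemma integral_dilation (f : R * R -> R) (e : R) : continuous f -> (forall x, 0 <= f x) -> 0 < e ->
  mu2.-integrable setT (EFin \o (f : plane -> R)) ->
  mu2.-integrable setT (EFin \o ((fun y => f (xi + e *: V y)) : plane -> R)) /\
  \int[mu2]_x f x = e ^+ 2 * (a * c) * \int[mu2]_y f (xi + e *: V y).
Proof.
move=> cf0 f0 e0 fi; have k0 : 0 < e ^+ 2 * (a * c) by rewrite !mulr_gt0 ?exprn_gt0.
have cg := continuous_dilation _ e cf0.
have E := ge0_integral_tri f xi (e * a) (e * b) (e * c) cf0 f0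
  (lt0r_neq0 (mulr_gt0 e0 a_gt0)) (lt0r_neq0 (mulr_gt0 e0 c_gt0)).
have kE : `|e * a * (e * c)| = e ^+ 2 * (a * c).
  by rewrite (_ : e * a * (e * c) = e ^+ 2 * (a * c)) ?gtr0_norm//; ring.
have mg : measurable_fun setT (EFin \o ((fun y => f (xi + e *: V y)) : plane -> R)).
  by apply/measurable_EFinP; exact: continuous_measurable_fun2.
have {}E : (\int[mu2]_x (f x)%:E =
    (e ^+ 2 * (a * c))%:E * \int[mu2]_y (f (xi + e *: V y))%:E)%E.
  rewrite E -ge0_integralZl//; last 2 first.
  - by move=> y _; rewrite lee_fin.
  - by rewrite lee_fin ltW.
  by apply: eq_integral => y _; rewrite kE triZ EFinM.
have gi : mu2.-integrable setT (EFin \o ((fun y => f (xi + e *: V y)) : plane -> R)).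
  apply/integrableP; split => //.
  rewrite (_ : (\int[mu2]_x _)%E = (\int[mu2]_y (f (xi + e *: V y))%:E)%E); last first.
    by apply: eq_integral => y _ /=; rewrite ger0_norm.
  have : (\int[mu2]_x (f x)%:E < +oo)%E by rewrite ge0_integrable_EFin// ltry.
  rewrite E; set I := (\int[_]_y _)%E; case: I => [r _|H|_]; [exact: ltry| |by rewrite ltNye].
  by move: H; rewrite gt0_muley ?lte_fin.
split => //; apply: EFin_inj; rewrite EFinM -!ge0_integrable_EFin//.
Qed.

Lemma continuous_S : continuous S. Proof. exact: (smoothP _ S_smooth).1. Qed.

Lemma continuous_expRN (k : R) : continuous (fun x => expR (- (S x / k))).
Proof.
move=> x; apply: (@cvg_comp _ _ _ (fun x => - (S x / k)) expR); last exact: continuous_expR.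
by apply: cvgN; apply: cvgM; [exact: continuous_S|exact: cvg_cst].
Qed.

Lemma integrable_expRN (k : R) : 0 < k <= 2 ->
  mu2.-integrable setT (EFin \o ((fun x => expR (- (S x / k))) : plane -> R)).
Proof.
move=> /andP[k0 k2]; apply: (integrable_dominated _ _ (continuous_expRN k) S_int) => x.
rewrite ger0_norm ?expR_ge0// ler_expR lerN2 ler_wpM2l//.
by rewrite lef_pV2 ?posrE.
Qed.

Definition lint (e : R) : R := \int[mu2]_y expR (- phase e y).

Lemma integrable_phase e : 0 < e <= 1 ->
  mu2.-integrable setT (EFin \o ((fun y => expR (- phase e y)) : plane -> R)) /\
  \int[mu2]_x expR (- (S x / e ^+ 2)) = e ^+ 2 * (a * c) * lint e.
Proof.
move=> /andP[e0 e1]; have e2 : 0 < e ^+ 2 <= 2.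
  by rewrite exprn_gt0//= (@le_trans _ _ 1)// ?ler1n// exprn_ile1// ltW.
exact: (integral_dilation (fun x => expR (- (S x / e ^+ 2))) e
  (continuous_expRN _) (fun x => expR_ge0 _) e0 (integrable_expRN _ e2)).
Qed.

(** The extra e^2 compensates the Jacobian 1/e^2 of the integral of exp(-S(xi + e V y)/2) in
    [lint_expansion]. *)
Lemma expRN_le_pow (m : R) M : 0 < m -> exists2 K : R, 0 <= K &
  forall e : R, 0 < e <= 1 -> expR (- (m / (2 * e ^+ 2))) <= K * e ^+ M * e ^+ 2.
Proof.
move=> m0; exists (M.+1`!%:R * (2 / m) ^+ M.+1).
  by rewrite mulr_ge0// exprn_ge0// divr_ge0// ltW.
move=> e /andP[e0 e1]; set z := m / (2 * e ^+ 2).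
have z0 : 0 < z by rewrite divr_gt0// mulr_gt0// exprn_gt0.
have := expr_le_expR M.+1 _ (ltW z0); rewrite expRN.
have zn : 0 < z ^+ M.+1 by rewrite exprn_gt0.
have E0 := expR_gt0 z; rewrite -ler_pdivrMr// => H.
apply: (@le_trans _ _ (M.+1`!%:R / z ^+ M.+1)).
  by rewrite ler_pdivlMr// mulrC.
rewrite -!mulrA ler_wpM2l//.
have -> : (z ^+ M.+1)^-1 = (2 / m) ^+ M.+1 * (e ^+ M.+1 * e ^+ M.+1).
  by rewrite -exprVn -!exprMn; congr (_ ^+ _); rewrite /z; field; rewrite !gt_eqF.
rewrite ler_wpM2l ?exprn_ge0 ?divr_ge0 ?(ltW m0)//.
rewrite exprS expr2 [leLHS](_ : _ = e ^+ M * (e * e) * e ^+ M); last by ring.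
rewrite ler_piMr ?mulr_ge0 ?exprn_ge0 ?(ltW e0)//.
by rewrite exprn_ile1// ltW.
Qed.

Lemma cf_slow m : slow (cf m). Proof. exact: (expseries_slow _ _ wser_slow). Qed.

Lemma cf_continuous m : continuous (cf m).
Proof. exact: (expseries_continuous _ _ wser_continuous). Qed.

Lemma gint_sum (e : R) M :
  [/\ continuous (fun y => \sum_(m < M) e ^+ m * cf m y),
      slow (fun y => \sum_(m < M) e ^+ m * cf m y) &
      gint (fun y => \sum_(m < M) e ^+ m * cf m y) =
        \sum_(m < M) e ^+ m * gint (cf m)].
Proof.
elim: M => [|M [cM sM EM]].
  have -> : (fun y => \sum_(m < 0) e ^+ m * cf m y) = fun=> 0.
    by apply/funext => y; rewrite big_ord0.
  split; [by move=> y; exact: cvg_cst|exact: slow_cst|].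
  rewrite big_ord0 /gint; under eq_Rintegral do rewrite mul0r.
  by rewrite Rintegral_cst// mul0r.
have -> : (fun y => \sum_(m < M.+1) e ^+ m * cf m y) =
    fun y => (\sum_(m < M) e ^+ m * cf m y) + e ^+ M * cf M y.
  by apply/funext => y; rewrite big_ord_recr.
have c1 : continuous (fun y => e ^+ M * cf M y).
  by move=> y; apply: cvgM; [exact: cvg_cst|exact: cf_continuous].
have s1 : slow (fun y => e ^+ M * cf M y).
  by apply: slowM; [exact: slow_cst|exact: cf_slow].
split; [by move=> y; apply: cvgD; [exact: cM|exact: c1]|exact: slowD|].
rewrite gintD// EM big_ord_recr /= gintZ//; [exact: cf_continuous|exact: cf_slow].
Qed.

(** The near and far estimates add up to one integrable majorant on the whole plane: a fixed
    Gaussian times e^M, plus exp(-m0/(2 e^2)) times the dilated exp(-S/2). *)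
Lemma lint_expansion M : exists2 K : R, 0 <= K & forall e, 0 < e <= 1 ->
  `|lint e - \sum_(m < M) e ^+ m * gint (cf m)| <= K * e ^+ M.
Proof.
have [d d0 near] := near_region.
have near' e y : near_dom d e y -> norm1 (e *: V y) <= 1 /\ `|phase e y - sq y / 2| <= sq y / 4.
  by case; exact: near.
have [K1 K10 H1] := near_bound d M d0 near'.
have [K2 K20 [m0 m00 H2]] := far_bound d M d0.
have [K3 K30 H3] := expRN_le_pow _ M m00.
have i8 : 0 < 4^-1 / 2 :> R by rewrite divr_gt0// invr_gt0.
have gi := integrable_gauss _ i8.
pose I0 := \int[mu2]_x expR (- (S x / 2)).
pose G := \int[mu2]_y gauss (4^-1 / 2) y.
have G0 : 0 <= G by apply: Rintegral_ge0 => y _; exact: gauss_ge0.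
have I00 : 0 <= I0 by apply: Rintegral_ge0 => y _; exact: expR_ge0.
exists ((K1 + K2) * G + K3 * (I0 / (a * c))).
  by rewrite addr_ge0// !mulr_ge0 ?addr_ge0 ?divr_ge0 ?invr_ge0 ?mulr_ge0 ?(ltW a_gt0) ?(ltW c_gt0).
move=> e e01; have /andP[e0 e1] := e01.
have [pi_ _] := integrable_phase _ e01.
have [cF sF EF] := gint_sum e M.
have i2 : 0 < 2^-1 :> R by rewrite invr_gt0.
have Fi := integrable_slow_gauss _ _ cF sF i2.
have [hi hE] := integral_dilation (fun x => expR (- (S x / 2))) e
  (continuous_expRN 2) (fun x => expR_ge0 _) e0 S_int.
rewrite -EF /lint /gint -(RintegralB measurableT pi_ Fi).
have bi := integrableZl measurableT ((K1 + K2) * e ^+ M) gi.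
have bi' := integrableZl measurableT (expR (- (m0 / (2 * e ^+ 2)))) hi.
have di := integrableB measurableT pi_ Fi.
apply: (le_trans (le_normr_Rintegral measurableT di)).
have eM : 0 <= e ^+ M by rewrite exprn_ge0// ltW.
apply: (@le_trans _ _ (\int[mu2]_y ((K1 + K2) * e ^+ M * gauss (4^-1 / 2) y +
    expR (- (m0 / (2 * e ^+ 2))) * expR (- (S (xi + e *: V y) / 2))))).
  apply: le_Rintegral => //.
  - exact: (integrable_norm di).
  - exact: (integrableD measurableT bi bi').
  - move=> y _; have [yd|yd] := leP (e ^+ 2 * sq y) d.
      rewrite (le_trans (H1 _ _ (conj e01 yd)))// ler_wpDr ?mulr_ge0 ?expR_ge0//.
      by rewrite ler_wpM2r ?gauss_ge0// ler_wpM2r// lerDl.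
    rewrite (le_trans (H2 _ _ e01 yd))// lerD2r.
    by rewrite ler_wpM2r ?gauss_ge0// ler_wpM2r// lerDr.
rewrite (RintegralD measurableT bi bi').
rewrite (RintegralZl _ measurableT gi) (RintegralZl _ measurableT hi) -/G.
rewrite [leRHS]mulrDl; apply: lerD; first by rewrite mulrAC.
have ac0 : 0 < a * c by rewrite mulr_gt0.
rewrite (_ : \int[mu2]_y expR (- (S (xi + e *: V y) / 2)) = I0 / (a * c) / e ^+ 2);
    last by rewrite /I0 hE; field; rewrite !gt_eqF.
have T : 0 <= I0 / (a * c) / e ^+ 2.
  by rewrite !divr_ge0 ?sqr_ge0// ltW.
apply: le_trans (ler_wpM2r T (H3 _ e01)) _.
rewrite le_eqVlt; apply/orP; left; apply/eqP; field; rewrite !gt_eqF//.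
Qed.

Lemma gint_cf_odd m : odd m -> gint (cf m) = 0.
Proof.
move=> om; have i2 : 0 < 2^-1 :> R by rewrite invr_gt0.
apply: Rintegral_odd.
- by move=> y; apply: cvgM; [exact: cf_continuous|exact: continuous_gauss].
- exact: (integrable_slow_gauss _ _ (cf_continuous m) (cf_slow m) i2).
- move=> y; have -> : gauss 2^-1 (- y) = gauss 2^-1 y by rewrite /gauss /sq /= !sqrrN.
  by rewrite /cf (expseries_parity _ _ _ (fun k => wser_parity k y)) -signr_odd om expr1 mulN1r mulNr.
Qed.

End laplace.

(** * The coefficients *)

Section coefficients.
Context {R : realType}.
Implicit Types (T : seq 'I_2 -> R) (L : 'M[R]_2) (y v : R * R).

Lemma polarS n T v :
  polar n.+1 T v = isum (fun i => Defs.coord i v * polar n (fun s => T (i :: s)) v).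
Proof.
rewrite /polar /=; apply: eq_isum => i; rewrite mulr_nsum; apply: eq_nsum => s _.
by rewrite big_cons mulrCA.
Qed.

Lemma polar_isum n (k : 'I_2 -> R) (T : 'I_2 -> seq 'I_2 -> R) v :
  polar n (fun s => isum (fun i => k i * T i s)) v =
  isum (fun i => k i * polar n (T i) v).
Proof.
rewrite /polar; under [RHS]eq_isum do rewrite mulr_nsum.
rewrite -nsum_isum; apply: eq_nsum => s _; rewrite mulrC mulr_isum.
by apply: eq_isum => i; ring.
Qed.

(** T(L y, .., L y) is the pullback of T evaluated at y; this moves the frame from the vectors into
    the tensor. *)
Lemma polar_pull n L T v y :
  (forall i, Defs.coord i v = isum (fun a => L i a * Defs.coord a y)) ->
  polar n T v = polar n (pull L T) y.
Proof.
move=> vE; elim: n T => [|n IH] T; first by rewrite /polar /= !big_nil.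
rewrite !polarS [RHS](_ : _ = isum (fun a => isum (fun i =>
    Defs.coord a y * (L i a * polar n (pull L (fun s => T (i :: s))) y)))).
  rewrite exchange_isum; apply: eq_isum => i; rewrite vE IH mulrC mulr_isum.
  by apply: eq_isum => a; ring.
by apply: eq_isum => a; rewrite /= polar_isum mulr_isum.
Qed.

(** Checked degree by degree; the second coefficient involves derivatives of order at most six. *)
Lemma polar_symtensor (c : nat -> nat -> R) n y : (n <= 6)%N ->
  polar n (symtensor c) y / n`!%:R = hform (taylor_form c n) y.1 y.2.
Proof.
rewrite /polar /symtensor /taylor_form.
do 7 (case: n => [_|n];
  first by rewrite /= ?isum_fun ?big_cons ?big_nil /Defs.coord /= ?factS ?fact0;
     (field || rewrite divr1 mulr1)).
by [].
Qed.

Lemma expseries0 (a : nat -> R * R -> R) y : expseries a 0 y = 1.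
Proof. by rewrite /expseries big_ord1 /= expr0 mulr1 invr1 mulr1. Qed.

Lemma expseries2 (a : nat -> R * R -> R) y : a 0%N y = 0 ->
  expseries a 2 y = 2^-1 * (a 1%N y * a 1%N y) + -1 * a 2%N y.
Proof.
move=> a0; rewrite /expseries !big_ord_recr big_ord0 /= a0 !factS fact0.
by field.
Qed.

Lemma expseries4 (a : nat -> R * R -> R) y : a 0%N y = 0 ->
  expseries a 4 y = 24^-1 * (a 1%N y * a 1%N y * (a 1%N y * a 1%N y))
    + ((- 2^-1) * (a 1%N y * a 1%N y * a 2%N y)
    + (2^-1 * (a 2%N y * a 2%N y)
    + (a 1%N y * a 3%N y + -1 * a 4%N y))).
Proof.
move=> a0; rewrite /expseries !big_ord_recr big_ord0 /= a0 !factS fact0.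
by field.
Qed.

Lemma continuous_slow_hform (p : seq R) :
  continuous (fun y : R * R => hform p y.1 y.2) /\
  slow (fun y : R * R => hform p y.1 y.2).
Proof.
elim: p => [|a p [c s]] /=.
  by split; [move=> y; exact: cvg_cst|exact: slow_cst].
have cX (h : R * R -> R) n : continuous h -> continuous (fun y => h y ^+ n).
  move=> ch y; apply: (@cvg_comp _ _ _ h (fun x : R => x ^+ n)); first exact: ch.
  exact: exprn_continuous.
split.
  move=> y; apply: cvgD; apply: cvgM; [exact: cvg_cst| |exact: cvg_snd|exact: c].
  by apply: (cX fst) => z; exact: cvg_fst.
apply: slowD; apply: slowM; [exact: slow_cst| |exact: slow_snd|exact: s].
by apply: slowX; exact: slow_fst.
Qed.

Lemma gint_hforms (ts : seq (R * seq R)) :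
  let f y := \sum_(t <- ts) t.1 * hform t.2 y.1 y.2 in
  [/\ continuous f, slow f &
      gint f = 2 * pi * \sum_(t <- ts) t.1 * hmoment t.2].
Proof.
elim: ts => [|[k p] ts [c s E]] /=.
  have -> : (fun y : R * R => \sum_(t <- [::] : seq (R * seq R)) t.1 * hform t.2 y.1 y.2) = fun=> 0.
    by apply/funext => y; rewrite big_nil.
  split; [by move=> y; exact: cvg_cst|exact: slow_cst|].
  rewrite big_nil mulr0 /gint; under eq_Rintegral do rewrite mul0r.
  by rewrite Rintegral_cst// mul0r.
have [cp sp] := continuous_slow_hform p.
have -> : (fun y : R * R => \sum_(t <- (k, p) :: ts) t.1 * hform t.2 y.1 y.2) =
    fun y => k * hform p y.1 y.2 + \sum_(t <- ts) t.1 * hform t.2 y.1 y.2.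
  by apply/funext => y; rewrite big_cons.
have ck : continuous (fun y : R * R => k * hform p y.1 y.2).
  by move=> y; apply: cvgM; [exact: cvg_cst|exact: cp].
have sk : slow (fun y : R * R => k * hform p y.1 y.2).
  by apply: slowM; [exact: slow_cst|exact: sp].
split; [by move=> y; apply: cvgD; [exact: ck|exact: c]|exact: slowD|].
by rewrite gintD// gintZ// gint_hform E big_cons /=; ring.
Qed.

Section values.
Variables (w : nat -> R * R -> R) (c : nat -> nat -> R).
Hypothesis w0 : forall y, w 0%N y = 0.
Hypothesis wE : forall m y, (0 < m <= 4)%N ->
  w m y = hform (taylor_form c m.+2) y.1 y.2.

Lemma gint_expseries0 : gint (expseries w 0) = 2 * pi.
Proof.
rewrite (_ : expseries w 0 = fun y => y.1 ^+ 0 * y.2 ^+ 0).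
  by rewrite gint_monomial !mulr1.
by apply/funext => y; rewrite expseries0 mulr1.
Qed.

Lemma gint_expseries2 :
  2 * gint (expseries w 2) = 2 * pi * wick1 (symtensor c) termsA1.
Proof.
pose t n := taylor_form c n.+2.
have [_ _ E] := gint_hforms [:: (2^-1, hmul (t 1%N) (t 1%N)); (-1, t 2%N)].
rewrite (_ : expseries w 2 = fun y => \sum_(t <- [:: (2^-1, hmul (t 1%N) (t 1%N)); (-1, t 2%N)])
    t.1 * hform t.2 y.1 y.2).
  rewrite E !big_cons big_nil -hmoment_A1 /=; move: (hmoment _) (hmoment _) => p q.
  by field.
by apply/funext => y; rewrite expseries2// !wE// !big_cons big_nil addr0 !hform_mul.
Qed.

Lemma gint_expseries4 :
  4 * gint (expseries w 4) = 2 * pi * wick1 (symtensor c) termsA2.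
Proof.
pose t n := taylor_form c n.+2; pose t11 := hmul (t 1%N) (t 1%N).
pose ts : seq (R * seq R) := [:: (24^-1, hmul t11 t11); (- 2^-1, hmul t11 (t 2%N));
  (2^-1, hmul (t 2%N) (t 2%N)); (1, hmul (t 1%N) (t 3%N)); (-1, t 4%N)].
have [_ _ E] := gint_hforms ts.
rewrite (_ : expseries w 4 = fun y => \sum_(t <- ts) t.1 * hform t.2 y.1 y.2).
  have A2 : 4 * (hmoment (hmul t11 t11) / 24 - hmoment (hmul t11 (t 2%N)) / 2
      + hmoment (hmul (t 2%N) (t 2%N)) / 2 + hmoment (hmul (t 1%N) (t 3%N))
      - hmoment (t 4%N)) = wick1 (symtensor c) termsA2 := hmoment_A2 c.
  have {}E : gint (fun y => \sum_(t <- ts) t.1 * hform t.2 y.1 y.2) = 2 * pi *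
      (24^-1 * hmoment (hmul t11 t11) + ((- 2^-1) * hmoment (hmul t11 (t 2%N))
      + (2^-1 * hmoment (hmul (t 2%N) (t 2%N)) + (1 * hmoment (hmul (t 1%N) (t 3%N))
      + -1 * hmoment (t 4%N))))).
    by rewrite E /ts !big_cons big_nil addr0.
  rewrite E -A2; move: (hmoment (hmul t11 t11)) (hmoment (hmul t11 _))
    (hmoment (hmul (t 2%N) _)) (hmoment (hmul (t 1%N) _)) (hmoment (t 4%N)) => p q r s u.
  by field.
apply/funext => y; rewrite expseries4// !wE// -!/(t _) /ts !big_cons big_nil addr0.
have sz : (0 < size t11)%N by [].
have m11 := hform_mul (t 1%N) (t 1%N) y.1 y.2 isT; rewrite -/t11 in m11.
have m1111 := hform_mul t11 t11 y.1 y.2 sz; rewrite m11 in m1111.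
have m112 := hform_mul t11 (t 2%N) y.1 y.2 isT; rewrite m11 in m112.
have m22 := hform_mul (t 2%N) (t 2%N) y.1 y.2 isT.
have m13 := hform_mul (t 1%N) (t 3%N) y.1 y.2 isT.
rewrite -m1111 -m112 -m22 -m13; congr (_ + (_ + (_ + (_ + _)))).
exact: (esym (mul1r _)).
Qed.

End values.
End coefficients.

(** * The heat trace *)

Section growth.
Context {R : realType}.
Notation mu := (@lebesgue_measure R).
Notation mu2 := (mu \x mu)%E.
Notation plane := (measurableTypeR R * measurableTypeR R)%type.
Variable S : R * R -> R.
Hypothesis cS : continuous S.
Hypothesis S_ge0 : forall x, 0 <= S x.
Variables (p r C : R).
Hypothesis p0 : 0 < p.
Hypothesis r0 : 0 < r.
Hypothesis C0 : 0 < C.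
Hypothesis S_growth : forall x : R * R, r ^+ 2 / 2 < sq x / 2 ->
  C * (sq x / 2) `^ p <= S x.

(** Outside the square of half-side [rho] one has |x| > r + 2, which ensures both that the growth
    bound applies and that |x|^2/2 is at least 1. *)
Let rho : R := r + 2.

Let rho_lt (x : R * R) : ~~ ((`|x.1| <= rho) && (`|x.2| <= rho)) ->
  r ^+ 2 / 2 < sq x / 2 /\ 1 <= sq x / 2.
Proof.
rewrite negb_and -!ltNge => H.
have : rho ^+ 2 < sq x.
  have sqn (u : R) : rho < `|u| -> rho ^+ 2 < u ^+ 2.
    move=> ru; rewrite -(real_normK (num_real u)) ltr_pXn2r// ?nnegrE//.
    by rewrite addr_ge0// ltW.
  case/orP: H => /sqn H; rewrite /sq.
  - by rewrite (lt_le_trans H)// lerDl sqr_ge0.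
  - by rewrite (lt_le_trans H)// lerDr sqr_ge0.
by rewrite /rho sqrrD; have := r0; split; nra.
Qed.

(** Outside the square, S is at least C because its base |x|^2/2 is at least 1 and p > 0. Inside,
    the points away from xi form a compact set, on which the continuous S has a positive minimum
    unless the set is empty. *)
Lemma away_bound (xi : R * R) : (forall x, x != xi -> 0 < S x) ->
  forall d : R, 0 < d -> exists2 m : R, 0 < m & forall v, d <= sq v -> m <= S (xi + v).
Proof.
move=> S0 d d0; have rho0 : 0 <= rho by rewrite addr_ge0// ltW.
pose B : set (R * R) := `[- rho, rho]%classic `*` `[- rho, rho]%classic.
pose A := B `&` [set x | d <= sq (x - xi)].
have cA : compact A.
  apply: compact_closedI; first by apply: compact_setX; exact: segment_compact.
  have csq : continuous (fun x : R * R => sq (x - xi)).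
    have -> : (fun x : R * R => sq (x - xi)) = fun x => (x.1 - xi.1) ^+ 2 + (x.2 - xi.2) ^+ 2.
      by apply/funext => x; case: (x) (xi) => ? ? [].
    move=> x; apply: cvgD.
    - apply: (@cvg_comp _ _ _ (fun x : R * R => x.1 - xi.1) (fun z : R => z ^+ 2));
        last exact: exprn_continuous.
      by apply: cvgB; [exact: cvg_fst|exact: cvg_cst].
    - apply: (@cvg_comp _ _ _ (fun x : R * R => x.2 - xi.2) (fun z : R => z ^+ 2));
        last exact: exprn_continuous.
      by apply: cvgB; [exact: cvg_snd|exact: cvg_cst].
  exact: (closed_comp (fun x _ => csq x) (@closed_ge R d)).
have out x : ~ B x -> C <= S x.
  move=> nB; have [|h1 h2] := rho_lt x.
    by apply/negP => /andP[x1 x2]; apply: nB; split; rewrite /= in_itv/= -ler_norml.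
  apply: le_trans (S_growth _ h1); rewrite ler_peMr ?(ltW C0)//.
  by rewrite -[X in X <= _](powRr0 (sq x / 2)) ler_powR// ltW.
have split_ v : d <= sq v -> A (xi + v) \/ ~ B (xi + v).
  move=> dv; have [b|b] := pselect (B (xi + v)); [left|by right].
  by split => //=; rewrite addrC addKr.
have [A0|A0] := pselect (A !=set0).
  have [x0 x0A Hx0] := compact_EVT_min A0 cA (continuous_subspaceT cS).
  have Sx0 : 0 < S x0.
    apply: S0; apply/eqP => xE; move/set_mem: x0A => [_ /=].
    by rewrite xE subrr /sq /= expr0n /= addr0 leNgt d0.
  exists (Num.min C (S x0)); first by rewrite lt_min C0.
  move=> v /split_[/mem_set/Hx0|/out]; rewrite ge_min => ->//.
  by rewrite orbT.
exists C => // v /split_[Av|/out//]; by case: A0; exists (xi + v).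
Qed.

(** With s = |x|^2/2 and p n at least 2, the inequality z^n <= n! exp z at z = S/2 gives exp(-S/2) =
    O(s^-2) outside the square, while (1 + x_1^2)(1 + x_2^2) is at most 9 s^2 because s is at least
    1. Hence exp(-S/2) is dominated by a multiple of [cauchy2]. *)
Lemma integrable_growth :
  mu2.-integrable setT (EFin \o ((fun x => expR (- (S x / 2))) : plane -> R)).
Proof.
have [n np] : exists n : nat, 2 <= p * n%:R.
  exists (Num.trunc (2 / p)).+1; rewrite mulrC -ler_pdivrMr//.
  by rewrite ltW// truncnS_gt.
pose K1 : R := (1 + rho ^+ 2) ^+ 2.
pose K2 : R := 9 * (n`!%:R / (C / 2) ^+ n).
have cf : continuous (fun x => expR (- (S x / 2))).
  move=> x; apply: (@cvg_comp _ _ _ (fun x => - (S x / 2)) expR); last exact: continuous_expR.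
  by apply: cvgN; apply: cvgM; [exact: cS|exact: cvg_cst].
have C2 : 0 < (C / 2) ^+ n by rewrite exprn_gt0// divr_gt0.
have K10 : 0 <= K1 by rewrite sqr_ge0.
have K20 : 0 <= K2 by rewrite mulr_ge0// divr_ge0// ltW.
apply: (integrable_dominated _ _ cf (integrableZl measurableT (K1 + K2) integrable_cauchy2)) => x.
rewrite ger0_norm ?expR_ge0//= /cauchy2 -invfM.
have D0 : 0 < oneDsqr x.1 * oneDsqr x.2 by rewrite mulr_gt0.
rewrite ler_pdivlMr//.
have E1 : expR (- (S x / 2)) <= 1 by rewrite -expR0 ler_expR oppr_le0 divr_ge0.
have [/andP[x1 x2]|out] := boolP ((`|x.1| <= rho) && (`|x.2| <= rho)).
  have b (u : R) : `|u| <= rho -> oneDsqr u <= 1 + rho ^+ 2.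
    move=> ur; rewrite /oneDsqr lerD2l -(real_normK (num_real u)).
    by rewrite lerXn2r ?nnegrE// addr_ge0// ltW.
  rewrite (@le_trans _ _ K1)// ?lerDl//.
  apply: (@le_trans _ _ (oneDsqr x.1 * oneDsqr x.2)).
    by rewrite ler_piMl// ltW.
  by rewrite /K1 expr2; apply: ler_pM => //; exact: b.
rewrite (@le_trans _ _ K2)// ?lerDr//.
have [h1 h2] := rho_lt x out; have := S_growth _ h1.
set s := sq x / 2 in h1 h2 *; move=> HS.
have s0 : 0 <= s by rewrite (le_trans _ h2).
have D9 : oneDsqr x.1 * oneDsqr x.2 <= 9 * s ^+ 2.
  have u0 : 0 <= x.1 ^+ 2 by exact: sqr_ge0.
  have v0 : 0 <= x.2 ^+ 2 by exact: sqr_ge0.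
  have sE : x.1 ^+ 2 + x.2 ^+ 2 = 2 * s by rewrite /s /sq; field.
  have aux (u v z : R) : 0 <= u -> 0 <= v -> u + v = 2 * z -> 1 <= z ->
      (1 + u) * (1 + v) <= 9 * z ^+ 2.
    move=> u1 v1 uv z1; have -> : 9 * z ^+ 2 = (3 * z) * (3 * z) by ring.
    by apply: ler_pM; lra.
  exact: (aux _ _ _ u0 v0 sE h2).
pose z := S x / 2.
have zC : C / 2 * s `^ p <= z by rewrite /z mulrAC ler_pM2r ?invr_gt0.
have sp0 : 0 <= s `^ p by exact: powR_ge0.
have zn : (C / 2) ^+ n * s ^+ 2 <= z ^+ n.
  apply: (@le_trans _ _ ((C / 2 * s `^ p) ^+ n)); last first.
    rewrite lerXn2r ?nnegrE// ?mulr_ge0 ?divr_ge0 ?(ltW C0)//.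
  rewrite [leRHS]exprMn ler_pM2l// -(powR_mulrn n sp0) -powRrM -(powR_mulrn 2 s0).
  by rewrite ler_powR.
have z0 : 0 <= z by rewrite divr_ge0.
have H := le_trans zn (expr_le_expR n z z0).
apply: (@le_trans _ _ (expR (- z) * (9 * s ^+ 2))).
  by rewrite ler_wpM2l ?expR_ge0.
rewrite expRN mulrC ler_pdivrMr ?expR_gt0// /K2 -mulrA ler_wpM2l//.
by rewrite mulrAC ler_pdivlMr// mulrC.
Qed.

End growth.

(** * Triangular factorisation of the inverse Hessian *)

Section hessian_frame.
Context {R : realType}.
Implicit Types (H : 'M[R]_2).

Lemma posdef_quad H (u v : R) : posdefmx H -> (u, v) != (0, 0) ->
  0 < u * (u * H ord0 ord0) + u * (v * H ord0 ord_max)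
    + (v * (u * H ord_max ord0) + v * (v * H ord_max ord_max)).
Proof.
move=> pH uv; pose w : 'cV[R]_2 := \matrix_(i, _) (if i == ord0 then u else v).
have wN0 : w != 0.
  apply: contraNneq uv => /matrixP w0; apply/eqP; congr (_, _).
  - by have := w0 ord0 ord0; rewrite !mxE.
  - by have := w0 ord_max ord0; rewrite !mxE.
have := pH w wN0; rewrite !mxE.
rewrite -[\sum_(j < 2) _]/(isum _) isumE.
rewrite !mxE -![\sum_(j < 2) _]/(isum _) !isumE !mxE /=.
by congr (_ < _); ring.
Qed.

Definition frame (a b c : R) : 'M[R]_2 :=
  \matrix_(i, j) (if i == ord0 then (if j == ord0 then a else b)
                  else if j == ord0 then 0 else c).

Lemma mxE2 (A B : 'M[R]_2) i j :
  (A *m B) i j = A i ord0 * B ord0 j + A i ord_max * B ord_max j.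
Proof. by rewrite mxE -[LHS]/(isum _) isumE. Qed.

Lemma matrix2P (A B : 'M[R]_2) :
  A ord0 ord0 = B ord0 ord0 -> A ord0 ord_max = B ord0 ord_max ->
  A ord_max ord0 = B ord_max ord0 -> A ord_max ord_max = B ord_max ord_max -> A = B.
Proof.
move=> e00 e01 e10 e11; have ordE (k : 'I_2) : k = ord0 \/ k = ord_max.
  by case: k => [[|[|//]] k2]; [left|right]; exact/val_inj.
by apply/matrixP => i j; case: (ordE i) (ordE j) => -> [] ->.
Qed.

(** A Cholesky factorisation with explicit entries: with q = sqrt h00 and d = sqrt(det H), take a =
    1/q, b = -h01/(q d), c = q/d. The last clause says that L^T H L is the identity. *)
Lemma frame_exists H : posdefmx H -> H ord_max ord0 = H ord0 ord_max ->
  exists a b c : R, [/\ 0 < a, 0 < c, invmx H = frame a b c *m (frame a b c)^T,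
    Num.sqrt (\det (invmx H)) = a * c &
    forall u v : R, let x := a * u + b * v in let y := c * v in
      x * (x * H ord0 ord0) + x * (y * H ord0 ord_max)
      + (y * (x * H ord0 ord_max) + y * (y * H ord_max ord_max)) = u ^+ 2 + v ^+ 2].
Proof.
move=> pH hs; set h00 := H ord0 ord0; set h01 := H ord0 ord_max in hs *.
set h11 := H ord_max ord_max.
have quad u v := posdef_quad H u v pH; rewrite hs -/h00 -/h01 -/h11 in quad.
have h0 : 0 < h00.
  have := quad 1 0; rewrite xpair_eqE oner_eq0 /= => /(_ isT).
  by rewrite !mul0r !mul1r !addr0.
pose D := h00 * h11 - h01 ^+ 2.
have D0 : 0 < D.
  (* At (-h01, h00) the quadratic form equals h00 det H, so the determinant is positive. *)
  have := quad (- h01) h00; rewrite xpair_eqE (gt_eqF h0) andbF => /(_ isT).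
  rewrite (_ : _ + _ = h00 * D) ?pmulr_rgt0//.
  by rewrite /D; ring.
pose q := Num.sqrt h00; pose d := Num.sqrt D.
have q0 : 0 < q by rewrite sqrtr_gt0.
have d0 : 0 < d by rewrite sqrtr_gt0.
have qq : h00 = q ^+ 2 by rewrite sqr_sqrtr// ltW.
have dd : h11 = (d ^+ 2 + h01 ^+ 2) / q ^+ 2.
  by rewrite sqr_sqrtr ?(ltW D0)// /D -qq; field; rewrite gt_eqF.
have qN : q != 0 by rewrite gt_eqF.
have dN : d != 0 by rewrite gt_eqF.
pose a := q^-1; pose c := q / d; pose b := - h01 / (q * d).
have HL : H *m (frame a b c *m (frame a b c)^T) = 1%:M.
  apply: matrix2P; rewrite !mxE2 !mxE /= ?hs -?/h00 -/h01 -?/h11 ?qq ?dd /a /b /c;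
    by field; rewrite ?qN ?dN.
have Hu : H \in unitmx by have [] := mulmx1_unit HL.
have QE : invmx H = frame a b c *m (frame a b c)^T.
  by rewrite -[LHS]mulmx1 -HL mulKmx.
exists a, b, c; split.
- by rewrite invr_gt0.
- by rewrite divr_gt0.
- exact: QE.
- have -> : \det (invmx H) = (a * c) ^+ 2.
    rewrite QE det_mulmx det_tr -expr2; congr (_ ^+ 2).
    rewrite -det_tr det_trig.
      by rewrite big_ord_recl big_ord1 !mxE.
    apply/is_trig_mxP => i j; rewrite !mxE.
    by case: i j => [[|[|//]] ?] [[|[|//]] ?].
  by rewrite sqrtr_sqr gtr0_norm// mulr_gt0 ?invr_gt0 ?divr_gt0.
- move=> u v x y; rewrite qq dd /x /y /a /b /c; field; rewrite ?qN ?dN//.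
Qed.

End hessian_frame.

(** * The Hessian at the minimum of S *)

Section critical_point.
Context {R : realType}.
Variables (S : R * R -> R) (xi : R * R).
Hypothesis S_smooth : smooth S.
Hypothesis S_ge0 : forall x, 0 <= S x.
Hypothesis S_xi : S xi = 0.
Hypothesis S_crit : Defs.critical_point S xi.
Let jet (s : seq 'I_2) : R := partials s S xi.

Lemma polar1_crit v : polar 1 jet v = 0.
Proof.
rewrite polarS /isum big1// => i _; rewrite /polar /= big_nil mulr1.
by rewrite /jet S_crit mulr0.
Qed.

(** S attains its minimum 0 at xi. If the quadratic form had a negative value p, Taylor's formula
    would make S(xi + s v) at most s^2 p/4 < 0 for small s. *)
Lemma polar2_ge0 v : 0 <= polar 2 jet v.
Proof.
have [C C0 HC] := taylor2 S xi 3 S_smooth.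
rewrite leNgt; apply/negP => p0; set p := polar 2 jet v in p0.
have N0 := norm1_ge0 v; set N := norm1 v in N0.
have k0 : 0 < 1 + N by rewrite ltr_pwDl.
have CN : 0 < 1 + C * N ^+ 3 by rewrite ltr_pwDl// mulr_ge0// exprn_ge0.
(* The first bound keeps s v in the range of Taylor's formula; the second makes the cubic remainder
   at most -s^2 p/4. *)
pose s := Num.min (1 + N)^-1 (- p / 4 / (1 + C * N ^+ 3)).
have s0 : 0 < s by rewrite lt_min invr_gt0 k0 !divr_gt0// oppr_gt0.
have s1 : norm1 (s *: v) <= 1.
  rewrite norm1Z ?(ltW s0)// (@le_trans _ _ ((1 + N)^-1 * N))//.
    by rewrite ler_wpM2r// /s ge_min lexx.
  by rewrite ler_pdivrMl// mulr1 lerDr.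
have s2 : C * s * N ^+ 3 <= - p / 4.
  have : s * (1 + C * N ^+ 3) <= - p / 4.
    by rewrite -ler_pdivlMr// /s ge_min lexx orbT.
  apply: le_trans; rewrite mulrDr mulr1 (_ : C * s * _ = s * (C * N ^+ 3)).
    by rewrite ler_wpDl// ltW.
  by ring.
have := HC _ s1; rewrite -/jet !big_ord_recl big_ord0 !polarZ polar1_crit -/p.
have -> : polar 0 jet v = 0 by rewrite /polar /= big_nil mulr1 /jet.
rewrite !mulr0 !mul0r !add0r addr0 norm1Z ?(ltW s0)// -/N ler_norml => /andP[_ H].
have := S_ge0 (xi + s *: v); move: H; move: (S _) => z.
have -> : s ^+ 2 * p / 2`!%:R = s ^+ 2 * (p / 2) by rewrite mulrA.
have -> : C * (s * N) ^+ 3 = s ^+ 2 * (C * s * N ^+ 3) by ring.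
have ss : 0 < s ^+ 2 by rewrite exprn_gt0.
have sp : s ^+ 2 * (C * s * N ^+ 3) <= s ^+ 2 * (- p / 4) by rewrite ler_pM2l.
have pp : s ^+ 2 * p < 0 by rewrite pmulr_rlt0.
move: sp; move: (s ^+ 2 * (C * s * N ^+ 3)) => w.
have -> : s ^+ 2 * (- p / 4) = - (s ^+ 2 * p) / 4 by ring.
rewrite (mulrA (s ^+ 2)); move: pp; move: (s ^+ 2 * p) => q.
by lra.
Qed.

Lemma polar2E v : polar 2 jet v =
  v.1 * (v.1 * hessian S xi ord0 ord0) + v.1 * (v.2 * hessian S xi ord0 ord_max)
  + (v.2 * (v.1 * hessian S xi ord_max ord0)
     + v.2 * (v.2 * hessian S xi ord_max ord_max)).
Proof.
have hE i j : hessian S xi i j = jet [:: i; j] by rewrite mxE.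
rewrite !hE; move: (jet) => T.
rewrite polarS isumE !polarS !isumE /Defs.coord /polar /= !big_nil !mulr1.
by rewrite !mulrDr.
Qed.

(** Negative definiteness is excluded by [polar2_ge0] at the vector (1, 0). *)
Lemma posdef_hessian : nondegenerate_critical_point S xi -> posdefmx (hessian S xi).
Proof.
case=> _ [//|nH]; have := polar2_ge0 (1, 0); rewrite polar2E /=.
have := posdef_quad _ 1 0 nH; rewrite xpair_eqE oner_eq0 /= => /(_ isT).
by rewrite !mul0r !mul1r !addr0 mxE; lra.
Qed.

Lemma hessian_sym : hessian S xi ord_max ord0 = hessian S xi ord0 ord_max.
Proof. by rewrite !mxE; exact: (symmetric_partials S xi S_smooth [::]). Qed.

End critical_point.

(** * From the expansion in e to the expansion in t *)

Section expansion.
Context {R : realType}.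
Notation mu := (@lebesgue_measure R).
Notation mu2 := (mu \x mu)%E.

Lemma sigmaE (x y : R * R) : Defs.sigma x y = sq (x - y) / 2.
Proof.
rewrite /Defs.sigma -[\sum_(i < 2) _]/(isum _) isumE /Defs.coord /= /sq mulrC.
by case: x y => ? ? [].
Qed.

Lemma S_of_ge0 Phi (x : R * R) : 0 <= S_of Phi x.
Proof. by rewrite /S_of sigmaE divr_ge0// sq_ge0. Qed.

Lemma S_of_eq0 Phi (x : R * R) : S_of Phi x = 0 <-> Phi x = x.
Proof.
rewrite /S_of sigmaE; split=> [/eqP|->]; last first.
  by rewrite subrr /sq /= expr0n /= addr0 mul0r.
rewrite mulf_eq0 invr_eq0 pnatr_eq0 orbF /sq paddr_eq0 ?sqr_ge0//.
rewrite !sqrf_eq0; case: (Phi x) => u v; case: x => u' v' /=.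
by rewrite !subr_eq0 => /andP[/eqP -> /eqP ->].
Qed.

Lemma even_terms (g : nat -> R) (e : R) n : (forall m, odd m -> g m = 0) ->
  \sum_(m < n.*2) e ^+ m * g m = \sum_(k < n) (e ^+ 2) ^+ k * g k.*2.
Proof.
move=> g0; elim: n => [|n IH]; first by rewrite !big_ord0.
rewrite doubleS !big_ord_recr /= IH (g0 n.*2.+1) ?mulr0 ?addr0; last first.
  by rewrite /= odd_double.
by rewrite -exprM mul2n.
Qed.

(** An error O(t^(K+1)) is o(t^K). The range of t up to 1/2 corresponds to e at most 1 under e^2 =
    2t. *)
Lemma asymptotic_expansion_bound (F : R -> R) (A : nat -> R) :
  (forall K : nat, exists2 C : R, 0 <= C & forall t, 0 < t <= 2^-1 ->
    `|F t - \sum_(k < K.+1) t ^+ k * A k| <= C * t ^+ K.+1) ->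
  asymptotic_expansion F A.
Proof.
move=> H K; have [C C0 HC] := H K; apply/eqoP => eps eps0.
have k0 : 0 < C + 1 by rewrite ltr_wpDl.
near=> t.
have t0 : 0 < t by near: t; exact: nbhs_right_gt.
have t2 : t <= 2^-1.
  by apply/ltW; near: t; apply: nbhs_right_lt; rewrite invr_gt0.
have te : t < eps / (C + 1).
  by near: t; apply: nbhs_right_lt; rewrite divr_gt0.
rewrite (le_trans (HC t _)) ?t0// (ger0_norm (exprn_ge0 _ (ltW t0))).
rewrite exprS mulrA ler_wpM2r ?exprn_ge0 ?(ltW t0)//.
move: te; rewrite ltr_pdivlMr// => /ltW; apply: le_trans.
by rewrite mulrC ler_wpM2l ?(ltW t0)// lerDl.
Unshelve. all: by end_near. Qed.

End expansion.

Theorem lemma3p4 (R : realType) (Phi : R * R -> R * R) (xi0 : R * R)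
  (Phi_smooth : smooth_map Phi)
  (Phi1 : [set x | Phi x = x] = [set xi0])
  (Phi2 : exists p r C : R, [/\ 0 < p, 0 < r, 0 < C &
     forall x : R * R, r ^+ 2 / 2 < sigma x (0, 0) ->
       C * (sigma x (0, 0)) `^ p <= S_of Phi x])
  (Phi3 : nondegenerate_critical_point (S_of Phi) xi0) :
  let S := fun s : seq 'I_2 => partials s (S_of Phi) xi0 in
  let Q := invmx (hessian (S_of Phi) xi0) in
  exists A : nat -> R,
    [/\ asymptotic_expansion (deformed_heat_trace Phi) A,
        A 0%N = coefA0 Q,
        A 1%N = coefA1 S Q &
        A 2%N = coefA2 S Q].
Proof.
move=> T Q; have [p [r [C [p0 r0 C0 growth]]]] := Phi2.
pose S := S_of Phi; have sS : smooth S by exact: smooth_S_of.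
have [cS _] := smoothP _ sS.
have fixP x : Phi x = x <-> x = xi0.
  by have := congr1 (fun A : set (R * R) => A x) Phi1; rewrite /= => ->.
have S0 : S xi0 = 0 by apply/S_of_eq0/fixP.
have Sge : forall x, 0 <= S x by exact: S_of_ge0.
have Spos x : x != xi0 -> 0 < S x.
  move=> /eqP xN; rewrite lt_def Sge andbT; apply/eqP => Sx0; apply: xN.
  by apply/fixP/S_of_eq0.
have {}growth x : r ^+ 2 / 2 < sq x / 2 -> C * (sq x / 2) `^ p <= S x.
  by have := growth x; rewrite sigmaE subr0.
have Scrit := Phi3.1.
have [a [b [c [a0 c0 QE detQ quad]]]] := frame_exists _
  (posdef_hessian S xi0 sS Sge S0 Scrit Phi3) (hessian_sym S xi0 sS).
have Shess y : polar 2 T (tri a b c y) = sq y.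
  by rewrite polar2E hessian_sym//; exact: quad.
have crit := polar1_crit S xi0 Scrit.
have away := away_bound S cS p r C p0 r0 C0 growth xi0 Spos.
have Sint := integrable_growth S cS Sge p r C p0 r0 C0 growth.
pose w := wser S xi0 a b c.
pose g m := gint (expseries w m).
have g_odd m : odd m -> g m = 0 by exact: gint_cf_odd.
have pi0 := pi_gt0 R.
(* The heat kernel prefactor 1/(4 pi t) times the Jacobian e^2 a c, with e^2 = 2t; the factor 2^k in
   [A] below comes from e^(2k) = 2^k t^k. *)
pose kappa := a * c / (2 * pi).
have kappa0 : 0 < kappa by rewrite divr_gt0// mulr_gt0.
pose A k := 2 ^+ k * kappa * g k.*2.
have traceE t : 0 < t <= 2^-1 ->
    deformed_heat_trace Phi t = kappa * lint S xi0 a b c (Num.sqrt (2 * t)).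
  move=> /andP[t0 t2]; set e := Num.sqrt (2 * t).
  have tt0 : 0 < 2 * t by rewrite mulr_gt0.
  have e2 : e ^+ 2 = 2 * t by rewrite sqr_sqrtr// ltW.
  have e01 : 0 < e <= 1.
    rewrite sqrtr_gt0 tt0 /= -[leRHS]sqrtr1 ler_sqrt//.
    by rewrite mulrC -ler_pdivlMr// mul1r.
  have [_ E] := integrable_phase S xi0 a b c sS a0 c0 Sge Sint e e01.
  have ki : 0 < e ^+ 2 <= 2.
    rewrite e2 tt0 /= (@le_trans _ _ 1)// ?ler1n// mulrC -ler_pdivlMr// mul1r.
    exact: t2.
  have hi := integrable_expRN S sS Sge Sint (e ^+ 2) ki.
  rewrite /deformed_heat_trace /heat_kernel.
  transitivity ((4 * pi * t)^-1 *
      \int[(@lebesgue_measure R \x @lebesgue_measure R)%E]_x expR (- (S x / e ^+ 2))).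
    rewrite -(RintegralZl _ measurableT hi); apply: eq_Rintegral => x _.
    by rewrite e2.
  rewrite E e2 /kappa; move: (pi : R) pi0 => P P0; field.
  by rewrite !gt_eqF.
exists A; split.
- apply: asymptotic_expansion_bound => K.
  (* Order 2(K+1) in e gives an error (2t)^(K+1) and, odd terms being zero, exactly the powers of t
     up to K. *)
  have [M M0 HM] := lint_expansion S xi0 a b c sS a0 c0 Sge S0 crit Shess away Sint K.+1.*2.
  exists (kappa * (M * 2 ^+ K.+1)).
    by apply: mulr_ge0; [exact: ltW|apply: mulr_ge0 => //; exact: exprn_ge0].
  move=> t /[dup] t02 /andP[t0 t2]; rewrite traceE//.
  set e := Num.sqrt (2 * t).
  have tt0 : 0 < 2 * t by rewrite mulr_gt0.
  have e2 : e ^+ 2 = 2 * t by rewrite sqr_sqrtr// ltW.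
  have e01 : 0 < e <= 1.
    rewrite sqrtr_gt0 tt0 /= -[leRHS]sqrtr1 ler_sqrt//.
    by rewrite mulrC -ler_pdivlMr// mul1r.
  have := HM e e01; rewrite (even_terms g)// e2 => H.
  have -> : \sum_(k < K.+1) t ^+ k * A k =
      kappa * \sum_(k < K.+1) (2 * t) ^+ k * g k.*2.
    by rewrite mulr_sumr; apply: eq_bigr => k _; rewrite /A exprMn; ring.
  rewrite -mulrBr normrM gtr0_norm// -mulrA ler_pM2l// (le_trans H)//.
  by rewrite -mul2n exprM e2 exprMn mulrA.
- rewrite /A /coefA0 detQ expr0 mul1r /g gint_expseries0 /kappa.
  by move: (pi : R) pi0 => P P0; field; rewrite gt_eqF.
(* The pulled back jet is symmetric, hence given by numbers [cc n j], and each [w m] with m at most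
   4 is its Taylor form of degree m + 2. The Gaussian identities then apply. *)
all: have symT := symmetric_pull (frame a b c) T (symmetric_partials S xi0 sS).
all: have TE := symtensorP _ symT.
all: set cc := (fun n j : nat => _) in TE.
all: have wE m y : (0 < m <= 4)%N -> w m y = hform (taylor_form cc m.+2) y.1 y.2.
1,3: case: m => [//|m] m4; rewrite -polar_symtensor//.
1,2: rewrite -TE -(polar_pull _ _ _ (tri a b c y))//.
1,2: move=> i; rewrite isumE /Defs.coord !mxE; case: (i == ord0) => //=.
1,2: by rewrite mul0r add0r.
- rewrite (coefA1_pull (frame a b c))// TE detQ /A expr1.
  have := gint_expseries2 w cc (fun=> erefl) wE; rewrite -/(g 2%N) => E.
  rewrite (_ : 2 * kappa * _ = kappa * (2 * g 2%N)); last by rewrite mulrA (mulrC 2).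
  by rewrite E /kappa; move: (pi : R) pi0 => P P0; field; rewrite gt_eqF.
- rewrite (coefA2_pull (frame a b c))// TE detQ /A.
  have := gint_expseries4 w cc (fun=> erefl) wE; rewrite -/(g 4%N) => E.
  rewrite (_ : 2 ^+ 2 * kappa * _ = kappa * (4 * g 4%N)); last by rewrite expr2; ring.
  by rewrite E /kappa; move: (pi : R) pi0 => P P0; field; rewrite gt_eqF.
Qed.
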